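(* A pair of third order ODEs is variational if and only if its invariants $\mathbf b_1$, $\mathbf b_2$ and $\mathbf b_3$ vanish, i.e. $\mathsf b_{10}=\mathsf b_{11}=\mathsf b_{12}=\mathsf b_{13}=0$, $\mathsf b_{20}=\mathsf b_{21}=\mathsf b_{22}=0$, $\mathsf b_{30}=0$.
   Context: **ODEs.** A pair of third order ODEs $y^i_3=F^i(x,y^j_0,y^j_1,y^j_2)$, $i,j=1,2$, is variational if there exist (locally) a non-singular matrix $[B_{ij}]$ of smooth functions and a Lagrangian $\mathcal L$ with $E_j(\mathcal L)=\sum_iB_{ij}(y^i_3-F^i)$, where $E_j(\mathcal L)=\sum_s(-1)^s(\frac d{dx})^s\frac{\partial\mathcal L}{\partial y^j_s}$ is the Euler–Lagrange operator. The equation manifold $\mathcal C\subset J^3(\mathbb R,\mathbb R^2)$, locally $J^2(\mathbb R,\mathbb R^2)$, carries the distribution $T^{-1}\mathcal C=\mathcal E\oplus\mathcal V$, $\mathcal E$ the line field tangent to lifted solutions, $\mathcal V=\langle\partial_{y^1_2},\partial_{y^2_2}\rangle$. **Cartan connection.** Let $\mathfrak g=\mathfrak{so}(3,4)$, $\mathfrak q$ the stabilizer of a flag (null 2-plane)$\subset$(null 3-plane), $\mathfrak p$ the stabilizer of the null 2-plane, with compatible gradings $\bigoplus_{-4}^4\mathfrak q_i$, $\bigoplus_{-2}^2\mathfrak p_i$, $\mathfrak q_0\subset\mathfrak p_0$. Put $\mathfrak k=(\mathfrak p_{-2}\oplus\mathfrak p_{-1}\oplus\mathfrak p_0)/\mathfrak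 p_{-2}\cong(\mathfrak{sl}(2,\mathbb R)\oplus\mathfrak{gl}(2,\mathbb R))\ltimes(\mathbb R^2\otimes\mathrm{Sym}^2\mathbb R^2)$ with grading $\mathfrak k_{-3}\oplus\dots\oplus\mathfrak k_1$ induced from the $\mathfrak q$-grading, $\mathfrak l=\mathfrak k_0\oplus\mathfrak k_1$, $L=\mathrm{SL}(2,\mathbb R)\times B$, $B\subset\mathrm{GL}(2,\mathbb R)$ Borel. A pair of third order ODEs (up to point transformations) defines a regular normal Cartan geometry $(\tau:\mathcal G\to\mathcal C,\psi)$ of type $(\mathfrak k,L)$; regular: curvature function of positive homogeneity; normal: curvature function in the kernel of the restriction to $\wedge^2(\mathfrak k/\mathfrak l)^*\otimes\mathfrak k$ of the adjoint of the Lie algebra cohomology differential $\mathfrak k^*\otimes\mathfrak k\to\wedge^2\mathfrak k^*\otimes\mathfrak k$ for the inner product $-B_{\mathfrak g}(\cdot,\theta\cdot)$ on $\mathfrak p_{-1}\oplus\mathfrak p_0\cong\mathfrak k$ ($B_{\mathfrak g}$ Killing form, $\theta$ a Cartan involution with $\theta(\mathfrak q_i)=\mathfrak q_{-i}$). Write ($1\le a,b\le3$) $$\psi=\begin{pmatrix}\phi_0+\mu&\xi_0&0\\ \omega^0&\phi_1-\phi_0+\mu&0\\ \omega^a&\theta^a&\phi^a_b+\mu\delta^a_b\end{pmatrix},\quad[\phi^a_b]=\begin{pmatrix}-\phi_2&-\gamma_0&0\\ \theta^0&0&\gamma_0\\0&-\theta^0&\phi_2\end{pmatrix},\quad\mu=-\tfrac15\phi_1,$$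 with $\mathcal E=\tau_*\langle\partial/\partial\theta^0\rangle$, $\mathcal V=\tau_*\langle\partial/\partial\omega^1,\partial/\partial\theta^1\rangle$. **Invariants.** Let $\Omega^a$, $\Theta^a$ be the entries of the curvature $d\psi+\psi\wedge\psi$ in the places of $\omega^a,\theta^a$. The normal curvature satisfies the following, which define the $\mathsf b_{ij}$: in $\Omega^3$ the coefficients of $\theta^2\wedge\theta^3$, $\omega^2\wedge\theta^3$, $\omega^2\wedge\omega^3$ are $-\mathsf b_{10},-\mathsf b_{11},-\mathsf b_{12}$, and in $\Theta^3$ the coefficient of $\omega^2\wedge\omega^3$ is $\mathsf b_{13}$; in $\Omega^2$ the coefficients of $\theta^0\wedge\theta^3$ and $\omega^3\wedge\theta^0$ are $\mathsf b_{20}$ and $-\mathsf b_{21}$, and in $\Theta^2$ the coefficient of $\omega^3\wedge\theta^0$ is $\mathsf b_{22}$; $\mathsf b_{30}$ is the coefficient of $\omega^3\wedge\theta^0$ in $\Omega^1$ minus the coefficient of $\theta^0\wedge\theta^3$ in $\Theta^1$. Then (pulled back by a section of $\mathcal G\to\mathcal C$) $\mathbf b_1=(\mathsf b_{13}(\omega^1)^3+3\mathsf b_{12}(\omega^1)^2\circ\theta^1+3\mathsf b_{11}\omega^1\circ(\theta^1)^2+\mathsf b_{10}(\theta^1)^3)\otimes(\frac{\partial}{\partial\theta^1}\wedge\frac{\partial}{\partial\omega^1})\otimes(\frac{\partial}{\partial\theta^0})^{-1}$, $\mathbf b_2=(\mathsf b_{22}(\omega^1)^2+2\mathsf b_{21}\omega^1\circ\theta^1+\mathsf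 b_{20}(\theta^1)^2)\otimes(\frac{\partial}{\partial\theta^1}\wedge\frac{\partial}{\partial\omega^1})\otimes(\frac{\partial}{\partial\theta^0})^{-2}$, $\mathbf b_3=\mathsf b_{30}(\frac{\partial}{\partial\theta^0})^{-3}$. *)

(* Defs.v *)
From HB Require Import structures.
From mathcomp Require Import all_boot all_order all_algebra.
From mathcomp Require Import mathcomp_extra boolp classical_sets functions.
From mathcomp Require Import reals topology normedtype derive.
From mathcomp Require Import ring lra.

Set Implicit Arguments.
Unset Strict Implicit.
Unset Printing Implicit Defensive.

Import Order.TTheory GRing.Theory Num.Theory.
Import numFieldNormedType.Exports.

Local Open Scope classical_set_scope.
Local Open Scope ring_scope.

Section Smooth.
Variables (R : realType) (n : nat).
Implicit Types (U : set 'rV[R]_n.+1) (f : 'rV[R]_n.+1 -> R).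

Definition pd (i : 'I_n.+1) f : 'rV[R]_n.+1 -> R :=
  fun p => 'D_(delta_mx 0 i) f p.

Fixpoint Ck_on (m : nat) U f : Prop :=
  (forall p, U p -> {for p, continuous f}) /\
  (if m is m'.+1 then
     forall i, (forall p, U p -> derivable f p (delta_mx 0 i)) /\
               Ck_on m' U (pd i f)
   else True).

Definition smooth_on U f : Prop := forall m, Ck_on m U f.

End Smooth.

(* J^k(R,R^2) is R^(1+2(k+1)); coordinate 0 is x and coordinate 1+2s+j is the
   s-th derivative y^j_s, where j ranges over 'I_2 = {0,1}.  In particular
   J^2(R,R^2) is R^7. *)

Definition jdim (k : nat) : nat := (k.+1).*2.+1.

Definition jx {k : nat} : 'I_(jdim k) := ord0.
Definition jy {k : nat} (s : nat) (j : 'I_2) : 'I_(jdim k) := inord (1 + s.*2 + j).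

Section Variational.
Variable R : realType.

(* the projection J^m -> J^k, for k <= m *)
Definition jtrunc (m k : nat) (z : 'rV[R]_(jdim m)) : 'rV[R]_(jdim k) :=
  \row_i z 0 (inord i : 'I_(jdim m)).

(* d/dx acting on (pullbacks to J^m of) functions of order < m; on such
   functions the missing derivatives in the y^j_m vanish anyway. *)
Definition Dx (m : nat) (g : 'rV[R]_(jdim m) -> R) : 'rV[R]_(jdim m) -> R :=
  fun z => pd jx g z +
    \sum_(s < m) \sum_(j < 2) z 0 (jy s.+1 j) * pd (jy s j) g z.

(* E_j(L) for L of order k: dL/dy^j_s has order k and is differentiated
   s <= k times, so that everything lives on J^(2k). *)
Definition euler_lagrange (k : nat) (L : 'rV[R]_(jdim k) -> R) (j : 'I_2) :
    'rV[R]_(jdim (2 * k)) -> R :=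
  fun z => \sum_(s < k.+1)
    (-1) ^+ s * iter s (@Dx (2 * k)) (pd (jy s j) (L \o @jtrunc (2 * k) k)) z.

(* The Lagrangian may have any order; since Lagrangians of order < 2 are also
   Lagrangians of order 2, taking k >= 2 is no restriction. *)
Definition variational (U : set 'rV[R]_(jdim 2))
    (F : 'I_2 -> 'rV[R]_(jdim 2) -> R) : Prop :=
  forall p, U p ->
  exists (V : set 'rV[R]_(jdim 2)) (B : 'rV[R]_(jdim 2) -> 'M[R]_2)
         (k : nat) (L : 'rV[R]_(jdim k) -> R),
    [/\ open V, V p & V `<=` U] /\
    [/\ forall i j, smooth_on V (fun q => B q i j),
        forall q, V q -> B q \in unitmx,
        (2 <= k)%N,
        smooth_on [set w | V (@jtrunc k 2 w)] L
      & forall z : 'rV[R]_(jdim (2 * k)), V (jtrunc 2 z) ->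
          forall j, euler_lagrange L j z =
            \sum_(i < 2) B (jtrunc 2 z) i j *
                         (z 0 (jy 3 i) - F i (jtrunc 2 z))].

(* spans the line field E *)
Definition solution_vector (F : 'I_2 -> 'rV[R]_(jdim 2) -> R)
    (p : 'rV[R]_(jdim 2)) : 'rV[R]_(jdim 2) :=
  delta_mx 0 jx + \sum_(i < 2)
    (p 0 (jy 1 i) *: delta_mx 0 (jy 0 i) +
     p 0 (jy 2 i) *: delta_mx 0 (jy 1 i) + F i p *: delta_mx 0 (jy 2 i)).

(* the rows span V *)
Definition vertical_vectors : 'M[R]_(2, jdim 2) :=
  \matrix_(i < 2) delta_mx 0 (jy 2 i).

End Variational.

(* Elements of k are given by their 13 coordinates; the coordinate functions
   are named as the entries of the Cartan connection.  The first seven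
   coordinates are coordinates on k/l; l is the span of the last six basis
   vectors. *)

Definition om1 : 'I_13 := @Ordinal 13 0 isT.
Definition om2 : 'I_13 := @Ordinal 13 1 isT.
Definition om3 : 'I_13 := @Ordinal 13 2 isT.
Definition th1 : 'I_13 := @Ordinal 13 3 isT.
Definition th2 : 'I_13 := @Ordinal 13 4 isT.
Definition th3 : 'I_13 := @Ordinal 13 5 isT.
Definition th0 : 'I_13 := @Ordinal 13 6 isT.
Definition ph0 : 'I_13 := @Ordinal 13 7 isT.
Definition ph1 : 'I_13 := @Ordinal 13 8 isT.
Definition ph2 : 'I_13 := @Ordinal 13 9 isT.
Definition xi0 : 'I_13 := @Ordinal 13 10 isT.
Definition om0 : 'I_13 := @Ordinal 13 11 isT.
Definition ga0 : 'I_13 := @Ordinal 13 12 isT.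

(* the eigenvalues of ad diag(2,2,1,0,-1,-2,-2), the grading element of the
   q-grading, under the identification k_to_so below *)
Definition kdeg (a : 'I_13) : int :=
  nth 0 [:: -1; -2; -3; -1; -2; -3; -1; 0; 0; 0; 0; 0; 1] a.

Section LieAlgebra.
Variable R : realType.

Definition mx_of_rows (m n : nat) (s : seq (seq R)) : 'M[R]_(m, n) :=
  \matrix_(i, j) nth 0 (nth [::] s i) j.

Definition kmx (x : 'rV[R]_13) : 'M[R]_5 :=
  let c a := x 0 a in
  let mu := - (c ph1 / 5) in
  mx_of_rows 5 5
   [:: [:: c ph0 + mu; c xi0;                0;            0;       0];
       [:: c om0;      c ph1 - c ph0 + mu;   0;            0;       0];
       [:: c om1;      c th1;                - c ph2 + mu; - c ga0; 0];
       [:: c om2;      c th2;                c th0;        mu;      c ga0];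
       [:: c om3;      c th3;                0;            - c th0; c ph2 + mu]].

(* coordinates of a matrix in the image of kmx *)
Definition kcoord (Z : 'M[R]_5) : 'rV[R]_13 :=
  let z (i j : nat) := Z (inord i) (inord j) in
  \row_a nth 0
    [:: z 2%N 0%N; z 3%N 0%N; z 4%N 0%N; z 2%N 1%N; z 3%N 1%N; z 4%N 1%N;
        z 3%N 2%N; z 0%N 0%N - z 3%N 3%N; - (5 * z 3%N 3%N);
        z 4%N 4%N - z 3%N 3%N; z 0%N 1%N; z 1%N 0%N; z 3%N 4%N] a.

Lemma kmxK : cancel kmx kcoord.
Proof.
move=> x; apply/rowP => a; rewrite !mxE !inordK // -[RHS]/(x ord0 a).
case: a => -[|[|[|[|[|[|[|[|[|[|[|[|[|//]]]]]]]]]]]]] h /=;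
[>rewrite (_ : Ordinal h = om1); last exact: val_inj
 | rewrite (_ : Ordinal h = om2); last exact: val_inj
 | rewrite (_ : Ordinal h = om3); last exact: val_inj
 | rewrite (_ : Ordinal h = th1); last exact: val_inj
 | rewrite (_ : Ordinal h = th2); last exact: val_inj
 | rewrite (_ : Ordinal h = th3); last exact: val_inj
 | rewrite (_ : Ordinal h = th0); last exact: val_inj
 | rewrite (_ : Ordinal h = ph0); last exact: val_inj
 | rewrite (_ : Ordinal h = ph1); last exact: val_inj
 | rewrite (_ : Ordinal h = ph2); last exact: val_inj
 | rewrite (_ : Ordinal h = xi0); last exact: val_inj
 | rewrite (_ : Ordinal h = om0); last exact: val_inj
 | rewrite (_ : Ordinal h = ga0); last exact: val_inj];
by field.
Qed.

Definition kbr (x y : 'rV[R]_13) : 'rV[R]_13 :=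
  kcoord (kmx x *m kmx y - kmx y *m kmx x).

Definition kbasis (a : 'I_13) : 'rV[R]_13 := delta_mx 0 a.

(* Signature (3,4).  The null 2-plane is spanned by the first two basis vectors
   and the null 3-plane by the first three. *)
Definition so_form : 'M[R]_7 :=
  mx_of_rows 7 7
   [:: [:: 0; 0;  0;  0;  0; 1; 0];
       [:: 0; 0;  0;  0;  0; 0; 1];
       [:: 0; 0;  0;  0; -1; 0; 0];
       [:: 0; 0;  0; -1;  0; 0; 0];
       [:: 0; 0; -1;  0;  0; 0; 0];
       [:: 1; 0;  0;  0;  0; 0; 0];
       [:: 0; 1;  0;  0;  0; 0; 0]].

Definition in_so (Z : 'M[R]_7) : Prop := Z^T *m so_form + so_form *m Z = 0.

(* the projection of gl(7) onto so(3,4) with kernel the so_form-symmetric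
   endomorphisms; note that so_form is its own inverse *)
Definition so_proj (Z : 'M[R]_7) : 'M[R]_7 :=
  2^-1 *: (Z - so_form *m Z^T *m so_form).

Definition commmx (n : nat) (X Y : 'M[R]_n) : 'M[R]_n := X *m Y - Y *m X.

(* tr (ad X ad Y) on so(3,4), computed as the trace on gl(7) of
   ad X o ad Y o so_proj, whose image is contained in so(3,4) *)
Definition killing_so (X Y : 'M[R]_7) : R :=
  \sum_i \sum_j (commmx X (commmx Y (so_proj (delta_mx i j)))) i j.

(* maps q_i to q_{-i} *)
Definition cartan_invol (Z : 'M[R]_7) : 'M[R]_7 := - Z^T.

(* The identification of k with p_{-1} + p_0: the diagonal blocks form p_0, and
   p_{-2} is the lower left 2x2 block. *)
Definition k_to_so (x : 'rV[R]_13) : 'M[R]_7 :=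
  let c a := x 0 a in
  mx_of_rows 7 7
   [:: [:: c ph0; c xi0;         0;       0;       0;     0;       0];
       [:: c om0; c ph1 - c ph0; 0;       0;       0;     0;       0];
       [:: c om1; c th1;         - c ph2; - c ga0; 0;     0;       0];
       [:: c om2; c th2;         c th0;   0;       c ga0; 0;       0];
       [:: c om3; c th3;         0;       - c th0; c ph2; 0;       0];
       [:: 0;     0;             c om3;   c om2;   c om1; - c ph0; - c om0];
       [:: 0;     0;             c th3;   c th2;   c th1; - c xi0; c ph0 - c ph1]].

Lemma k_to_so_in (x : 'rV[R]_13) : in_so (k_to_so x).
Proof.
rewrite /in_so /k_to_so /=.
move: (x 0 om1) (x 0 om2) (x 0 om3) (x 0 th1) (x 0 th2) (x 0 th3) (x 0 th0) 
  (x 0 ph0) (x 0 ph1) (x 0 ph2) (x 0 xi0) (x 0 om0) (x 0 ga0)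
  => a1 a2 a3 a4 a5 a6 a7 a8 a9 a10 a11 a12 a13.
apply/matrixP => i j.
rewrite !mxE !big_ord_recl !big_ord0 !mxE.
by case: i => -[|[|[|[|[|[|[|//]]]]]]] h /=;
case: j => -[|[|[|[|[|[|[|//]]]]]]] h' /=; ring.
Qed.

Definition kip (x y : 'rV[R]_13) : R :=
  - killing_so (k_to_so x) (cartan_invol (k_to_so y)).

Definition kgram : 'M[R]_13 := \matrix_(a, b) kip (kbasis a) (kbasis b).

(* A linear map k -> k is the matrix A acting by x |-> x *m A; a bilinear map
   k x k -> k is given by its values on the basis. *)

Definition kcochain2 := 'I_13 -> 'I_13 -> 'rV[R]_13.

Definition kdiff (A : 'M[R]_13) : kcochain2 := fun a b =>
  kbr (kbasis a) (kbasis b *m A) - kbr (kbasis b) (kbasis a *m A)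
    - kbr (kbasis a) (kbasis b) *m A.

(* the inner products induced by kip on k^* (x) k and on /\^2 k^* (x) k; the
   inner product on k^* has the inverse Gram matrix in the dual basis *)
Definition kip1 (A B : 'M[R]_13) : R :=
  \sum_a \sum_a' invmx kgram a a' * kip (row a A) (row a' B).

Definition kip2 (K H : kcochain2) : R :=
  2^-1 * \sum_a \sum_b \sum_a' \sum_b'
    invmx kgram a a' * invmx kgram b b' * kip (K a b) (H a' b').

Definition kadjoint (ds : kcochain2 -> 'M[R]_13) : Prop :=
  forall (K : kcochain2) (A : 'M[R]_13), kip1 (ds K) A = kip2 K (kdiff A).

(* A k-valued 1-form on (an open subset of) J^2 is a 7 x 13 matrix valued
   function psi: its value on the tangent vector v at p is v *m psi p. *)

Definition kform := 'rV[R]_7 -> 'M[R]_(7, 7 + 6).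

(* the coframe given by psi modulo l *)
Definition coframe (psi : kform) (p : 'rV[R]_7) : 'M[R]_7 := lsubmx (psi p).

(* Row a is the vector field d/d(omega^1), ..., d/d(theta^0) dual to the
   coframe, and 0 if the a-th basis vector of k is in l. *)
Definition dual_frame (psi : kform) (p : 'rV[R]_7) : 'M[R]_(7 + 6, 7) :=
  col_mx (invmx (coframe psi p)) 0.

(* (d psi + psi /\ psi) evaluated on the i-th and j-th coordinate fields *)
Definition curvature_mx (psi : kform) (p : 'rV[R]_7) (i j : 'I_7) : 'M[R]_5 :=
  let P k q := kmx (row k (psi q)) in
  (\matrix_(a, b) (pd i (fun q => P j q a b) p - pd j (fun q => P i q a b) p))
    + (P i p *m P j p - P j p *m P i p).

(* The curvature function, as an element of /\^2 (k/l)^* (x) k.  The component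
   c of its value at (a, b) is the coefficient of e^a /\ e^b in the component c
   of the curvature, where e^a is the a-th element of the coframe. *)
Definition curvature (psi : kform) (p : 'rV[R]_7) : kcochain2 := fun a b =>
  \sum_i \sum_j (dual_frame psi p a i * dual_frame psi p b j)
                  *: kcoord (curvature_mx psi p i j).

Definition b10 psi p : R := - curvature psi p th2 th3 0 om3.
Definition b11 psi p : R := - curvature psi p om2 th3 0 om3.
Definition b12 psi p : R := - curvature psi p om2 om3 0 om3.
Definition b13 psi p : R := curvature psi p om2 om3 0 th3.
Definition b20 psi p : R := curvature psi p th0 th3 0 om2.
Definition b21 psi p : R := - curvature psi p om3 th0 0 om2.
Definition b22 psi p : R := curvature psi p om3 th0 0 th2.
Definition b30 psi p : R :=
  curvature psi p om3 th0 0 om1 - curvature psi p th0 th3 0 th1.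

(* L = SL(2,R) x B, where B is the group of invertible upper triangular 2 x 2
   matrices C, acting on Sym^2 R^2 in the basis (u^2, 2uv, -2v^2); in this basis
   its Lie algebra acts by the matrices [phi^a_b] with theta^0 = 0, up to
   multiples of the identity. *)

Definition in_L (S C : 'M[R]_2) : Prop :=
  [/\ \det S = 1, C \in unitmx & C 1 0 = 0].

Definition sym2B (C : 'M[R]_2) : 'M[R]_3 :=
  let a := C 0 0 in let c := C 0 1 in let d := C 1 1 in
  mx_of_rows 3 3
   [:: [:: a ^+ 2; 2 * a * c; - (2 * c ^+ 2)];
       [:: 0;      a * d;     - (2 * c * d)];
       [:: 0;      0;         d ^+ 2]].

(* Only defined up to a scalar: k consists of trace-free matrices, so the
   Maurer-Cartan form of L is the trace-free part of h^-1 dh. *)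
Definition Lmx (S C : 'M[R]_2) : 'M[R]_5 :=
  block_mx S 0 0 (sym2B C) : 'M[R]_(2 + 3).

Definition tracefree (Z : 'M[R]_5) : 'M[R]_5 := Z - (\tr Z / 5)%:M.

(* psi' = Ad(h^-1) psi + h^* omega_L at p, where h = (S, C) *)
Definition gauge_related (psi psi' : kform) (S C : 'rV[R]_7 -> 'M[R]_2)
    (p : 'rV[R]_7) : Prop :=
  let h q := Lmx (S q) (C q) in
  forall i : 'I_7,
    kmx (row i (psi' p)) =
    tracefree (invmx (h p) *m kmx (row i (psi p)) *m h p
      + invmx (h p) *m (\matrix_(a, b) pd i (fun q => h q a b) p)).

(* A Cartan geometry on an open subset U of J^2 presented by a Cartan atlas:
   the gauges are the pullbacks of the Cartan connection by local sections
   covering U, and (cg_S i j, cg_C i j) is the L-valued transition function. *)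
Record cartan_geometry (U : set 'rV[R]_7) := CartanGeometry {
  cg_index : Type;
  cg_dom : cg_index -> set 'rV[R]_7;
  cg_gauge : cg_index -> kform;
  cg_S : cg_index -> cg_index -> 'rV[R]_7 -> 'M[R]_2;
  cg_C : cg_index -> cg_index -> 'rV[R]_7 -> 'M[R]_2;
  cg_open : forall i, open (cg_dom i);
  cg_cover : \bigcup_i cg_dom i = U;
  cg_smooth : forall i a b, smooth_on (cg_dom i) (fun p => cg_gauge i p a b);
  cg_coframe : forall i p, cg_dom i p -> coframe (cg_gauge i) p \in unitmx;
  cg_transL : forall i j p, (cg_dom i `&` cg_dom j) p ->
    in_L (cg_S i j p) (cg_C i j p);
  cg_trans_smooth : forall i j a b,
    smooth_on (cg_dom i `&` cg_dom j) (fun p => cg_S i j p a b) /\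
    smooth_on (cg_dom i `&` cg_dom j) (fun p => cg_C i j p a b);
  cg_cocycle : forall i j k p, (cg_dom i `&` cg_dom j `&` cg_dom k) p ->
    cg_S i k p = cg_S i j p *m cg_S j k p /\
    cg_C i k p = cg_C i j p *m cg_C j k p;
  cg_compat : forall i j p, (cg_dom i `&` cg_dom j) p ->
    gauge_related (cg_gauge i) (cg_gauge j) (cg_S i j) (cg_C i j) p
}.

Definition cg_regular U (G : cartan_geometry U) : Prop :=
  forall i p, cg_dom (c := G) i p ->
  forall a b c, curvature (cg_gauge i) p a b 0 c != 0 ->
    kdeg a + kdeg b < kdeg c.

Definition cg_normal U (G : cartan_geometry U) : Prop :=
  exists2 ds, kadjoint ds &
    forall i p, cg_dom (c := G) i p -> ds (curvature (cg_gauge i) p) = 0.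

(* E is spanned by d/d(theta^0), and V by d/d(omega^1), d/d(theta^1). *)
Definition cg_of_ode U (F : 'I_2 -> 'rV[R]_7 -> R) (G : cartan_geometry U) :
    Prop :=
  forall i p, cg_dom (c := G) i p ->
    let X := dual_frame (cg_gauge i) p in
    (solution_vector F p == row th0 X)%MS /\
    (vertical_vectors R == row om1 X + row th1 X)%MS.

End LieAlgebra.

(* Main.v *)
(** The equations are variational iff, locally, there is a closed 2-form rho on
J^2 which annihilates the line field E spanned by D, vanishes on V x V and on
V x [E, V], and pairs V nondegenerately with the derivatives d/dy_0 (a Helmholtz
form).  Such a form is the vertical part of the differential of the Lepage form
of a Lagrangian, whose coefficients of high order vanish by descending induction
since E_j(L) has order three.  Conversely, by the Poincare lemma rho = d Theta,
where one may assume Theta(V) = 0, and then Theta(D) is a Lagrangian.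

In terms of the Cartan connection, put
rho_0 = omega^1 /\ theta^3 + omega^2 /\ theta^2 + omega^3 /\ theta^1.  The structure
equations give d rho_0 = phi_1 /\ rho_0 + T, where T is the contraction of the
curvature with rho_0.  Comparing homogeneous components in d rho = 0 shows that
a Helmholtz form is a multiple of rho_0 and that T is divisible by rho_0; by
normality and the Bianchi identity this forces the invariants to vanish.
Conversely, if the invariants vanish, normality and the lowest order parts of
the Bianchi identity kill the curvature in homogeneity 1 and 2 and T in
homogeneity 3; differentiating d rho_0 once more yields
d T - phi_1 /\ T + K^{phi_1} /\ rho_0 = 0, hence T = 0 and d phi_1 = 0, so that
exp(- int phi_1) rho_0 is a Helmholtz form.  The finitely many linear
implications between curvature components are decided by Gaussian elimination
over the integers. *)

Require Import Defs.
From HB Require Import structures.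
From Stdlib Require Import ZArith.
From mathcomp Require Import all_boot all_order all_algebra.
From mathcomp Require Import mathcomp_extra boolp classical_sets functions.
From mathcomp Require Import constructive_ereal reals topology normedtype sequences.
From mathcomp Require Import derive realfun exp measure lebesgue_measure.
From mathcomp Require Import lebesgue_integral ftc.
From mathcomp Require Import ring lra zify ssrZ.

Set Implicit Arguments.
Unset Strict Implicit.
Unset Printing Implicit Defensive.

Import Order.TTheory GRing.Theory Num.Theory.
Import numFieldNormedType.Exports.

Local Open Scope classical_set_scope.
Local Open Scope ring_scope.

(** * Smooth functions on open subsets of R^n *)

(** The form rho_0 is what remains in [k] of the bracket of p_{-1} with itself, whose values lie in
    the line p_{-2} that the quotient forgets. The Jacobi identity makes it invariant up to the
    character [ph1], which is why d rho_0 is phi_1 /\ rho_0 up to curvature. The obstacle is that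
    the Bianchi identity and d rho = 0 are differential equations. The grading removes the
    derivatives: once everything below homogeneity h vanishes, derivatives and non-leading
    connection coefficients drop out of the part of homogeneity h, leaving linear equations whose
    integer coefficients are the same at all points. T stops at homogeneity 4, since the three
    lowest degrees in k/l are -3, -3, -2 and rho_0 has degree -4. That a Helmholtz form is a
    multiple of rho_0 rests on the bracket with [th0], which carries the conditions on V and [E, V]
    from pairs of low weight to all pairs. The frame calculus is done over a commutative ring with
    commuting derivations; smooth functions enter by instantiating that ring. *)

Section SmoothTheory.
Variables (R : realType) (n : nat).
Implicit Types (U V : set 'rV[R]_n.+1) (f g : 'rV[R]_n.+1 -> R).

Lemma near_open_eq U f g p : open U -> U p -> (forall q, U q -> f q = g q) ->
  \near p, f p = g p.
Proof. by move=> oU Up fg; near=> q; apply: fg; near: q; exact: open_nbhs_nbhs. Unshelve. all: by end_near. Qed.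

Lemma pd_congr U f g i : open U -> (forall q, U q -> f q = g q) ->
  forall p, U p -> pd i f p = pd i g p.
Proof. by move=> oU fg p Up; apply: near_eq_derive; exact: (near_open_eq oU). Qed.

Lemma Ck_on_congr m U f g : open U -> (forall q, U q -> f q = g q) ->
  Ck_on m U f -> Ck_on m U g.
Proof.
move=> oU; elim: m f g => [|m IH] f g fg [cf df].
  split=> // p Up; have := cf _ Up; rewrite /prop_for /continuous_at (fg _ Up).
  exact: cvg_trans (near_eq_cvg (near_open_eq oU Up fg)).
split=> [p Up|i].
  have := cf _ Up; rewrite /prop_for /continuous_at (fg _ Up).
  exact: cvg_trans (near_eq_cvg (near_open_eq oU Up fg)).
have [d1 d2] := df i; split => [p Up|].
  by apply: near_eq_derivable (d1 _ Up); exact: (near_open_eq oU).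
by apply: IH d2 => q Uq; exact: (pd_congr _ oU fg).
Qed.

Lemma Ck_on_sub m U V f : V `<=` U -> Ck_on m U f -> Ck_on m V f.
Proof.
move=> VU; elim: m f => [|m IH] f [cf df].
  by split=> // p Vp; exact/cf/VU.
split=> [p Vp|i]; first exact/cf/VU.
by have [d1 d2] := df i; split => [p Vp|]; [exact/d1/VU|exact: IH].
Qed.

Lemma Ck_onS m U f : Ck_on m.+1 U f -> Ck_on m U f.
Proof.
elim: m f => [|m IH] f [cf df]; first by split.
by split=> // i; have [d1 d2] := df i; split => //; exact: IH.
Qed.

Lemma Ck_on_cst m U (a : R) : Ck_on m U (fun=> a).
Proof.
elim: m a => [|m IH] a; first by split=> // p _; exact: cst_continuous.
split=> [p _|i]; first exact: cst_continuous.
split=> [p _|]; first exact: derivable_cst.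
have -> : pd i (fun=> a) = (fun=> 0) :> ('rV[R]_n.+1 -> R).
  by apply/funext => p; rewrite /pd derive_cst.
exact: IH.
Qed.

Lemma Ck_onD m U f g : open U -> Ck_on m U f -> Ck_on m U g ->
  Ck_on m U (fun p => f p + g p).
Proof.
move=> oU; elim: m f g => [|m IH] f g [cf df] [cg dg].
  by split=> // p Up; exact: (cvgD (cf _ Up) (cg _ Up)).
split=> [p Up|i]; first exact: (cvgD (cf _ Up) (cg _ Up)).
have [df1 df2] := df i; have [dg1 dg2] := dg i.
split=> [p Up|]; first exact: (derivableD (df1 _ Up) (dg1 _ Up)).
apply: (@Ck_on_congr _ _ (fun p => pd i f p + pd i g p)) => // [q Uq|].
  by rewrite /pd -deriveD //; [exact: df1|exact: dg1].
exact: IH.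
Qed.

Lemma Ck_onM m U f g : open U -> Ck_on m U f -> Ck_on m U g ->
  Ck_on m U (fun p => f p * g p).
Proof.
move=> oU; elim: m f g => [|m IH] f g; last move=> Cf Cg.
  by move=> [cf _] [cg _]; split => // p Up; exact: (cvgM (cf _ Up) (cg _ Up)).
have [[cf df] [cg dg]] := (Cf, Cg); split => [p Up|i].
  exact: (cvgM (cf _ Up) (cg _ Up)).
have [df1 df2] := df i; have [dg1 dg2] := dg i.
split=> [p Up|]; first exact: (derivableM (df1 _ Up) (dg1 _ Up)).
apply: (@Ck_on_congr _ _ (fun p => f p * pd i g p + g p * pd i f p)) => // [q Uq|].
  by rewrite /pd -deriveM //; [exact: df1|exact: dg1].
by apply: Ck_onD => //; apply: IH => //; exact: Ck_onS.
Qed.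

Lemma Ck_onV m U f : open U -> (forall p, U p -> f p != 0) -> Ck_on m U f ->
  Ck_on m U (fun p => (f p)^-1).
Proof.
move=> oU f0; elim: m => [|m IH]; last move=> Cf.
  by move=> [cf _]; split => // p Up; apply: continuousV; [exact: f0|exact: cf].
have [cf df] := Cf; split => [p Up|i].
  by apply: continuousV; [exact: f0|exact: cf].
have [df1 df2] := df i.
split=> [p Up|]; first exact: (derivableV (f0 _ Up) (df1 _ Up)).
apply: (@Ck_on_congr _ _ (fun p => - 1 * ((f p)^-1 * (f p)^-1) * pd i f p)) => // [q Uq|].
  rewrite /pd (deriveV (f0 _ Uq) (df1 _ Uq)).
  by rewrite /GRing.scale /= -invfM expr2 mulN1r.
apply: Ck_onM => //; apply: Ck_onM => //; first exact: Ck_on_cst.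
by apply: Ck_onM => //; apply: IH; exact: Ck_onS.
Qed.

Lemma Ck_on_coord m U i : open U -> Ck_on m U (fun p => p 0 i).
Proof.
move=> oU; case: m => [|m].
  by split=> // p _; exact: coord_continuous.
split=> [p _|j]; first exact: coord_continuous.
have dx p : is_derive p (delta_mx 0 j : 'rV[R]_n.+1) (fun p : 'rV[R]_n.+1 => p 0 i)
    (i == j)%:R.
  apply: DeriveDef; first exact/diff_derivable/differentiable_coord.
  have lin : linear (fun p : 'rV[R]_n.+1 => p 0 i) by move=> a x y; rewrite !mxE.
  pose l : {linear 'rV[R]_n.+1 -> R} :=
    HB.pack (fun p : 'rV[R]_n.+1 => p 0 i) (GRing.isLinear.Build _ _ _ _ _ lin).
  rewrite deriveE; last exact: differentiable_coord.
  rewrite -[fun p : 'rV_n.+1 => p 0 i]/(l : _ -> _) diff_lin.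
    by rewrite /= mxE eqxx.
  exact: coord_continuous.
split=> [p _|]; first exact: ex_derive.
apply: (@Ck_on_congr _ _ (fun=> (i == j)%:R)) => // [q _|]; last exact: Ck_on_cst.
by rewrite /pd derive_val.
Qed.

Lemma pd_coord i j p : pd j (fun p : 'rV[R]_n.+1 => p 0 i) p = (i == j)%:R.
Proof.
have lin : linear (fun p : 'rV[R]_n.+1 => p 0 i) by move=> a x y; rewrite !mxE.
pose l : {linear 'rV[R]_n.+1 -> R} :=
  HB.pack (fun p : 'rV[R]_n.+1 => p 0 i) (GRing.isLinear.Build _ _ _ _ _ lin).
rewrite /pd deriveE; last exact: differentiable_coord.
rewrite -[fun p : 'rV_n.+1 => p 0 i]/(l : _ -> _) diff_lin.
  by rewrite /= mxE eqxx.
exact: coord_continuous.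
Qed.

End SmoothTheory.

(** * Directional derivatives of C^1 functions and symmetry of second derivatives *)

Section Lines.
Variables (R : realType) (n : nat).
Implicit Types (U : set 'rV[R]_n.+1) (f : 'rV[R]_n.+1 -> R) (p q v : 'rV[R]_n.+1).

(** Restricting to a line makes the mean value theorem of one variable available for directional
    derivatives. *)
Lemma line_is_derive f q v (s : R) : derivable f (s *: v + q) v ->
  is_derive s 1 (fun s => f (s *: v + q)) ('D_v f (s *: v + q)).
Proof.
have E : (fun h : R => h^-1 *: (((fun s => f (s *: v + q)) \o shift s) (h *: 1)
      - f (s *: v + q))) =
    (fun h => h^-1 *: ((f \o shift (s *: v + q)) (h *: v) - f (s *: v + q))).
  by apply/funext => h /=; rewrite [h%:A]mulr1 scalerDl addrA.
by move=> df; apply: DeriveDef; rewrite /derivable /derive E.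
Qed.

Lemma derive_scale f p v (c : R) : derivable f p v ->
  is_derive p (c *: v) f (c * 'D_v f p).
Proof.
move=> df; pose g (s : R) := f (s *: v + p).
have dg0 : is_derive (0 : R) 1 g ('D_v f p).
  by have := @line_is_derive f p v 0; rewrite scale0r add0r; apply.
have dm : is_derive (0 : R) 1 (c \*: (id : R -> R)) (c *: 1) by exact: is_deriveZ.
have dg : is_derive ((c \*: (id : R -> R)) 0) 1 g ('D_v f p).
  by rewrite [(_ \*: _) _]mulr0.
have E : (fun h => f (h *: (c *: v) + p)) = g \o (c \*: (id : R -> R)).
  by apply/funext => h /=; rewrite /g scalerA mulrC.
have [dgk vgk] := is_derive1_comp dg dm.
apply: DeriveDef; first by apply/derivable1P; rewrite E.
have -> : 'D_(c *: v) f p = 'D_1 (g \o (c \*: (id : R -> R))) (0 : R).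
  rewrite -E /derive; set g1 := fun h => h^-1 *: _; set g2 := fun h => h^-1 *: _.
  suff -> : g1 = g2 by [].
  by apply/funext => h; rewrite /g1 /g2 /= scale0r add0r addr0 [h%:A]mulr1.
by rewrite vgk [c *: 1]mulr1 mulrC.
Qed.

Lemma MVT_line f q v : (forall t : R, t \in `[0, 1] -> derivable f (t *: v + q) v) ->
  exists2 t : R, t \in `]0, 1[ & f (v + q) - f q = 'D_v f (t *: v + q).
Proof.
move=> df.
have [||t t01] := @MVT R (fun s => f (s *: v + q)) (fun s => 'D_v f (s *: v + q)) 0 1 ltr01.
- move=> t /andP[t0 t1]; apply/line_is_derive/df.
  by rewrite in_itv /= !ltW.
- apply: derivable_within_continuous => t t01.
  by case: (line_is_derive (df _ t01)).
rewrite scale1r scale0r add0r subr0 mulr1 => ->; by exists t.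
Qed.

Lemma MVT_pd U f q i (c : R) : (forall p, U p -> derivable f p (delta_mx 0 i)) ->
  (forall t : R, t \in `[0, 1] -> U ((t * c) *: delta_mx 0 i + q)) ->
  exists2 t : R, t \in `]0, 1[ &
    f (c *: delta_mx 0 i + q) - f q = c * pd i f ((t * c) *: delta_mx 0 i + q).
Proof.
move=> df Uq; have [t t01|t t01 ->] := @MVT_line f q (c *: delta_mx 0 i).
  have /(derive_scale c) := df _ (Uq _ t01).
  by rewrite scalerA; case.
exists t => //; rewrite scalerA /pd.
apply: (derive_val (is_derive := derive_scale c (df _ (Uq t _)))).
by move: t01; rewrite !in_itv /= => /andP[? ?]; rewrite !ltW.
Qed.

Lemma ball_rowP p q (e : R) : 0 < e ->
  (forall i, `|q 0 i - p 0 i| < e) -> ball p e q.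
Proof.
by move=> e0 H; split => // a b; rewrite ord1 /ball /= distrC.
Qed.

(** Changing one coordinate at a time splits the difference quotient along [v] into quotients with a
    single varying coordinate. Each is a partial derivative at a nearby point by the mean value
    theorem, and continuity of the partials gives the limit. *)
Lemma C1_is_derive U f p v : open U -> Ck_on 1 U f -> U p ->
  is_derive p v f (\sum_i v 0 i * pd i f p).
Proof.
move=> oU [_ Cf] Up.
have df i : forall p, U p -> derivable f p (delta_mx 0 i) by case: (Cf i).
have cf i : {for p, continuous (pd i f)} by case: (Cf i) => _ [/(_ _ Up)].
(* [w k] keeps the first [k] coordinates of [v]; the induction on [k] adds one partial derivative at
   a time. *)
pose w (k : nat) : 'rV[R]_n.+1 := \row_i (if (i < k)%N then v 0 i else 0).
have cv (k : nat) : (k <= n.+1)%N ->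
   (fun h : R => h^-1 *: (f (h *: w k + p) - f p)) @ 0^' -->
      \sum_(i < n.+1 | (i < k)%N) v 0 i * pd i f p.
  elim: k => [|k IH] kn.
    rewrite big_pred0 // (_ : (fun h => _) = (fun=> 0)); first exact: cvg_cst.
    apply/funext => h; rewrite (_ : w 0%N = 0) ?scaler0 ?add0r ?subrr ?scaler0 //.
    by apply/rowP => i; rewrite !mxE.
  pose K : 'I_n.+1 := Ordinal kn.
  rewrite (bigD1 K) //= addrC (eq_bigl (fun i : 'I_n.+1 => i < k)%N); last first.
    by move=> i; rewrite ltnS [RHS]ltn_neqAle -val_eqE andbC.
  rewrite (_ : (fun h => _) = (fun h => h^-1 *: (f (h *: w k + p) - f p) +
     h^-1 *: (f (h *: w k.+1 + p) - f (h *: w k + p)))); last first.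
    by apply/funext => h; rewrite -scalerDr; congr (_ *: _); ring.
  apply: cvgD; first exact/IH/ltnW.
  apply/cvgrPdist_lt => e e0.
  (* The [+ 1] covers the case [v 0 K = 0]. *)
  pose e' := e / (`|v 0 K| + 1).
  have v0 : 0 < `|v 0 K| + 1 by rewrite ltr_wpDl.
  have e'0 : 0 < e' by rewrite divr_gt0.
  have : \forall q \near p, U q /\ `|pd K f p - pd K f q| < e'.
    near=> q; split; first by near: q; exact: open_nbhs_nbhs.
    by near: q; move/cvgrPdist_lt: (cf K); apply.
  move=> /nbhs_ballP[d d0 dP].
  pose m := 1 + \sum_i `|v 0 i|.
  have m0 : 0 < m by rewrite ltr_wpDr // sumr_ge0.
  have vm i : `|v 0 i| < m.
    by rewrite /m (bigD1 i) //= addrCA ltrDl ltr_wpDr // sumr_ge0.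
  near=> h.
  have h0 : h != 0 by near: h; exact: nbhs_dnbhs_neq.
  have hd : `|h| < d / m.
    near: h; apply: dnbhs0_lt; exact: divr_gt0.
  have inb (t : R) : t \in `[0, 1] ->
      ball p d ((t * (h * v 0 K)) *: delta_mx 0 K + (h *: w k + p)).
    rewrite in_itv /= => /andP[t0 t1]; apply: ball_rowP => // i.
    rewrite !mxE eqxx /= addrA addrK.
    have lt1 (x : R) : `|x| <= `|h| * `|v 0 i| -> `|x| < d.
      move=> /le_lt_trans; apply; rewrite (le_lt_trans (y := `|h| * m)) //.
        by rewrite ler_wpM2l // ltW.
      by rewrite -ltr_pdivlMr.
    apply: lt1; case: eqVneq => [->|iK]; rewrite ?ltnn /=.
      rewrite mulr1 mulr0 addr0 !normrM (ger0_norm t0).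
      by apply: ler_piMl => //; exact: mulr_ge0.
    rewrite mulr0 add0r; case: ifP => _; rewrite ?normrM //.
    by rewrite normr0 mulr0; exact: mulr_ge0.
  have [t t01 E] := @MVT_pd U f (h *: w k + p) K (h * v 0 K) (df K)
     (fun t t01 => (dP _ (inb t t01)).1).
  have -> : h *: w k.+1 + p = (h * v 0 K) *: delta_mx 0 K + (h *: w k + p).
    rewrite addrA; congr (_ + p); apply/rowP => i; rewrite !mxE eqxx /=.
    rewrite ltnS leq_eqVlt; case: (eqVneq i K) => [->|iK] /=.
      by rewrite eqxx /= ltnn mulr0 addr0 mulr1.
    by rewrite mulr0 add0r (_ : (val i == k) = false) // -[k]/(val K) val_eqE (negbTE iK).
  rewrite {}E scalerAl [_ *: (h * _)]mulrA mulVf // mul1r -mulrBr normrM.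
  have tt : t \in `[0, 1] by move: t01; rewrite !in_itv /= => /andP[? ?]; rewrite !ltW.
  have [_ lt'] := dP _ (inb t tt).
  apply: (@le_lt_trans _ _ (`|v 0 K| * e')); first by rewrite ler_wpM2l // ltW.
  by rewrite /e' mulrCA gtr_pMr // ltr_pdivrMr // mul1r ltrDl.
have wn : w n.+1 = v by apply/rowP => i; rewrite mxE ltn_ord.
have := cv n.+1 (leqnn _); rewrite wn.
rewrite (eq_bigl xpredT); last by move=> i; rewrite ltn_ord.
move=> cvv; apply: DeriveDef; first by apply/cvg_ex; eexists; exact: cvv.
exact/cvg_lim.
Unshelve. all: by end_near. Qed.

(** The second difference of [f] over a square of side [d] equals [d ^+ 2] times either mixed
    derivative at some point near [p]; continuity then lets [d] shrink. *)
Lemma Schwarz U f i j p : open U -> Ck_on 2 U f -> U p ->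
  pd i (pd j f) p = pd j (pd i f) p.
Proof.
move=> oU [_ Cf] Up.
have df a : forall p, U p -> derivable f p (delta_mx 0 a) by case: (Cf a).
have ddf a b : forall p, U p -> derivable (pd a f) p (delta_mx 0 b).
  by case: (Cf a) => _ [_ /(_ b)] [].
have cdf a b : {for p, continuous (pd b (pd a f))}.
  by case: (Cf a) => _ [_ /(_ b)] [_ [/(_ _ Up)]].
(* The two directions may coincide, so points of the square differ from [p] by up to [2 * d] in a
   coordinate; the radius [3 * d] makes the bound strict. *)
have mixed (a b : 'I_n.+1) (d : R) : 0 < d -> ball p (3 * d) `<=` U ->
   exists2 q, ball p (3 * d) q &
     f (d *: delta_mx 0 a + (d *: delta_mx 0 b + p)) - f (d *: delta_mx 0 a + p)
     - f (d *: delta_mx 0 b + p) + f p = d * (d * pd b (pd a f) q).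
  move=> d0 dU.
  have inb (s t : R) : 0 <= s <= d -> 0 <= t <= d ->
      ball p (3 * d) (t *: delta_mx 0 b + (s *: delta_mx 0 a + p)).
    move=> /andP[s0 sd] /andP[t0 td].
    apply: ball_rowP => [|k]; first lra.
    rewrite !mxE addrA addrK eqxx /= (le_lt_trans (ler_normD _ _)) //.
    apply: (@le_lt_trans _ _ (t + s)); last lra.
    by rewrite !normrM !(ger0_norm s0, ger0_norm t0) lerD // ler_piMr // normr_nat lern1 leq_b1.
  have inb' s t : 0 <= s <= d -> 0 <= t <= d ->
      ball p (3 * d) (s *: delta_mx 0 a + (t *: delta_mx 0 b + p)).
    by move=> sd td; rewrite addrCA; exact: inb.
  have dd : 0 <= d <= d by rewrite lexx ltW.
  have d00 : 0 <= (0 : R) <= d by apply/andP; split => //; exact: ltW.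
  have inb0 s : 0 <= s <= d -> ball p (3 * d) (s *: delta_mx 0 a + p).
    by move=> sd; have := inb' s 0 sd d00; rewrite scale0r add0r.
  pose g s := f (s *: delta_mx 0 a + (d *: delta_mx 0 b + p)) - f (s *: delta_mx 0 a + p).
  pose dg s := pd a f (s *: delta_mx 0 a + (d *: delta_mx 0 b + p))
    - pd a f (s *: delta_mx 0 a + p).
  have gd s : 0 <= s <= d -> is_derive s 1 g (dg s).
    move=> sd; apply: is_deriveB; apply: line_is_derive; apply: df; apply: dU.
      exact: inb'.
    exact: inb0.
  have [||s sd E] := @MVT R g dg 0 d d0.
  - by move=> s; rewrite in_itv /= => /andP[s0 s1]; apply: gd; rewrite !ltW.
  - apply: derivable_within_continuous => s; rewrite in_itv /= => sd.
    by case: (gd s sd).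
  have {}sd : 0 <= s <= d by move: sd; rewrite in_itv /= => /andP[? ?]; rewrite !ltW.
  have td t : t \in `[0, 1] -> 0 <= t * d <= d.
    rewrite in_itv /= => /andP[t0 t1].
    by rewrite mulr_ge0 ?(ltW d0) //= ler_piMl // ltW.
  have [t t01 E2] := @MVT_pd U (pd a f) (s *: delta_mx 0 a + p) b d (ddf a b)
     (fun t t01 => dU _ (inb _ _ sd (td t t01))).
  exists ((t * d) *: delta_mx 0 b + (s *: delta_mx 0 a + p)).
    apply: inb => //; apply: td; move: t01; rewrite !in_itv /= => /andP[? ?].
    by rewrite !ltW.
  rewrite -{}E2; move: E; rewrite /g /dg !scale0r !add0r subr0 mulrC => E.
  by rewrite [_ + (s *: _ + p)]addrCA -E; ring.
have near_pd a b (e : R) : 0 < e -> \forall q \near p, `|pd b (pd a f) p - pd b (pd a f) q| < e.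
  by move=> e0; move/cvgrPdist_lt: (cdf a b); apply.
have := mixed i j; have := mixed j i; have := near_pd i j; have := near_pd j i.
move: (pd i (pd j f)) (pd j (pd i f)) => u v nu nv Mu Mv {mixed near_pd cdf ddf df Cf}.
apply/eqP; rewrite -subr_eq0 -normr_le0; apply/ler_addgt0Pr => e e0; rewrite add0r.
have e20 : 0 < e / 2 by rewrite divr_gt0.
have : \forall q \near p, [/\ U q, `|u p - u q| < e / 2 & `|v p - v q| < e / 2].
  have nU : \forall q \near p, U q by exact: open_nbhs_nbhs.
  by apply: filterS3 nU (nu _ e20) (nv _ e20) => q; split.
move=> /nbhs_ballP[d' /= d'0 d'P].
pose d := d' / 3; have d0 : 0 < d by exact: divr_gt0.
have d3 : 3 * d = d' by rewrite /d; field.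
have dU : ball p (3 * d) `<=` U by move=> q; rewrite d3 => /d'P[].
have [q1 bq1 E1] := Mv d d0 dU; have [q2 bq2 E2] := Mu d d0 dU.
rewrite d3 in bq1 bq2; have [_ h1 _] := d'P _ bq2; have [_ _ h2] := d'P _ bq1.
have E : v q1 = u q2.
  apply: (mulfI (lt0r_neq0 d0)); apply: (mulfI (lt0r_neq0 d0)).
  by rewrite -E1 -E2 [d *: delta_mx 0 i + (_ + _)]addrCA; congr (_ + _); exact: addrAC.
rewrite E distrC in h2; rewrite (splitr e) ltW //.
apply: le_lt_trans (ltrD h1 h2).
by apply: le_trans (ler_normD _ _); rewrite addrA subrK.
Unshelve. all: by end_near. Qed.

(** The derivative along [q - p] involves only the coordinates in which the two points differ. This
    later compares two lifts of a point to a jet space. *)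
Lemma const_line U f p q : open U -> Ck_on 1 U f ->
  (forall t : R, U (t *: (q - p) + p)) ->
  (forall i z, U z -> q 0 i != p 0 i -> pd i f z = 0) -> f q = f p.
Proof.
move=> oU Cf Us d0.
have D t := C1_is_derive (q - p) oU Cf (Us t).
have [t t01|t _] := @MVT_line f p (q - p); first by case: (D t).
rewrite subrK (derive_val (is_derive := D t)) big1 => [/eqP|i _].
  by rewrite subr_eq0 => /eqP.
rewrite !mxE; have [->|qp] := eqVneq (q 0 i) (p 0 i); first by rewrite subrr mul0r.
by rewrite d0 ?mulr0.
Qed.

End Lines.

(** * The differential ring of smooth functions on a domain *)

Section SmoothRing.
Variables (R : realType) (n : nat).

(** The point makes the set nonempty, so that [1 != 0] in its ring of functions. *)
Record domain := Domain {
  dom_set :> set 'rV[R]_n.+1;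
  dom_open : open dom_set;
  dom_pt : 'rV[R]_n.+1;
  dom_ptP : dom_set dom_pt }.

Arguments dom_open : clear implicits.
Arguments dom_ptP : clear implicits.

Variable W : domain.

(* Extending by the junk value 0 outside W makes equality on W Leibniz equality,
   so that ring identities between smooth functions can be proved by ring. *)
Record sfun := SFun {
  sfun_val :> 'rV[R]_n.+1 -> R;
  _ : smooth_on W sfun_val /\ forall p, ~ dom_set W p -> sfun_val p = 0 }.

Lemma sfun_smooth (f : sfun) : smooth_on W f. Proof. by case: f => f []. Qed.

Lemma sfun_out (f : sfun) p : ~ dom_set W p -> f p = 0.
Proof. by case: f => f [? out] /=; exact: out. Qed.

Lemma sfunP (f g : sfun) : (forall p, dom_set W p -> f p = g p) -> f = g.
Proof.
move=> fg; have E : f = g :> (_ -> R).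
  apply/funext => p; have [/fg //|Wp] := pselect (dom_set W p).
  by rewrite !sfun_out.
case: f g E {fg} => [f Hf] [g Hg] /= E; subst g.
by congr SFun; exact: Prop_irrelevance.
Qed.

Lemma mk_sfun_subproof (f : 'rV[R]_n.+1 -> R) : smooth_on W f ->
  smooth_on W (fun p => if `[< dom_set W p >] then f p else 0) /\
  forall p, ~ dom_set W p -> (if `[< dom_set W p >] then f p else 0) = 0.
Proof.
move=> sf; split=> [m|p Wp]; last by rewrite asboolF.
by apply: Ck_on_congr (sf m); [exact: dom_open|move=> q Wq; rewrite asboolT].
Qed.

Definition mk_sfun f (sf : smooth_on W f) : sfun := SFun (mk_sfun_subproof sf).

Arguments mk_sfun : simpl never.

Lemma mk_sfunE f (sf : smooth_on W f) p : dom_set W p -> mk_sfun sf p = f p.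
Proof. by move=> Wp; rewrite /mk_sfun /= asboolT. Qed.

HB.instance Definition _ := gen_eqMixin sfun.
HB.instance Definition _ := gen_choiceMixin sfun.

Let oW := dom_open W.

Definition sfun_cst (a : R) := mk_sfun (fun m => @Ck_on_cst _ _ m W a).
Definition sfun_add (f g : sfun) :=
  mk_sfun (fun m => Ck_onD oW (sfun_smooth f m) (sfun_smooth g m)).
Definition sfun_mul (f g : sfun) :=
  mk_sfun (fun m => Ck_onM oW (sfun_smooth f m) (sfun_smooth g m)).
Definition sfun_opp (f : sfun) := sfun_mul (sfun_cst (-1)) f.
Definition sfun_unit (f : sfun) : bool := `[< forall p, dom_set W p -> f p != 0 >].

(** The inverse is smooth only for nowhere vanishing functions, and its construction needs that
    proof; hence it is shown to exist by cases and then extracted by choice. *)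
Lemma sfun_inv_subproof (f : sfun) :
  exists g : sfun, if sfun_unit f then forall p, dom_set W p -> g p = (f p)^-1 else g = f.
Proof.
case: (boolP (sfun_unit f)) => [/asboolP f0|_]; last by exists f.
have sV : smooth_on W (fun p => (f p)^-1).
  by move=> m; exact: (Ck_onV oW f0 (sfun_smooth f m)).
by exists (mk_sfun sV) => p Wp; rewrite mk_sfunE.
Qed.

Definition sfun_inv (f : sfun) : sfun := projT1 (cid (sfun_inv_subproof f)).

Lemma sfun_invE (f : sfun) p : sfun_unit f -> dom_set W p -> sfun_inv f p = (f p)^-1.
Proof. by rewrite /sfun_inv; case: cid => g /= + fu; rewrite fu; apply. Qed.

Lemma sfun_addA : associative sfun_add.
Proof. by move=> f g h; apply: sfunP => p Wp; rewrite !mk_sfunE // addrA. Qed.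
Lemma sfun_addC : commutative sfun_add.
Proof. by move=> f g; apply: sfunP => p Wp; rewrite !mk_sfunE // addrC. Qed.
Lemma sfun_add0 : left_id (sfun_cst 0) sfun_add.
Proof. by move=> f; apply: sfunP => p Wp; rewrite !mk_sfunE // add0r. Qed.
Lemma sfun_addN : left_inverse (sfun_cst 0) sfun_opp sfun_add.
Proof.
by move=> f; apply: sfunP => p Wp; rewrite !mk_sfunE // mulN1r addNr.
Qed.

HB.instance Definition _ :=
  GRing.isZmodule.Build sfun sfun_addA sfun_addC sfun_add0 sfun_addN.

Lemma sfun_mulA : associative sfun_mul.
Proof. by move=> f g h; apply: sfunP => p Wp; rewrite !mk_sfunE // mulrA. Qed.
Lemma sfun_mulC : commutative sfun_mul.
Proof. by move=> f g; apply: sfunP => p Wp; rewrite !mk_sfunE // mulrC. Qed.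
Lemma sfun_mul1 : left_id (sfun_cst 1) sfun_mul.
Proof. by move=> f; apply: sfunP => p Wp; rewrite !mk_sfunE // mul1r. Qed.
Lemma sfun_mulD : left_distributive sfun_mul sfun_add.
Proof. by move=> f g h; apply: sfunP => p Wp; rewrite !mk_sfunE // mulrDl. Qed.
Lemma sfun_one_neq0 : sfun_cst 1 != 0.
Proof.
apply/eqP => /(congr1 (fun f : sfun => f (dom_pt W))).
rewrite !mk_sfunE; try exact: dom_ptP.
by move/eqP; rewrite oner_eq0.
Qed.

HB.instance Definition _ := GRing.Zmodule_isComNzRing.Build sfun
  sfun_mulA sfun_mulC sfun_mul1 sfun_mulD sfun_one_neq0.

Lemma sfun_mulV : {in sfun_unit, left_inverse 1 sfun_inv *%R}.
Proof.
move=> f fu; apply: sfunP => p Wp; rewrite !mk_sfunE // sfun_invE //.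
by rewrite mulVf //; move/asboolP: fu; apply.
Qed.

Lemma sfun_unitP (f g : sfun) : g * f = 1 -> f \in sfun_unit.
Proof.
move=> gf; apply/asboolP => p Wp; apply/eqP => f0.
have /eqP := congr1 (fun f : sfun => f p) gf.
by rewrite !mk_sfunE // f0 mulr0 eq_sym oner_eq0.
Qed.

Lemma sfun_inv_out : {in [predC sfun_unit], sfun_inv =1 id}.
Proof.
move=> f fu; rewrite /sfun_inv; case: cid => g /=.
by rewrite -[sfun_unit f]/(f \in sfun_unit) (negbTE fu).
Qed.

HB.instance Definition _ := GRing.ComNzRing_hasMulInverse.Build sfun
  sfun_mulV sfun_unitP sfun_inv_out.

Lemma sfun_unitE (f : sfun) :
  (f \is a GRing.unit) <-> forall p, dom_set W p -> f p != 0.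
Proof. by split=> /asboolP. Qed.

(** The membership proof is an argument because evaluation is a unital morphism only at points of
    [W]: elsewhere [1] takes the junk value 0. *)
Definition ev p (Wp : dom_set W p) (f : sfun) : R := f p.

Arguments ev : simpl never.

Lemma ev_is_zmod p (Wp : dom_set W p) : zmod_morphism (ev Wp).
Proof. by move=> f g; rewrite /ev !mk_sfunE // mulN1r. Qed.
HB.instance Definition _ p (Wp : dom_set W p) :=
  GRing.isZmodMorphism.Build sfun R (ev Wp) (ev_is_zmod Wp).
Lemma ev_is_monoid p (Wp : dom_set W p) : monoid_morphism (ev Wp).
Proof. by split=> [|f g]; rewrite /ev mk_sfunE. Qed.
HB.instance Definition _ p (Wp : dom_set W p) :=
  GRing.isMonoidMorphism.Build sfun R (ev Wp) (ev_is_monoid Wp).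

Lemma sfun_evP (f g : sfun) : (forall p (Wp : dom_set W p), ev Wp f = ev Wp g) -> f = g.
Proof. exact: sfunP. Qed.

Lemma pd_smooth f i : smooth_on W f -> smooth_on W (pd i f).
Proof. by move=> sf m; have [_ /(_ i)[]] := sf m.+1. Qed.

Definition spd i (f : sfun) : sfun := mk_sfun (pd_smooth i (sfun_smooth f)).

Arguments spd : simpl never.

Lemma ev_spd i f p (Wp : dom_set W p) : ev Wp (spd i f) = pd i f p.
Proof. exact: mk_sfunE. Qed.

Lemma sfun_derivable i (f : sfun) p : dom_set W p -> derivable f p (delta_mx 0 i).
Proof. by have [_ /(_ i)[+ _]] := sfun_smooth f 1%N; exact. Qed.

Lemma spd_is_zmod i : zmod_morphism (spd i).
Proof.
move=> f g; apply: sfun_evP => p Wp; rewrite rmorphB /= !ev_spd.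
rewrite -[RHS](deriveB (@sfun_derivable i f p Wp) (@sfun_derivable i g p Wp)).
by apply: (pd_congr i oW) => // q Wq; rewrite -[LHS]/(ev Wq (f - g)) rmorphB.
Qed.
HB.instance Definition _ i :=
  GRing.isZmodMorphism.Build sfun sfun (spd i) (spd_is_zmod i).

Lemma spdM i (f g : sfun) : spd i (f * g) = spd i f * g + f * spd i g.
Proof.
apply: sfun_evP => p Wp; rewrite rmorphD !rmorphM /= !ev_spd [pd i f p * _]mulrC addrC.
have <- : pd i (fun q => f q * g q) p = ev Wp f * pd i g p + ev Wp g * pd i f p.
  by rewrite /pd -deriveM //; exact: sfun_derivable.
by apply: (pd_congr i oW) => // q Wq; rewrite -[LHS]/(ev Wq (f * g)) rmorphM.
Qed.

Lemma spdC i j (f : sfun) : spd i (spd j f) = spd j (spd i f).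
Proof.
apply: sfun_evP => p Wp; rewrite !ev_spd.
have E k l : pd k (spd l f) p = pd k (pd l f) p.
  by apply: (pd_congr k oW) => // q Wq; rewrite -[LHS]/(ev Wq (spd l f)) ev_spd.
by rewrite !E; exact: (Schwarz i j oW (sfun_smooth f 2%N)).
Qed.

Definition scoord i : sfun := mk_sfun (fun m => Ck_on_coord m i oW).

Lemma ev_scoord i p (Wp : dom_set W p) : ev Wp (scoord i) = p 0 i.
Proof. exact: mk_sfunE. Qed.

Lemma spd_scoord i j : spd j (scoord i) = (i == j)%:R.
Proof.
apply: sfun_evP => p Wp; rewrite ev_spd rmorph_nat -(pd_coord i j p).
by apply: (pd_congr j oW) => // q Wq; rewrite mk_sfunE.
Qed.

Lemma ev_mk_sfun f (sf : smooth_on W f) p (Wp : dom_set W p) : ev Wp (mk_sfun sf) = f p.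
Proof. exact: mk_sfunE. Qed.

Lemma pd_sfun i (f : sfun) g : (forall p (Wp : dom_set W p), ev Wp f = g p) ->
  forall p (Wp : dom_set W p), ev Wp (spd i f) = pd i g p.
Proof. by move=> fg p Wp; rewrite ev_spd; apply: (pd_congr i oW) => // q Wq; exact: fg. Qed.

End SmoothRing.
Arguments mk_sfun : simpl never.
Arguments ev : simpl never.
Arguments spd : simpl never.
Arguments dom_open {R n} d.
Arguments dom_ptP {R n} d.

(** * Momenta and the Lepage 2-form, over a ring with commuting derivations *)

Section Lepage.
Variables (A : comNzRingType) (k : nat).
Let m := (2 * k)%N.
Variables (dy : nat -> 'I_2 -> {additive A -> A}) (dx : {additive A -> A})
  (y : nat -> 'I_2 -> A).
Hypothesis dyM : forall s i f g, dy s i (f * g) = dy s i f * g + f * dy s i g.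
Hypothesis dyC : forall r i s j f, dy r i (dy s j f) = dy s j (dy r i f).
Hypothesis dyx : forall s i f, dy s i (dx f) = dx (dy s i f).
Hypothesis dyy : forall r i s j, (r <= m)%N -> (s <= m)%N ->
  dy r i (y s j) = ((r == s) && (i == j))%:R.

Definition Dtot (f : A) : A :=
  dx f + \sum_(s < m) \sum_(j < 2) y s.+1 j * dy s j f.

Lemma Dtot_is_zmod : zmod_morphism Dtot.
Proof.
move=> f g; rewrite /Dtot raddfB opprD addrACA; congr (_ + _).
rewrite -sumrB; apply: eq_bigr => s _; rewrite -sumrB; apply: eq_bigr => j _.
by rewrite raddfB mulrBr.
Qed.
HB.instance Definition _ := GRing.isZmodMorphism.Build A A Dtot Dtot_is_zmod.

(** The commutator of d/dy_r with the total derivative is d/dy_{r-1}, because y_r occurs in [Dtot]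
    only as the coefficient of d/dy_{r-1}. *)
Lemma dy_Dtot r i f : (r <= m)%N ->
  dy r i (Dtot f) = Dtot (dy r i f) + (if r is r'.+1 then dy r' i f else 0).
Proof.
move=> rm; rewrite /Dtot raddfD /= dyx -addrA; congr (_ + _).
rewrite raddf_sum /=.
under eq_bigr => s _.
  rewrite raddf_sum /=.
  under eq_bigr => j _ do rewrite dyM dyC addrC dyy ?(ltn_ord s) //.
  rewrite big_split /=; over.
rewrite big_split /=; congr (_ + _).
case: r rm => [|r] rm.
  by rewrite big1 // => s _; rewrite big1 // => j _; rewrite mul0r.
rewrite (bigD1 (Ordinal rm)) //= [X in _ + X]big1 ?addr0; last first.
  move=> s sr; rewrite big1 // => j _; rewrite eqSS eq_sym.
  by rewrite (_ : (s == r :> nat) = false) ?mul0r //; exact: negbTE.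
rewrite (bigD1 i) //= big1 ?addr0; last first.
  by move=> j ji; rewrite [i == j]eq_sym (negbTE ji) andbF mul0r.
by rewrite !eqxx mul1r.
Qed.

Variables (L : A).
Hypothesis L_order : forall r i, (k < r)%N -> (r <= m)%N -> dy r i L = 0.

(* lmom j n is the momentum p_j^(k - n), so that lmom j k.+1 is the j-th
   Euler-Lagrange expression *)
Fixpoint lmom (j : 'I_2) (n : nat) : A :=
  if n is n'.+1 then dy (k - n') j L - Dtot (lmom j n') else 0.

Definition mom (j : 'I_2) (s : nat) : A := lmom j (k.+1 - s).

Lemma momE j s : (s <= k)%N -> mom j s = dy s j L - Dtot (mom j s.+1).
Proof. by move=> sk; rewrite /mom subSn // subSS /= subKn. Qed.

Lemma mom_out j s : (k < s)%N -> mom j s = 0.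
Proof. by move=> ks; rewrite /mom (eqP (ks : (k.+1 - s)%N == 0%N)). Qed.

Lemma lmom_sum j n : (n <= k.+1)%N ->
  lmom j n = \sum_(l < n) (-1) ^+ l * iter l Dtot (dy (k.+1 - n + l) j L).
Proof.
elim: n => [|n IH] nk; first by rewrite big_ord0.
rewrite /= IH ?(ltnW nk) // big_ord_recl /= expr0 mul1r subSS addn0; congr (_ + _).
rewrite raddf_sum /= -sumrN; apply: eq_bigr => l _.
rewrite /bump /= add1n raddfMsign exprS mulN1r mulNr.
by rewrite subSn // addSnnS.
Qed.

Lemma mom0E j :
  mom j 0 = \sum_(l < k.+1) (-1) ^+ l * iter l Dtot (dy l j L).
Proof.
rewrite /mom lmom_sum ?subn0 //; apply: eq_bigr => l _.
by rewrite subnn.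
Qed.

(** The top momentum [mom j k] is a derivative of [L], of order at most [k], and each step down in
    [s] applies one more total derivative; so [mom j s] has order at most [m - s]. *)
Lemma mom_order r i s j : (r <= m)%N -> (m < r + s)%N -> dy r i (mom j s) = 0.
Proof.
have mE : m = (2 * k)%N by [].
move=> rm; have [ks|sk] := ltnP k s; first by rewrite mom_out // raddf0.
move: {2}(k - s)%N (erefl (k - s)%N) => d; elim: d => [|d IH] in r i s rm sk *.
  move=> ks mrs; have {}ks : s = k by lia.
  rewrite {}ks {sk} in mrs *.
  rewrite momE // raddfB /= [X in Dtot X]mom_out //.
  rewrite raddf0 raddf0 subr0 dyC L_order ?raddf0 //; lia.
move=> ks mrs; have sk' : (s < k)%N by lia.
rewrite momE // raddfB /= dyC L_order ?raddf0; [|lia|lia].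
rewrite sub0r dy_Dtot // IH; [|lia|lia|lia|lia].
rewrite raddf0 add0r; case: r rm mrs => [|r] rm mrs; first by rewrite oppr0.
by rewrite IH ?oppr0 //; lia.
Qed.

(* coefficient of the Lepage 2-form d(L dx + sum p_j^s theta^j_s) on
   theta^i_r /\ theta^j_s *)
Definition lep (r : nat) (i : 'I_2) (s : nat) (j : 'I_2) : A :=
  dy r i (mom j s.+1) - dy s j (mom i r.+1).

Lemma lepC r i s j : lep r i s j = - lep s j r i.
Proof. by rewrite /lep opprB. Qed.

Lemma mom_dy r i s j : (r <= m)%N -> (s <= m)%N ->
  dy r i (mom j s) = dy r i (dy s j L) - Dtot (dy r i (mom j s.+1))
     - (if r is r'.+1 then dy r' i (mom j s.+1) else 0).
Proof.
have mE : m = (2 * k)%N by [].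
move=> rm sm; have [sk|ks] := leqP s k.
  by rewrite momE // raddfB /= dy_Dtot // opprD addrA.
rewrite !mom_out ?(ltnW ks) //; last by lia.
rewrite L_order // !raddf0.
by case: r rm => [|r] rm; rewrite /= ?raddf0 ?oppr0 ?addr0.
Qed.

(** This is the Lie derivative of the Lepage form along the total derivative, which shifts contact
    forms by one order. The second derivatives of [L] cancel by symmetry, so only derivatives of the
    Euler-Lagrange expressions [mom _ 0] remain. *)
Lemma lep_Dtot r i s j : (r <= m)%N -> (s <= m)%N ->
  Dtot (lep r i s j) +
    (if s is s'.+1 then lep r i s' j else dy r i (mom j 0)) +
    (if r is r'.+1 then lep r' i s j else - dy s j (mom i 0)) = 0.
Proof.
move=> rm sm; rewrite /lep raddfB /=.
have := mom_dy i j rm sm; have := mom_dy j i sm rm.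
rewrite (dyC s).
case: r rm => [|r] rm; case: s sm => [|s] sm => -> ->; ring.
Qed.

Lemma lep_cyc a i b j c l :
  dy a i (lep b j c l) + dy b j (lep c l a i) + dy c l (lep a i b j) = 0.
Proof.
rewrite /lep !raddfB /= (dyC b j a) (dyC c l a) (dyC c l b); ring.
Qed.

Hypothesis E_order : forall r i j, (3 < r)%N -> (r <= m)%N -> dy r i (mom j 0) = 0.

(** Descending induction on [r + s], starting where [mom_order] applies. For a fixed sum, [lep_Dtot]
    at [r.+1] and [s] lowers [s] to 0, where the remaining term differentiates [mom j 0] by a
    variable of order above 3. *)
Lemma lep_order r i s j : (r <= m)%N -> (s <= m)%N -> (3 <= r + s)%N ->
  lep r i s j = 0.
Proof.
have mE : m = (2 * k)%N by [].
move: {2}(m - (r + s))%N (erefl (m - (r + s))%N) => d.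
elim: d => [|d IH] in r i s j *.
  by move=> h rm sm _; rewrite /lep !mom_order ?subr0 //; lia.
move=> h rm sm; elim: s => [|s IHs] in r i j rm sm h *.
  move=> r3; have rm' : (r < m)%N by lia.
  have := @lep_Dtot r.+1 i 0 j rm' (leq0n _).
  by rewrite IH ?raddf0 ?E_order ?add0r //; lia.
move=> rs3; have rm' : (r < m)%N by lia.
have := @lep_Dtot r.+1 i s.+1 j rm' sm.
rewrite (IH r.+1 i s.+1 j) ?raddf0 ?add0r; [|lia|lia|lia|lia].
by rewrite IHs ?add0r //; lia.
Qed.

(** Closedness turns this derivative into derivatives of coefficients having the index [a > 2],
    which [lep_order] kills. Hence the surviving coefficients are functions on J^2. *)
Lemma lep_dy a i r j s l : (2 < a)%N -> (a <= m)%N -> (r <= m)%N -> (s <= m)%N ->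
  dy a i (lep r j s l) = 0.
Proof.
have mE : m = (2 * k)%N by [].
move=> a2 am rm sm; have := lep_cyc a i r j s l.
by rewrite [lep s l a i]lep_order ?[lep a i r j]lep_order ?raddf0 ?addr0 //; lia.
Qed.

End Lepage.

(** * Maps that drop, reorder or insert coordinates *)

Section CoordinateMaps.
Variables (R : realType) (n m : nat).
Variables (sg : 'I_m.+1 -> option 'I_n.+1) (tau : 'I_n.+1 -> option 'I_m.+1).
Hypothesis sg_tau : forall i a, (sg i == Some a) = (tau a == Some i).

(** [None] inserts the coordinate 0. One construction thus covers the projections of jet spaces and
    the inclusions that set the higher derivatives to 0. *)
Definition cmap (z : 'rV[R]_n.+1) : 'rV[R]_m.+1 :=
  \row_i (if sg i is Some a then z 0 a else 0).

Lemma cmap_lin (h : R) v z : cmap (h *: v + z) = h *: cmap v + cmap z.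
Proof.
by apply/rowP => i; rewrite !mxE; case: (sg i) => [a|]; rewrite ?mxE // mulr0 addr0.
Qed.

Lemma cmap_delta a :
  cmap (delta_mx 0 a) = if tau a is Some b then delta_mx 0 b else 0.
Proof.
apply/rowP => i; have := sg_tau i a; rewrite !mxE.
case: (tau a) => [b|]; case: (sg i) => [c|] H; rewrite ?mxE ?eqxx //=.
- by rewrite -[c == a]/(Some c == Some a) H -[Some b == Some i]/(b == i) eq_sym.
- by rewrite eq_sym -[b == i]/(Some b == Some i) -H.
- by rewrite -[c == a]/(Some c == Some a) H.
Qed.

Lemma cmap_continuous : continuous cmap.
Proof.
move=> z A /nbhs_ballP[e /= e0 eA]; apply/nbhs_ballP; exists e => // y [_ zy].
apply: eA; split=> // i j; rewrite ord1 !mxE.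
by case: (sg j) => [a|]; [exact: zy|exact: ballxx].
Qed.

Lemma pd_cmap (f : 'rV[R]_m.+1 -> R) a z :
  pd a (f \o cmap) z = if tau a is Some b then pd b f (cmap z) else 0.
Proof.
have -> : pd a (f \o cmap) z = 'D_(cmap (delta_mx 0 a)) f (cmap z).
  rewrite /pd /derive; set g1 := fun h => h^-1 *: _; set g2 := fun h => h^-1 *: _.
  suff -> : g1 = g2 by [].
  by apply/funext => h; rewrite /g1 /g2 /= cmap_lin.
by rewrite cmap_delta; case: (tau a) => [b|] //; rewrite derive0.
Qed.

Lemma Ck_on_cmap k (U : set 'rV[R]_m.+1) f :
  Ck_on k U f -> Ck_on k (cmap @^-1` U) (f \o cmap).
Proof.
elim: k f => [|k IH] f [cf df].
  split=> // z Uz; apply: continuous_comp; [exact: cmap_continuous|exact: cf].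
split=> [z Uz|a].
  by apply: continuous_comp; [exact: cmap_continuous|exact: cf].
have E : pd a (f \o cmap) = if tau a is Some b then pd b f \o cmap else (fun=> 0).
  by apply/funext => z; rewrite pd_cmap; case: (tau a).
split=> [z Uz|].
  rewrite /derivable.
  have -> : (fun h => h^-1 *: ((f \o cmap \o shift z) (h *: delta_mx 0 a) - (f \o cmap) z))
    = (fun h => h^-1 *: ((f \o shift (cmap z)) (h *: cmap (delta_mx 0 a)) - f (cmap z))).
    by apply/funext => h /=; rewrite cmap_lin.
  rewrite cmap_delta; case: (tau a) => [b|]; last exact: derivable0.
  by have [d1 _] := df b; exact: d1.
rewrite E; case: (tau a) => [b|]; first by apply: IH; have [_] := df b.
exact: Ck_on_cst.
Qed.

End CoordinateMaps.

(** * Extending a vertical 2-form to a closed form annihilated by a vector field *)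

Section HorizontalExtension.
Variables (A : comNzRingType) (n : nat) (d : 'I_n.+1 -> {additive A -> A}).
Hypothesis dM : forall a f g, d a (f * g) = d a f * g + f * d a g.
Variables (D : 'I_n.+1 -> A) (c : 'I_n.+1 -> 'I_n.+1 -> A).
Hypothesis D0 : D ord0 = 1.
Hypothesis cN : forall a b, c a b = - c b a.
Hypothesis c0 : forall b, c ord0 b = 0.
Hypothesis c_cyc : forall a b e, a != ord0 -> b != ord0 -> e != ord0 ->
  d a (c b e) + d b (c e a) + d e (c a b) = 0.
Hypothesis c_lie : forall b e, b != ord0 -> e != ord0 ->
  \sum_a (D a * d a (c b e) + d b (D a) * c a e + d e (D a) * c b a) = 0.

(* the 2-form which agrees with c on vertical vectors and is annihilated by D *)
Definition hext (a b : 'I_n.+1) : A :=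
  if a == ord0 then (if b == ord0 then 0 else - \sum_e D e * c e b)
  else if b == ord0 then \sum_e D e * c e a else c a b.

Lemma hextN a b : hext a b = - hext b a.
Proof.
by rewrite /hext; case: eqVneq => _; case: eqVneq => _; rewrite ?oppr0 ?opprK.
Qed.

Let c0r a : c a ord0 = 0. Proof. by rewrite cN c0 oppr0. Qed.

(** [D] is the direction [ord0] plus a vertical vector, and the vertical part is closed; so this
    component is the contraction of the exterior derivative with [D]. By Cartan's formula that is
    the Lie derivative, which vanishes by [c_lie]. *)
Lemma hext_cyc0 b e :
  d ord0 (hext b e) + d b (hext e ord0) + d e (hext ord0 b) = 0.
Proof.
have [->|b0] := eqVneq b ord0.
  rewrite [hext e _]hextN [hext ord0 ord0]/hext eqxx raddf0 addr0.
  by rewrite raddfN subrr.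
have [->|e0] := eqVneq e ord0.
  rewrite [hext b _]hextN [hext ord0 ord0]/hext eqxx raddf0 addr0.
  by rewrite raddfN addNr.
rewrite /hext eqxx (negbTE b0) (negbTE e0).
have -> : d b (\sum_a D a * c a e) =
    \sum_a d b (D a) * c a e + \sum_a D a * d b (c a e).
  by rewrite raddf_sum -big_split; apply: eq_bigr => a _; exact: dM.
have -> : d e (- \sum_a D a * c a b) =
    \sum_a d e (D a) * c b a + \sum_a D a * d e (c b a).
  rewrite raddfN raddf_sum /= -big_split -sumrN; apply: eq_bigr => a _ /=.
  rewrite dM [c a b]cN raddfN /=; ring.
have := c_lie b0 e0; rewrite !big_split /=.
have -> : \sum_a D a * d a (c b e) =
    d ord0 (c b e) + (\sum_a D a * d b (c a e) + \sum_a D a * d e (c b a)).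
  rewrite -big_split [LHS](bigD1 ord0) //= [in RHS](bigD1 ord0) //= D0 mul1r.
  rewrite c0 c0r !raddf0 mulr0 !add0r; congr (_ + _); apply: eq_bigr => a a0.
  have := c_cyc a0 b0 e0; rewrite [c e a]cN [c a b]cN !raddfN /= => E.
  rewrite -mulrDr; congr (_ * _); apply/eqP; rewrite -subr_eq0 -E; apply/eqP; ring.
by move=> E; rewrite -[RHS]E; ring.
Qed.

Lemma hext_cyc a b e :
  d a (hext b e) + d b (hext e a) + d e (hext a b) = 0.
Proof.
have [->|a0] := eqVneq a ord0; first exact: hext_cyc0.
have [->|b0] := eqVneq b ord0; first by rewrite -addrA addrC hext_cyc0.
have [->|e0] := eqVneq e ord0; first by rewrite addrC addrA hext_cyc0.
by rewrite /hext (negbTE a0) (negbTE b0) (negbTE e0); exact: c_cyc.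
Qed.

Hypothesis two_reg : forall x : A, x + x = 0 -> x = 0.

Lemma hext_ker b : \sum_a D a * hext a b = 0.
Proof.
rewrite (bigD1 ord0) //= D0 mul1r.
under eq_bigr => a a0 do rewrite /hext (negbTE a0).
rewrite /hext eqxx; case: eqVneq => [_|b0].
  rewrite add0r; set S := \sum_(i | _) _.
  have -> : S = \sum_a D a * \sum_e D e * c e a.
    rewrite [RHS](bigD1 ord0) //= [X in _ * X]big1 ?mulr0 ?add0r // => e _.
    by rewrite c0r mulr0.
  (* Contracting the skew [c] twice with [D] gives a sum equal to its own negative. *)
  apply: two_reg; rewrite -{1}[X in X + _]opprK; apply/eqP; rewrite addrC subr_eq0.
  apply/eqP; rewrite -sumrN.
  under eq_bigr do rewrite mulr_sumr.
  under [RHS]eq_bigr do rewrite mulr_sumr -sumrN.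
  rewrite exchange_big /=; apply: eq_bigr => a _; apply: eq_bigr => e _.
  rewrite cN; ring.
by rewrite [X in - X + _](bigD1 ord0) //= c0 mulr0 add0r addNr.
Qed.

End HorizontalExtension.

(** * Helmholtz forms *)

Section Jets.
Variables (R : realType).

Definition jup (k m : nat) (i : 'I_(jdim k)) : 'I_(jdim m) := inord i.
Definition jdown (k m : nat) (a : 'I_(jdim m)) : option 'I_(jdim k) :=
  if (a < jdim k)%N then Some (inord a) else None.

Lemma jdim_le k m : (k <= m)%N -> (jdim k <= jdim m)%N.
Proof. by move=> km; rewrite ltnS leq_double. Qed.

Lemma jup_down k m : (k <= m)%N -> forall (i : 'I_(jdim k)) (a : 'I_(jdim m)),
  (Some (jup m i) == Some a) = (jdown k a == Some i).
Proof.
move=> /jdim_le km i a; have im : (i < jdim m)%N by exact: leq_trans km.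
rewrite /jdown -[LHS]/(jup m i == a) -val_eqE /= inordK //.
case: ifP => ak; first by rewrite -[RHS](inj_eq val_inj) /= inordK // eq_sym.
by apply/eqP => /= ia; rewrite -ia ltn_ord in ak.
Qed.

Lemma jdown_up k m : (k <= m)%N -> forall (a : 'I_(jdim m)) (i : 'I_(jdim k)),
  (jdown k a == Some i) = (Some (jup m i) == Some a).
Proof. by move=> km a i; rewrite jup_down. Qed.

Lemma jy_val k s (j : 'I_2) : (s <= k)%N ->
  (jy s j : 'I_(jdim k)) = (1 + s.*2 + j)%N :> nat.
Proof.
by move=> sk; rewrite inordK //; case: j => [[|[|//]]] ? /=; lia.
Qed.

Lemma jy_eq k r i s j : (r <= k)%N -> (s <= k)%N ->
  (jy r i == jy s j :> 'I_(jdim k)) = (r == s) && (i == j).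
Proof.
move=> rk sk; rewrite -val_eqE /= !jy_val // -[i == j]val_eqE /=.
case: i j => [[|[|//]]] ? [[|[|//]]] ? /=; apply/idP/idP; lia.
Qed.

Lemma jup_jy k m s j : (k <= m)%N -> (s <= k)%N -> jup m (jy s j : 'I_(jdim k)) = jy s j.
Proof.
move=> km sk; apply: val_inj.
by rewrite /jup jy_val // ?(leq_trans sk) // jy_val.
Qed.

Lemma jdown_jy k m s j : (k <= m)%N -> (s <= m)%N ->
  jdown k (jy s j : 'I_(jdim m)) = if (s <= k)%N then Some (jy s j) else None.
Proof.
move=> km sm; rewrite /jdown jy_val //.
have -> : (1 + s.*2 + j < jdim k)%N = (s <= k)%N.
  by rewrite /jdim; case: j => [[|[|//]]] ? /=; apply/idP/idP; lia.
by case: ifP.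
Qed.

Lemma jtruncE m k (z : 'rV[R]_(jdim m)) :
  jtrunc k z = cmap (fun i => Some (jup m i)) z.
Proof. by []. Qed.

Definition jlift k m (q : 'rV[R]_(jdim k)) : 'rV[R]_(jdim m) :=
  cmap (@jdown k m) q.

Lemma jlift_coord k m (q : 'rV[R]_(jdim k)) i : (k <= m)%N ->
  jlift m q 0 (jup m i) = q 0 i.
Proof.
by move=> km; rewrite mxE; have := jup_down km i (jup m i); rewrite eqxx => /esym/eqP ->.
Qed.

Lemma jliftK k m (q : 'rV[R]_(jdim k)) : (k <= m)%N -> jtrunc k (jlift m q) = q.
Proof. by move=> km; apply/rowP => i; rewrite mxE jlift_coord. Qed.

Lemma jtrunc_jtrunc m k l (z : 'rV[R]_(jdim m)) : (l <= k)%N -> (k <= m)%N ->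
  jtrunc l (jtrunc k z) = jtrunc l z.
Proof.
move=> /jdim_le lk /jdim_le km; apply/rowP => i; rewrite !mxE.
by congr (z _ _); apply: val_inj; rewrite inordK // (leq_trans _ lk).
Qed.

Lemma jtrunc_jy m k s j (z : 'rV[R]_(jdim m)) : (k <= m)%N -> (s <= k)%N ->
  jtrunc k z 0 (jy s j) = z 0 (jy s j).
Proof. by move=> km sk; rewrite mxE -(jup_jy j km sk). Qed.

Lemma ord7P (a : 'I_(jdim 2)) : a = jx \/ exists r i, (r <= 2)%N /\ a = jy r i.
Proof.
have [->|a0] := eqVneq a jx; [by left|right].
have {}a0 : (0 < a)%N by rewrite lt0n.
have i2 : (odd a.-1 < 2)%N by case: odd.
exists (a.-1)./2, (Ordinal i2).
have r2 : ((a.-1)./2 <= 2)%N by case: a {a0 i2} => a /=; rewrite /jdim; lia.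
split=> //; apply: val_inj => /=; rewrite jy_val //=.
by have := odd_double_half a.-1; lia.
Qed.

Lemma sum7 (M : nmodType) (G : 'I_(jdim 2) -> M) :
  \sum_a G a = G jx +
    (\sum_(i < 2) G (jy 0 i) + \sum_(i < 2) G (jy 1 i) + \sum_(i < 2) G (jy 2 i)).
Proof.
rewrite (big_ord_recl 6); congr (G _ + _).
rewrite !big_ord_recl !big_ord0 !addr0 -!addrA.
by do !congr (_ + _); congr (G _); apply: val_inj => /=; rewrite jy_val.
Qed.

Definition helmholtz_form (V : domain R (3).*2) (F : 'I_2 -> 'rV[R]_(jdim 2) -> R)
    (rho : 'I_(jdim 2) -> 'I_(jdim 2) -> sfun V) : Prop :=
  [/\ forall a b, rho a b = - rho b a,
      forall a b c, spd a (rho b c) + spd b (rho c a) + spd c (rho a b) = 0,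
      forall p (Vp : dom_set V p) b,
        \sum_a solution_vector F p 0 a * ev Vp (rho a b) = 0,
      forall i j, rho (jy 2 i) (jy 2 j) = 0 /\ rho (jy 2 i) (jy 1 j) = 0
    & forall p (Vp : dom_set V p),
        \matrix_(i < 2, j < 2) ev Vp (rho (jy 2 i) (jy 0 j)) \in unitmx].

Lemma jx_jy s i : (s <= 2)%N -> (jx == jy s i :> 'I_(jdim 2)) = false.
Proof. by move=> s2; rewrite -val_eqE /= jy_val. Qed.

Lemma solution_jx F p : solution_vector F p 0 jx = 1 :> R.
Proof.
rewrite /solution_vector !mxE eqxx summxE big1 ?addr0 // => i _; rewrite !mxE.
by rewrite !jx_jy // !mulr0 !addr0.
Qed.

Lemma solution_jy F p s i : (s <= 2)%N -> solution_vector F p 0 (jy s i) =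
  (if s is s'.+2 then F i p else p 0 (jy s.+1 i)) :> R.
Proof.
move=> s2; rewrite /solution_vector !mxE eq_sym jx_jy // andbF add0r summxE.
rewrite (bigD1 i) //= big1 => [|j ji]; rewrite !mxE !jy_eq //.
  by case: s s2 => [|[|[|//]]] _; rewrite !eqxx /= ?mulr0 ?mulr1 ?addr0 ?add0r.
by rewrite [i == j]eq_sym (negbTE ji) !andbF !mulr0 !addr0.
Qed.

End Jets.

Lemma sum_ord3 (M : nmodType) (G : nat -> M) :
  \sum_(r < 3) G r = G 0%N + G 1%N + G 2%N.
Proof. by rewrite !big_ord_recl big_ord0 addr0 /= addrA. Qed.

Lemma sum_eqb (A : comNzRingType) (b : bool) (i : 'I_2) (G : 'I_2 -> A) :
  \sum_l (b && (l == i))%:R * G l = if b then G i else 0.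
Proof.
case: b; last by rewrite big1 // => l _; rewrite mul0r.
by rewrite (bigD1 i) //= eqxx mul1r big1 ?addr0 // => l /negbTE ->; rewrite mul0r.
Qed.

Section Pullback.
Variables (R : realType) (n m : nat) (W : domain R n) (V : domain R m).
Variables (sg : 'I_m.+1 -> option 'I_n.+1) (tau : 'I_n.+1 -> option 'I_m.+1).
Hypothesis sg_tau : forall i a, (sg i == Some a) = (tau a == Some i).
Hypothesis WV : forall z, dom_set W z -> dom_set V (cmap sg z).

Lemma spull_subproof (f : sfun V) : smooth_on W (f \o cmap sg).
Proof.
move=> k; apply: Ck_on_sub (Ck_on_cmap sg_tau (sfun_smooth f k)).
exact: WV.
Qed.

Definition spull (f : sfun V) : sfun W := mk_sfun (spull_subproof f).

Lemma ev_spull z (Wz : dom_set W z) f : ev Wz (spull f) = ev (WV Wz) f.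
Proof. by rewrite ev_mk_sfun. Qed.

Lemma spd_spull a f :
  spd a (spull f) = if tau a is Some b then spull (spd b f) else 0.
Proof.
apply: sfun_evP => z Wz.
rewrite (@pd_sfun _ _ _ _ _ (f \o cmap sg)) => [|p Wp]; last exact: ev_spull.
rewrite (pd_cmap sg_tau); case: (tau a) => [b|]; last by rewrite rmorph0.
by rewrite ev_spull ev_spd.
Qed.
End Pullback.

(** * From a Lagrangian to a Helmholtz form *)

Section Necessity.
Variables (R : realType) (V : domain R (3).*2).
Variables (F : 'I_2 -> sfun V) (B : 'I_2 -> 'I_2 -> sfun V).
Variables (k : nat) (L : 'rV[R]_(jdim k) -> R).
Let m := (2 * k)%N.
Hypothesis k2 : (2 <= k)%N.
Hypothesis L_smooth : smooth_on [set w : 'rV[R]_(jdim k) | dom_set V (jtrunc 2 w)] L.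
Hypothesis EL : forall z : 'rV[R]_(jdim m), dom_set V (jtrunc 2 z) ->
  forall j, euler_lagrange L j z =
    \sum_(i < 2) B i j (jtrunc 2 z) * (z 0 (jy 3 i) - F i (jtrunc 2 z)).
Hypothesis B_unit : forall q (Vq : dom_set V q), \matrix_(i, j) ev Vq (B i j) \in unitmx.

Let m2 : (2 <= m)%N. Proof. by rewrite /m; lia. Qed.
Let km : (k <= m)%N. Proof. by rewrite /m; lia. Qed.

Lemma jdom_subproof l : (2 <= l)%N ->
  open [set z : 'rV[R]_(jdim l) | dom_set V (jtrunc 2 z)] /\
  dom_set V (jtrunc 2 (jlift l (dom_pt V))).
Proof.
move=> l2; split; last by rewrite jliftK //; exact: dom_ptP.
apply: (@open_comp _ _ (@jtrunc R l 2)); last exact: dom_open.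
move=> z _.
exact: (@cmap_continuous R _ _ (fun i : 'I_(jdim 2) => Some (jup l i)) z).
Qed.

Definition jdom l (l2 : (2 <= l)%N) : domain R (l.+1).*2 :=
  Domain (jdom_subproof l2).1 (jdom_subproof l2).2.

Let W := jdom m2.
Let Vk := jdom k2.

Lemma W_Vk z : dom_set W z -> dom_set Vk (jtrunc k z).
Proof. by rewrite /= jtrunc_jtrunc. Qed.
Lemma V_W q : dom_set V q -> dom_set W (jlift m q).
Proof. by rewrite /= jliftK. Qed.

Definition jpull : sfun V -> sfun W :=
  @spull R _ _ W V _ _ (jup_down m2) (fun z Wz => Wz).
(** Restriction to the lift whose derivatives of order above 2 are 0. For the Lepage coefficients
    the choice of lift is immaterial, since by [lep_dy0] they do not depend on those coordinates. *)
Definition jrestr : sfun W -> sfun V :=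
  @spull R _ _ V W _ _ (jdown_up m2) V_W.
Let LW : sfun W :=
  @spull R _ _ W Vk _ _ (jup_down km) W_Vk (mk_sfun (W := Vk) L_smooth).

Let y s i : sfun W := scoord W (jy s i).
Let dy s i : {additive sfun W -> sfun W} := spd (jy s i).
Let dx : {additive sfun W -> sfun W} := spd jx.

Lemma dyM s i f g : dy s i (f * g) = dy s i f * g + f * dy s i g.
Proof. exact: spdM. Qed.
Lemma dyC r i s j f : dy r i (dy s j f) = dy s j (dy r i f).
Proof. exact: spdC. Qed.
Lemma dyx s i f : dy s i (dx f) = dx (dy s i f).
Proof. exact: spdC. Qed.
Lemma dyy r i s j : (r <= m)%N -> (s <= m)%N ->
  dy r i (y s j) = ((r == s) && (i == j))%:R.
Proof. by move=> rm sm; rewrite /dy /= /y spd_scoord eq_sym jy_eq. Qed.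

Lemma dy_jpull r i f : (r <= m)%N ->
  dy r i (jpull f) = if (r <= 2)%N then jpull (spd (jy r i) f) else 0.
Proof.
by move=> rm; rewrite /dy /= spd_spull jdown_jy //; case: ifP.
Qed.

Lemma LW_order r i : (k < r)%N -> (r <= m)%N -> dy r i LW = 0.
Proof. by move=> kr rm; rewrite /dy /= spd_spull jdown_jy // leqNgt kr. Qed.

Let D := Dtot k dy dx y.
Let P := mom k dy dx y LW.
Let c := lep k dy dx y LW.

Lemma ev_D (f : sfun W) g : (forall z (Wz : dom_set W z), ev Wz f = g z) ->
  forall z (Wz : dom_set W z), ev Wz (D f) = Dx g z.
Proof.
move=> fg z Wz; rewrite /D /Dtot rmorphD rmorph_sum /dx /dy /=. rewrite (pd_sfun _ fg); congr (_ + _).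
apply: eq_bigr => s _; rewrite rmorph_sum; apply: eq_bigr => j _.
by rewrite rmorphM /= (pd_sfun _ fg) ev_scoord.
Qed.

Lemma ev_mom0 j z (Wz : dom_set W z) : ev Wz (P j 0) = euler_lagrange L j z.
Proof.
rewrite /P mom0E rmorph_sum; apply: eq_bigr => s _.
rewrite rmorphM rmorphXn rmorphN rmorph1; congr (_ * _).
have : forall z (Wz : dom_set W z), ev Wz (dy s j LW) =
    pd (jy s j) (L \o @jtrunc _ m k) z.
  by apply: pd_sfun => {}z {}Wz; rewrite ev_spull ev_mk_sfun.
elim: (s : nat) z Wz (dy _ _ _) (pd _ _) => [|l IH] {}z {}Wz f g fg; first exact: fg.
by rewrite !iterSr; apply: IH => {}z {}Wz; exact: ev_D.
Qed.

Lemma mom0_eq j : P j 0 = \sum_i jpull (B i j) * (y 3 i - jpull (F i)).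
Proof.
apply: sfun_evP => z Wz; rewrite ev_mom0 EL // rmorph_sum; apply: eq_bigr => i _.
by rewrite rmorphM rmorphB /= !ev_spull ev_scoord.
Qed.

Let m4 : (4 <= m)%N. Proof. by rewrite /m; lia. Qed.

Lemma dy_mom0 r i j : (r <= m)%N -> dy r i (P j 0) =
  \sum_l (dy r i (jpull (B l j)) * (y 3 l - jpull (F l)) +
    jpull (B l j) * (((r == 3) && (i == l))%:R - dy r i (jpull (F l)))).
Proof.
move=> rm; rewrite mom0_eq raddf_sum; apply: eq_bigr => l _.
by rewrite dyM raddfB /= dyy //; lia.
Qed.

Lemma mom0_order r i j : (3 < r)%N -> (r <= m)%N -> dy r i (P j 0) = 0.
Proof.
move=> r3 rm; rewrite dy_mom0 // big1 // => l _.
have r2 : (r <= 2)%N = false by rewrite leqNgt ltnW.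
rewrite !dy_jpull // r2 (gtn_eqF r3).
by rewrite mul0r subr0 mulr0 addr0.
Qed.

Let lep0 r i s j := @lep_order _ k dy dx y dyM dyC dyx dyy LW LW_order
  mom0_order r i s j.
Let lep_dy0 a i r j s l := @lep_dy _ k dy dx y dyM dyC dyx dyy LW LW_order
  mom0_order a i r j s l.
Let lepD r i s j := @lep_Dtot _ k dy dx y dyM dyC dyx dyy LW LW_order r i s j.

(** Read off from [lep_Dtot] at orders 3 and 0: the coefficient of order 3 vanishes, and the
    derivative of the j-th Euler-Lagrange expression by y_3^i is [B i j]. *)
Lemma lep20 i j : c 2 i 0 j = - jpull (B i j).
Proof.
have m3 : (3 <= m)%N by lia.
have := lepD i j m3 (leq0n m).
rewrite lep0 // raddf0 add0r -/c -/P dy_mom0 // => /eqP; rewrite addrC addr_eq0 => /eqP ->.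
congr (- _); rewrite (bigD1 i) //= big1 => [|l li].
  by rewrite !dy_jpull //= eqxx mul0r add0r subr0 mulr1 addr0.
by rewrite !dy_jpull //= [i == l]eq_sym (negbTE li) mul0r add0r subrr mulr0.
Qed.

(** The lift with y_3 = F. There the Euler-Lagrange expressions vanish, and [Dtot] acts on functions
    pulled back from J^2 as the solution field. *)
Definition onshell (q : 'rV[R]_(jdim 2)) : 'rV[R]_(jdim m) :=
  \row_a (if jdown 2 a is Some b then q 0 b else
    if a == jy 3 0 then F 0 q else if a == jy 3 1 then F 1 q else 0).

Lemma onshell_up q i : onshell q 0 (jup m i) = q 0 i.
Proof.
by rewrite mxE; have := jup_down m2 i (jup m i); rewrite eqxx => /esym/eqP ->.
Qed.

Lemma onshellK q : jtrunc 2 (onshell q) = q.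
Proof. by apply/rowP => i; rewrite mxE onshell_up. Qed.

Lemma onshell_jy q s i : (s <= 3)%N ->
  onshell q 0 (jy s i) = if s is 3 then F i q else q 0 (jy s i).
Proof.
have m3 : (3 <= m)%N by exact: leq_trans m4.
have [s2 _|s3 s3'] := leqP s 2.
  rewrite -(jup_jy i m2 s2) onshell_up; by case: s s2 => [|[|[|]]].
have -> : s = 3 by apply/eqP; rewrite eqn_leq s3' s3.
rewrite mxE jdown_jy // !jy_eq //.
by case: i => [[|[|//]]] h; congr (F _ q); exact: val_inj.
Qed.

Lemma V_onshell q : dom_set V q -> dom_set W (onshell q).
Proof. by rewrite /= onshellK. Qed.

Lemma ev_jrestr q (Vq : dom_set V q) f : ev Vq (jrestr f) = ev (V_W Vq) f.
Proof. exact: ev_spull. Qed.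

Lemma spd_jrestr a f : spd a (jrestr f) = jrestr (spd (jup m a) f).
Proof. exact: spd_spull. Qed.

Lemma spd_jrestr_jy r i f : (r <= 2)%N -> spd (jy r i) (jrestr f) = jrestr (dy r i f).
Proof. by move=> r2; rewrite spd_jrestr jup_jy. Qed.

(** The two lifts differ only in coordinates of order 3, and the fibre over [q] is a whole affine
    space, so the line joining them stays in the domain. *)
Lemma ev_onshell q (Vq : dom_set V q) f : (forall i, dy 3 i f = 0) ->
  ev (V_onshell Vq) f = ev Vq (jrestr f).
Proof.
move=> f0; rewrite ev_jrestr /ev; apply: (const_line (dom_open W) (sfun_smooth f 1%N)).
  move=> t /=; rewrite (_ : jtrunc 2 _ = q) //; apply/rowP => i.
  by rewrite 4!mxE -/(jup m i) onshell_up jlift_coord // mxE jlift_coord // subrr mulr0 add0r.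
move=> a z Wz; rewrite !mxE.
case: (jdown 2 a) => [b|]; first by rewrite eqxx.
have dz i : pd (jy 3 i) f z = 0 by rewrite -(ev_spd _ _ Wz) (f0 i) rmorph0.
by case: (eqVneq a (jy 3 0)) => [-> //|_]; case: (eqVneq a (jy 3 1)) => [-> //|_]; rewrite eqxx.
Qed.

Let cV r i s j : sfun V := jrestr (c r i s j).

(** Inverts [jy] on indices. Its value at [jx] is junk; [vform] and [sol] treat [jx] separately. *)
Definition jdec (a : 'I_(jdim 2)) : nat * 'I_2 :=
  ((a.-1)./2, if odd a.-1 then 1 else 0).

Arguments jdec : simpl never.

Lemma jdecE r i : (r <= 2)%N -> jdec (jy r i) = (r, i).
Proof.
move=> r2; rewrite /jdec jy_val //; case: i => [[|[|//]]] h /=;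
by rewrite ?addn0 ?addn1 /= ?uphalf_double ?doubleK ?odd_double //=;
   congr (_, _); exact: val_inj.
Qed.

Definition vform (a b : 'I_(jdim 2)) : sfun V :=
  if (a == jx) || (b == jx) then 0
  else cV (jdec a).1 (jdec a).2 (jdec b).1 (jdec b).2.

Lemma vformE r i s j : (r <= 2)%N -> (s <= 2)%N ->
  vform (jy r i) (jy s j) = cV r i s j.
Proof.
by move=> r2 s2; rewrite /vform !jdecE // ![_ == jx]eq_sym !jx_jy.
Qed.

Definition sol (a : 'I_(jdim 2)) : sfun V :=
  if a == jx then 1 else
  if (jdec a).1 == 2 then F (jdec a).2 else scoord V (jy (jdec a).1.+1 (jdec a).2).

Lemma solE r i : (r <= 2)%N -> sol (jy r i) =
  if r == 2 then F i else scoord V (jy r.+1 i).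
Proof. by move=> r2; rewrite /sol jdecE // [_ == jx]eq_sym jx_jy. Qed.

Lemma ev_sol q (Vq : dom_set V q) a : ev Vq (sol a) = solution_vector F q 0 a.
Proof.
have [->|[r [i [r2 ->]]]] := ord7P a.
  by rewrite /sol eqxx rmorph1 solution_jx.
rewrite solE // solution_jy //.
by case: r r2 => [|[|[|//]]] _ //=; rewrite ev_scoord.
Qed.

Lemma vformN a b : vform a b = - vform b a.
Proof.
rewrite /vform orbC; case: ifP; rewrite ?oppr0 // => _.
by apply: sfun_evP => q Vq; rewrite rmorphN /= !ev_jrestr /c lepC rmorphN.
Qed.

Lemma vform_cyc a b e : a != ord0 -> b != ord0 -> e != ord0 ->
  spd a (vform b e) + spd b (vform e a) + spd e (vform a b) = 0.
Proof.
have [->|[r [i [r2 ->]]]] := ord7P a; first by rewrite eqxx.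
have [->|[s [j [s2 ->]]]] := ord7P b; first by rewrite eqxx.
have [->|[t [l [t2 ->]]]] := ord7P e; first by rewrite eqxx.
move=> _ _ _; rewrite !vformE // /cV !spd_jrestr_jy //.
apply: sfun_evP => q Vq; rewrite !rmorphD /= !ev_jrestr -!rmorphD rmorph0.
by rewrite /c lep_cyc ?rmorph0 //; exact: dyC.
Qed.

Lemma cV20 i s j : (s <= 2)%N -> cV 2 i s j = if s == 0 then - B i j else 0.
Proof.
move=> s2; apply: sfun_evP => q Vq; rewrite ev_jrestr.
case: eqVneq => [->|s0].
  by rewrite lep20 !rmorphN /= ev_spull /ev -jtruncE jliftK.
have sm : (s <= m)%N by exact: leq_trans m2.
by rewrite /c lep0 ?rmorph0 //; case: s s0 {s2 sm}.
Qed.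

(** On shell the factors [y 3 l - F l] vanish, so the derivatives of [B] drop out. *)
Lemma ev_dy_mom0 q (Vq : dom_set V q) r i j : (r <= 2)%N ->
  ev (V_onshell Vq) (dy r i (P j 0)) =
    - \sum_l ev Vq (B l j) * ev Vq (spd (jy r i) (F l)).
Proof.
move=> r2; have rm : (r <= m)%N by exact: leq_trans m2.
rewrite dy_mom0 // rmorph_sum -sumrN; apply: eq_bigr => l _.
rewrite rmorphD !rmorphM !rmorphB /= ev_scoord !dy_jpull // r2 !ev_spull onshell_jy //.
rewrite (ltn_eqF (r2 : (r < 3)%N)) rmorph0 sub0r mulrN.
by rewrite /ev -!jtruncE onshellK subrr mulr0 add0r.
Qed.

(** This is [lep_Dtot] on the on-shell lift. Differentiating the jet components of [sol] reproduces
    its index shifts, and differentiating [F] reproduces the derivatives of the Euler-Lagrange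
    expressions. *)
Lemma vform_lie b e : b != ord0 -> e != ord0 ->
  \sum_a (sol a * spd a (vform b e) + spd b (sol a) * vform a e
     + spd e (sol a) * vform b a) = 0.
Proof.
have [->|[r [i [r2 ->]]]] := ord7P b; first by rewrite eqxx.
have [->|[s [j [s2 ->]]]] := ord7P e; first by rewrite eqxx.
move=> _ _; apply: sfun_evP => q Vq.
have rm : (r <= m)%N by exact: leq_trans m2.
have sm : (s <= m)%N by exact: leq_trans m2.
have m3 : (3 <= m)%N by exact: leq_trans m4.
have c3 r' i' s' j' t : (r' <= 2)%N -> (s' <= 2)%N -> dy 3 t (c r' i' s' j') = 0.
  by move=> ? ?; rewrite lep_dy0 // (leq_trans _ m2).
have evc r' i' s' j' : (r' <= 2)%N -> (s' <= 2)%N ->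
    ev (V_onshell Vq) (c r' i' s' j') = ev Vq (cV r' i' s' j').
  by move=> ? ?; rewrite ev_onshell // => t; exact: c3.
have evD : ev (V_onshell Vq) (D (c r i s j)) =
    ev Vq (\sum_a sol a * spd a (vform (jy r i) (jy s j))).
  rewrite vformE // sum7.
  rewrite /D /Dtot (bigID (fun t : 'I_m => (t < 3)%N)) /= [X in _ + (_ + X)]big1 ?addr0; last first.
    move=> t; rewrite -leqNgt => t3; rewrite big1 // => l _.
    by rewrite lep_dy0 ?mulr0 // ltnW.
  rewrite -(big_ord_widen m (fun t => \sum_(l < 2) y t.+1 l * dy t l (c r i s j)) m3).
  rewrite (sum_ord3 (fun t => \sum_(l < 2) y t.+1 l * dy t l (c r i s j))).
  have evdy t l : (t <= 2)%N -> ev (V_onshell Vq) (y t.+1 l * dy t l (c r i s j)) =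
      ev Vq (sol (jy t l) * spd (jy t l) (cV r i s j)).
    move=> t2; rewrite spd_jrestr_jy // !rmorphM /= ev_sol solution_jy //.
    have d3 t' : dy 3 t' (dy t l (c r i s j)) = 0 by rewrite dyC c3 // raddf0.
    rewrite (ev_onshell Vq d3).
    by rewrite ev_scoord onshell_jy //; case: t t2 {d3} => [|[|[|]]].
  rewrite /sol eqxx -/sol mul1r spd_jrestr.
  rewrite -!addrA !rmorphD !rmorph_sum /=; congr (_ + _).
    rewrite (_ : jup m jx = jx); last by apply: val_inj; rewrite /= inordK.
    have d3 t : dy 3 t (dx (c r i s j)) = 0 by rewrite dyx c3 // raddf0.
    exact: (ev_onshell Vq d3).
  by do !congr (_ + _); apply: eq_bigr => l _; rewrite evdy.
have chain r' i' (G : 'I_(jdim 2) -> sfun V) : (r' <= 2)%N ->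
    \sum_a spd (jy r' i') (sol a) * G a =
    (if r' is r''.+1 then G (jy r'' i') else 0) +
    \sum_l spd (jy r' i') (F l) * G (jy 2 l).
  move=> r'2; rewrite sum7.
  have -> : sol jx = 1 by rewrite /sol eqxx.
  have -> : spd (jy r' i') (1 : sfun V) = 0.
    apply: (addrI (spd (jy r' i') (1 : sfun V))); rewrite addr0.
    by rewrite -{3}[1]mulr1 spdM mulr1 mul1r.
  rewrite mul0r add0r; congr (_ + _); last first.
    by apply: eq_bigr => l _; rewrite solE.
  under eq_bigr => l _ do rewrite solE // spd_scoord jy_eq //.
  under [X in _ + X]eq_bigr => l _ do rewrite solE // spd_scoord jy_eq //.
  rewrite !sum_eqb.
  by case: r' r'2 => [|[|[|]]] //= _; rewrite ?addr0 ?add0r.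
rewrite !big_split !rmorphD /= -evD !chain //=.
rewrite [RHS]rmorph0 -[RHS](rmorph0 (ev (V_onshell Vq))) -(lepD i j rm sm) -/c -/D -/P.
rewrite !rmorphD /= -!addrA; congr (_ + _).
(* By [cV20] order 2 pairs only with order 0, with coefficient [- B]; the sum is therefore an
   on-shell derivative of an Euler-Lagrange expression. *)
have half t l u v : (t <= 2)%N -> (u <= 2)%N ->
    ev Vq (\sum_h spd (jy t l) (F h) * vform (jy 2 h) (jy u v)) =
    if u == 0 then ev (V_onshell Vq) (dy t l (P v 0)) else 0.
  move=> t2 u2; case: eqVneq => [->|u0].
    rewrite ev_dy_mom0 // rmorph_sum -sumrN; apply: eq_bigr => h _.
    by rewrite vformE // cV20 // rmorphM rmorphN mulrN mulrC.
  by rewrite big1 ?rmorph0 // => h _; rewrite vformE // cV20 // (negbTE u0) mulr0.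
have X1 : ev Vq (if s is s'.+1 then vform (jy r i) (jy s' j) else 0) +
    ev Vq (\sum_h spd (jy r i) (F h) * vform (jy 2 h) (jy s j)) =
    ev (V_onshell Vq) (if s is s'.+1 then c r i s' j else dy r i (P j 0)).
  rewrite half //; case: s s2 {sm evD} => [|s] s2; first by rewrite rmorph0 add0r.
  by rewrite addr0 vformE ?(ltnW s2) // -evc // ltnW.
have X2 : ev Vq (if r is r'.+1 then vform (jy r' i) (jy s j) else 0) +
    ev Vq (\sum_h spd (jy s j) (F h) * vform (jy r i) (jy 2 h)) =
    ev (V_onshell Vq) (if r is r'.+1 then c r' i s j else - dy s j (P i 0)).
  under eq_bigr do rewrite vformN mulrN.
  rewrite sumrN rmorphN /= half //.
  case: r r2 {rm evD X1} => [|r] r2; first by rewrite rmorph0 add0r rmorphN.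
  by rewrite oppr0 addr0 vformE ?(ltnW r2) // -evc // ltnW.
rewrite /= in X1 X2; rewrite -X1 -X2; ring.
Qed.

Lemma necessity : exists rho : 'I_(jdim 2) -> 'I_(jdim 2) -> sfun V,
  helmholtz_form (fun i q => F i q) rho.
Proof.
have N2 (x : sfun V) : x + x = 0 -> x = 0.
  move=> xx; apply: sfun_evP => q Vq; have /(congr1 (ev Vq)) := xx.
  by rewrite rmorphD rmorph0 /= => h; lra.
have sol0 : sol ord0 = 1 by rewrite /sol eqxx.
have v0 b : vform ord0 b = 0 by rewrite /vform eqxx.
exists (hext sol vform); split.
- exact: (hextN _ vformN).
- exact: (hext_cyc (@spdM _ _ V) sol0 vformN v0 vform_cyc vform_lie).
- move=> p Vp b; rewrite -[RHS](rmorph0 (ev Vp)).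
  rewrite -(hext_ker sol0 vformN v0 N2 b) rmorph_sum; apply: eq_bigr => a _.
  by rewrite rmorphM /= ev_sol.
- move=> i j; rewrite /hext ![_ == ord0]eq_sym !jx_jy // !vformE //.
  by rewrite !cV20.
- move=> p Vp; rewrite (_ : \matrix_(i, j) _ = - \matrix_(i, j) ev Vp (B i j)).
    by rewrite -scaleN1r unitmxZ ?unitrN1 //; exact: B_unit.
  apply/matrixP => i j; rewrite !mxE /hext ![_ == ord0]eq_sym !jx_jy //.
  by rewrite vformE // cV20 // rmorphN.
Qed.

End Necessity.

Lemma variational_helmholtz (R : realType) (U : set 'rV[R]_(jdim 2))
    (F : 'I_2 -> 'rV[R]_(jdim 2) -> R) p :
  (forall i, smooth_on U (F i)) -> variational U F -> U p ->
  exists (V : domain R (3).*2) (rho : 'I_(jdim 2) -> 'I_(jdim 2) -> sfun V),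
    [/\ dom_set V p, dom_set V `<=` U & helmholtz_form F rho].
Proof.
move=> sF varF Up; have [V [B [k [L [[oV Vp VU] [sB uB k2 sL EL]]]]]] := varF p Up.
pose Vd : domain R (3).*2 := Domain oV Vp.
have sFV i : smooth_on Vd (F i) by move=> m; exact: (Ck_on_sub VU (sF i m)).
pose FV i : sfun Vd := mk_sfun (sFV i).
pose BV i j : sfun Vd := mk_sfun (W := Vd) (sB i j).
have [|q Vq|rho [r1 r2 r3 r4 r5]] := @necessity R Vd FV BV k L k2 sL.
- move=> z Vz j; rewrite EL //; apply: eq_bigr => i _.
  by rewrite /FV /BV !mk_sfunE.
- rewrite (_ : \matrix_(i, j) _ = B q) ?uB //.
  by apply/matrixP => i j; rewrite mxE ev_mk_sfun.
exists Vd, rho; split=> //; split=> // q Vq b; apply: etrans (r3 q Vq b).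
apply: eq_bigr => a _; congr (_ * _).
have [->|[s [i [s2 ->]]]] := ord7P a; first by rewrite !solution_jx.
rewrite !solution_jy //; case: s s2 => [|[|[|//]]] // _.
by rewrite [RHS]mk_sfunE.
Qed.

(** * The Lie algebra k by structure constants *)

Notation kidx := 'I_13.

(* structure constants of k: row c lists the (a, b, s), a < b, such that
   [e_a, e_b] has coefficient s on e_c *)
Definition sctab : seq (seq (kidx * kidx * int)) :=
  [:: [:: (om1, ph0, 1); (om1, ph2, 1); (om2, ga0, 1); (th1, om0, 1)];
      [:: (om1, th0, -1); (om2, ph0, 1); (om3, ga0, -1); (th2, om0, 1)];
      [:: (om2, th0, 1); (om3, ph0, 1); (om3, ph2, -1); (th3, om0, 1)];
      [:: (om1, xi0, 1); (th1, ph0, -1); (th1, ph1, 1); (th1, ph2, 1); (th2, ga0, 1)];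
      [:: (om2, xi0, 1); (th1, th0, -1); (th2, ph0, -1); (th2, ph1, 1); (th3, ga0, -1)];
      [:: (om3, xi0, 1); (th2, th0, 1); (th3, ph0, -1); (th3, ph1, 1); (th3, ph2, -1)];
      [:: (th0, ph2, -1)];
      [:: (xi0, om0, 1)];
      [::];
      [:: (th0, ga0, -1)];
      [:: (ph0, xi0, 2); (ph1, xi0, -1)];
      [:: (ph0, om0, -2); (ph1, om0, 1)];
      [:: (ph2, ga0, -1)]].

(* [eqn] computes much faster than the generic equality *)
Definition keq (a b : kidx) : bool := eqn a b.

Definition sc (a b c : kidx) : int :=
  foldr (fun t s => (if keq t.1.1 a && keq t.1.2 b then t.2 else 0)
    - (if keq t.1.1 b && keq t.1.2 a then t.2 else 0) + s) 0 (nth [::] sctab c).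

Lemma keqE a b : keq a b = (a == b). Proof. by []. Qed.

Lemma scE a b c : sc a b c =
  foldr (fun t s => (if (t.1.1 == a) && (t.1.2 == b) then t.2 else 0)
    - (if (t.1.1 == b) && (t.1.2 == a) then t.2 else 0) + s) 0 (nth [::] sctab c).
Proof. by []. Qed.

Definition kidxs : seq kidx :=
  [:: om1; om2; om3; th1; th2; th3; th0; ph0; ph1; ph2; xi0; om0; ga0].

Lemma kidxsE : kidxs = enum kidx.
Proof. by apply: (inj_map val_inj); rewrite val_enum_ord. Qed.

Lemma mem_kidxs a : a \in kidxs. Proof. by rewrite kidxsE mem_enum. Qed.

Lemma sum_kidxs (M : nmodType) (G : kidx -> M) : \sum_a G a = \sum_(a <- kidxs) G a.
Proof. by rewrite kidxsE big_enum. Qed.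

Lemma kidx_ind (P : kidx -> Prop) :
  P om1 -> P om2 -> P om3 -> P th1 -> P th2 -> P th3 -> P th0 -> P ph0 -> P ph1 ->
  P ph2 -> P xi0 -> P om0 -> P ga0 -> forall a, P a.
Proof.
move=> ? ? ? ? ? ? ? ? ? ? ? ? ? a; have := mem_kidxs a.
by rewrite !inE; do !(case/orP=> [/eqP -> //|]); move/eqP ->.
Qed.

Lemma sum_delta (I : finType) (A : pzRingType) (a : I) (f : I -> A) :
  \sum_b (a == b)%:R * f b = f a.
Proof.
rewrite (bigD1 a) //= eqxx mul1r big1 ?addr0 // => b /negbTE.
by rewrite eq_sym => ->; rewrite mul0r.
Qed.

Definition isneg (a : kidx) : bool := (a < 7)%N.

Lemma sc_deg a b c : sc a b c != 0 -> kdeg a + kdeg b = kdeg c.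
Proof.
have : all (fun a => all (fun b => all (fun c =>
  (sc a b c == 0) || (kdeg a + kdeg b == kdeg c)) kidxs) kidxs) kidxs by vm_compute.
move=> /allP/(_ a (mem_kidxs a))/allP/(_ b (mem_kidxs b))/allP/(_ c (mem_kidxs c)).
by case/orP=> [->|/eqP].
Qed.

Section Bracket.
Variable A : comNzRingType.
Implicit Types x y z : kidx -> A.

(** The bracket of k with coefficients in any commutative ring, so that it applies to vectors of
    functions; [kbr_brk] compares it with the matrix commutator. *)
Definition brk x y (c : kidx) : A :=
  foldr (fun t s => t.2%:~R * (x t.1.1 * y t.1.2 - x t.1.2 * y t.1.1) + s)
    0 (nth [::] sctab c).

Lemma brkE x y c : brk x y c = \sum_a \sum_b (sc a b c)%:~R * (x a * y b).
Proof.
rewrite /brk; under eq_bigr => a _ do under eq_bigr => b _ do rewrite scE.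
elim: (nth _ _ _) => [|t l IH] /=.
  by rewrite big1 // => a _; rewrite big1 // => b _; rewrite mul0r.
under eq_bigr => a _ do under eq_bigr => b _ do rewrite rmorphD mulrDl /=.
under eq_bigr => a _ do rewrite big_split /=.
rewrite big_split /= -{}IH; congr (_ + _).
under eq_bigr => a _ do under eq_bigr => b _ do rewrite rmorphB mulrBl /=.
under eq_bigr => a _ do rewrite sumrB /=.
rewrite sumrB mulrBr; congr (_ - _).
  rewrite (bigD1 t.1.1) //= [X in _ + X]big1 ?addr0 => [|a /negbTE ta]; last first.
    by rewrite big1 // => b _; rewrite eq_sym ta mul0r.
  rewrite (bigD1 t.1.2) //= [X in _ + X]big1 ?addr0 => [|b /negbTE tb]; last first.
    by rewrite [_ == b]eq_sym tb andbF mul0r.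
  by rewrite !eqxx.
rewrite (bigD1 t.1.2) //= [X in _ + X]big1 ?addr0 => [|a /negbTE ta]; last first.
  by rewrite big1 // => b _; rewrite [_ == a]eq_sym ta andbF mul0r.
rewrite (bigD1 t.1.1) //= [X in _ + X]big1 ?addr0 => [|b /negbTE tb]; last first.
  by rewrite [_ == b]eq_sym tb mul0r.
by rewrite !eqxx.
Qed.

Lemma brkC x y c : brk x y c = - brk y x c.
Proof.
rewrite /brk; elim: (nth _ _ _) => [|t l IH] /=; first by rewrite oppr0.
by rewrite IH opprD; congr (_ + _); ring.
Qed.

Lemma brk_jacobi x y z c :
  brk x (brk y z) c + brk y (brk z x) c + brk z (brk x y) c = 0.
Proof. by move: c; apply: kidx_ind; rewrite /brk /=; ring. Qed.

(* the symplectic pairing between p_{-1} and itself with values in p_{-2} *)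
Definition symp (x y : kidx -> A) : A :=
  x om1 * y th3 - x th3 * y om1 + (x om2 * y th2 - x th2 * y om2)
  + (x om3 * y th1 - x th1 * y om3).

(** The p_{-2} component of the Jacobi identity in p_{-2} + p_{-1} + p_0: up to sign, p_0 acts on
    the line p_{-2} by the trace of its gl(2) block, which is [ph1]. *)
Lemma symp_cyc x y z :
  symp (brk x y) z + symp (brk y z) x + symp (brk z x) y =
  - (x ph1 * symp y z + y ph1 * symp z x + z ph1 * symp x y).
Proof. by rewrite /symp /brk /=; ring. Qed.

End Bracket.

(** * Linear relations between curvature components *)

Section LinearConsequences.
Variable R : realType.

(** Coefficients are binary integers, on which the elimination computes quickly. *)
Definition zr (z : Z) : R := (int_of_Z z)%:~R.

Lemma zr_comb a u b v : zr (Z.sub (Z.mul a u) (Z.mul b v)) = zr a * zr u - zr b * zr v.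
Proof.
rewrite /zr -[Z.mul a u]/(a * u) -[Z.mul b v]/(b * v) -[Z.sub _ _]/(a * u - b * v).
by rewrite !rmorphB !rmorphM.
Qed.

Lemma zr_eq0 z : (zr z == 0) = (Z.eqb z Z0).
Proof.
rewrite /zr intr_eq0; case: z => //= p; apply/eqP => -[]; lia.
Qed.

Fixpoint dot (l : seq Z) (xs : seq R) : R :=
  match l, xs with
  | i :: l', x :: xs' => zr i * x + dot l' xs'
  | _, _ => 0
  end.

Definition comb (a : Z) (u : seq Z) (b : Z) (v : seq Z) : seq Z :=
  [seq Z.sub (Z.mul a w.1) (Z.mul b w.2) | w <- zip u v].

Let hd (r : seq Z) : Z := head Z0 r.
Let hd0 (r : seq Z) : bool := Z.eqb (hd r) Z0.

(* decides by Gaussian elimination whether the linear forms ts vanish wherever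
   all the forms in rows do *)
Fixpoint implied (n : nat) (rows ts : seq (seq Z)) : bool :=
  if n is n'.+1 then
    if [seq r <- rows | ~~ hd0 r] is p :: _ then
      let red r := if hd0 r then behead r
                   else comb (hd p) (behead r) (hd r) (behead p) in
      implied n' (map red rows) (map red ts)
    else all hd0 ts && implied n' (map behead rows) (map behead ts)
  else true.

Lemma dot_comb a u b v xs : size u = size v ->
  dot (comb a u b v) xs = zr a * dot u xs - zr b * dot v xs.
Proof.
elim: u v xs => [|i u IH] [|j v] [|x xs] //=; rewrite ?mulr0 ?subr0 // => -[uv].
by rewrite IH // zr_comb; ring.
Qed.

Lemma size_comb a u b v : size u = size v -> size (comb a u b v) = size v.
Proof. by move=> uv; rewrite size_map size_zip uv minnn. Qed.

Let wf n (rows : seq (seq Z)) := forall r, r \in rows -> size r = n.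

(** Fraction-free elimination of the first unknown: a form with head [k] becomes the pivot head
    times it minus [k] times the pivot. The pivot head stays nonzero in [R], so on solutions of the
    rows a form vanishes exactly when its reduction does. *)
Lemma impliedP n rows ts xs : wf n ts -> wf n rows -> size xs = n ->
  (forall r, r \in rows -> dot r xs = 0) -> implied n rows ts ->
  forall t, t \in ts -> dot t xs = 0.
Proof.
elim: n rows ts xs => [|n IH] rows ts xs wts wrows sxs rows0.
  by move=> _ t /wts; case: t.
case: xs sxs rows0 => [|x xs] // [sx] rows0 H t tts.
have cut (r : seq Z) : size r = n.+1 -> exists j r', r = j :: r' /\ size r' = n.
  by case: r => [|j r'] // [?]; exists j, r'.
have [i [t' [tE st]]] := cut t (wts t tts).
move: H => /=; case E: [seq r <- rows | ~~ hd0 r] => [|p ps].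
  case/andP=> /allP/(_ t tts) ht H.
  have i0 : zr i = 0 by apply/eqP; rewrite zr_eq0; rewrite tE in ht.
  rewrite tE /= i0 mul0r add0r.
  apply: (IH _ _ xs _ _ sx _ H) => //; last by apply/mapP; exists t => //; rewrite tE.
  - by move=> _ /mapP[r rr ->]; have [j [r' [-> ->]]] := cut r (wts r rr).
  - by move=> _ /mapP[r rr ->]; have [j [r' [-> ->]]] := cut r (wrows r rr).
  move=> _ /mapP[r rr ->].
  have : r \notin [seq r <- rows | ~~ hd0 r] by rewrite E.
  rewrite mem_filter rr andbT negbK; have := rows0 r rr.
  have [j [r' [-> _]]] := cut r (wrows r rr).
  by rewrite /hd0 -zr_eq0 /= => + /eqP j0; rewrite j0 mul0r add0r.
have /andP[p0 pr] : ~~ hd0 p && (p \in rows).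
  by rewrite -(mem_filter (fun r => ~~ hd0 r)) E mem_head.
have [j [p' [pE sp']]] := cut p (wrows p pr); have := rows0 p pr.
rewrite {}pE /hd0 /= in p0 * => px H.
have jR : zr j != 0 by rewrite zr_eq0.
set red := fun r => _ in H.
have redE k r : size r = n -> zr k * x + dot r xs = 0 <-> dot (red (k :: r)) xs = 0.
  move=> sr; rewrite /red /hd0 /=; case: ifP => [|k0].
    by rewrite -zr_eq0 => /eqP ->; rewrite mul0r add0r.
  rewrite dot_comb ?sr //; have {px}-> : dot p' xs = - (zr j * x).
    by apply/eqP; rewrite -addr_eq0 addrC px.
  rewrite (_ : _ - _ = zr j * (zr k * x + dot r xs)); last by ring.
  by split=> [->|/eqP]; rewrite ?mulr0 // mulf_eq0 (negbTE jR) => /eqP.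
have sred r : size r = n.+1 -> size (red r) = n.
  move=> /cut[k [r' [-> sr]]].
  by rewrite /red /=; case: ifP => _ //; rewrite size_comb ?sr.
rewrite tE; apply/(redE _ _ st).
apply: (IH _ _ xs _ _ sx _ H); last by apply/mapP; exists t => //; rewrite tE.
- by move=> _ /mapP[r rr ->]; exact/sred/wts.
- by move=> _ /mapP[r rr ->]; exact/sred/wrows.
move=> _ /mapP[r rr ->]; have := rows0 r rr.
by have [k [r' [-> sr']]] := cut r (wrows r rr) => /redE; exact.
Qed.

Lemma dot_map (T : Type) (f : T -> int) (x : T -> R) (s : seq T) :
  dot (map (fun v => Z_of_int (f v)) s) (map x s) = \sum_(v <- s) (f v)%:~R * x v.
Proof.
by elim: s => [|v s IH] /=; rewrite ?big_nil // big_cons IH /zr Z_of_intK.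
Qed.

(* A form on k-valued 2-cochains is given by its coefficients on the K a b c. *)
Definition cform := kidx -> kidx -> kidx -> int.
Definition ktriple : Type := kidx * kidx * kidx.

Definition ktriples (h : int) : seq ktriple :=
  [seq v : ktriple <- [seq (u, c) | u <- [seq (a, b) | a <- kidxs, b <- kidxs], c <- kidxs] |
    [&& (v.1.1 < v.1.2)%N, isneg v.1.2
      & kdeg v.2 - kdeg v.1.1 - kdeg v.1.2 == h]].

Definition kvec (l : cform) (v : ktriple) : int :=
  l v.1.1 v.1.2 v.2 - l v.1.2 v.1.1 v.2.

Definition keval (A : pzRingType) (l : cform) (K : kidx -> kidx -> kidx -> A) : A :=
  \sum_a \sum_b \sum_c (l a b c)%:~R * K a b c.

Definition kpure (h : int) (l : cform) : Prop :=
  forall a b c, isneg a -> isneg b -> l a b c != 0 -> kdeg c - kdeg a - kdeg b = h.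

(** Skew-symmetry and support leave the unknowns [K a b c] with [a < b] negative, and purity
    confines them to one homogeneity; this keeps the systems small. *)
Lemma keval_vec h l (K : kidx -> kidx -> kidx -> R) : kpure h l ->
  (forall a b c, K a b c = - K b a c) ->
  (forall a b c, ~~ isneg a -> K a b c = 0) ->
  keval l K = \sum_(v <- ktriples h) (kvec l v)%:~R * K v.1.1 v.1.2 v.2.
Proof.
move=> lh Kc Kl.
have Kl' a b c : ~~ isneg b -> K a b c = 0 by move=> nb; rewrite Kc Kl // oppr0.
have Kaa a c : K a a c = 0 by have := Kc a a c; lra.
rewrite big_filter big_mkcond !big_allpairs_dep.
rewrite -sum_kidxs /keval.
pose f a b c := (l a b c)%:~R * K a b c.
have -> : \sum_a \sum_b \sum_c (l a b c)%:~R * K a b c =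
   \sum_(a : kidx) \sum_(b : kidx) \sum_c (if (a < b)%N then f a b c + f b a c else 0).
  transitivity (\sum_(a : kidx) \sum_(b : kidx) \sum_c (if (a < b)%N then f a b c else 0) +
                \sum_(a : kidx) \sum_(b : kidx) \sum_c (if (b < a)%N then f a b c else 0)).
    rewrite -big_split; apply: eq_bigr => a _; rewrite -big_split.
    apply: eq_bigr => b _; rewrite -big_split; apply: eq_bigr => c _ /=.
    rewrite -/(f a b c); case: ltngtP => ab; rewrite ?addr0 ?add0r //.
    by rewrite (val_inj ab) /f Kaa mulr0.
  rewrite [X in _ + X]exchange_big -big_split; apply: eq_bigr => a _ /=.
  rewrite -big_split; apply: eq_bigr => b _; rewrite -big_split.
  by apply: eq_bigr => c _ /=; case: ifP => _; rewrite ?addr0.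
apply: eq_bigr => a _; rewrite -sum_kidxs; apply: eq_bigr => b _; rewrite -sum_kidxs.
apply: eq_bigr => c _ /=; case: ifP => //= ab; rewrite /f.
case: ifP => [_|].
  by rewrite /kvec /= [K b a c]Kc rmorphB /= mulrBl mulrN.
case nb: (isneg b) => /=; last by rewrite Kl' ?nb // Kl ?nb // !mulr0 addr0.
move=> hne.
have na : isneg a by exact: ltn_trans ab nb.
have l0 a' b' : isneg a' -> isneg b' -> kdeg c - kdeg a' - kdeg b' != h -> l a' b' c = 0.
  by move=> na' nb' ne; apply/eqP/negPn/negP => /(lh _ _ _ na' nb') /eqP; rewrite (negbTE ne).
have -> : l a b c = 0 by apply: l0; rewrite ?hne.
have -> : l b a c = 0 by apply: l0; rewrite // addrAC hne.
by rewrite !mul0r addr0.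
Qed.

Definition krow (h : int) (l : cform) : seq Z :=
  [seq Z_of_int (kvec l v) | v <- ktriples h].

Definition kpureb (h : int) (l : cform) : bool :=
  all (fun a => all (fun b => ~~ (isneg a && isneg b) || all (fun c =>
    (l a b c == 0) || (kdeg c - kdeg a - kdeg b == h)) kidxs) kidxs) kidxs.

Lemma kpurebP h l : kpureb h l -> kpure h l.
Proof.
move=> /allP H a b c na nb nz; have /allP/(_ b (mem_kidxs b)) := H a (mem_kidxs a).
by rewrite na nb => /allP/(_ c (mem_kidxs c)); rewrite (negbTE nz) => /eqP.
Qed.

Definition consequence (h : int) (rows ts : seq cform) : bool :=
  [&& all (kpureb h) rows, all (kpureb h) ts
    & implied (size (ktriples h)) (map (krow h) rows) (map (krow h) ts)].

Lemma allIn (T : Type) (p : pred T) s x : all p s -> List.In x s -> p x.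
Proof. by elim: s => //= y s IH /andP[py /IH H] [<-|/H]. Qed.

Lemma consequenceP h rows ts (K : kidx -> kidx -> kidx -> R) :
  (forall a b c, K a b c = - K b a c) ->
  (forall a b c, ~~ isneg a -> K a b c = 0) ->
  consequence h rows ts ->
  (forall l, List.In l rows -> keval l K = 0) ->
  forall t, List.In t ts -> keval t K = 0.
Proof.
move=> Kc Kl /and3P[prows pts H] Hrows t tts.
pose xs := [seq K v.1.1 v.1.2 v.2 | v <- ktriples h].
have E l : kpureb h l -> keval l K = dot (krow h l) xs.
  by move=> /kpurebP hl; rewrite dot_map; exact: keval_vec.
have InP (l : seq cform) r : r \in map (krow h) l -> exists2 u, List.In u l & r = krow h u.
  elim: l => //= u l IH; rewrite inE => /orP[/eqP ->|/IH[v]]; first by exists u; [left|].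
  by exists v; [right|].
have wl l : wf (size (ktriples h)) (map (krow h) l).
  by move=> _ /InP[u _ ->]; rewrite size_map.
rewrite (E _ (allIn pts tts)); apply: (impliedP (wl ts) (wl rows)) H _ _; rewrite ?size_map //.
  by move=> _ /InP[u ur ->]; rewrite -E ?Hrows ?(allIn prows ur).
by elim: ts {pts} tts => //= u l IH [->|/IH]; rewrite inE ?eqxx // => ->; rewrite orbT.
Qed.

End LinearConsequences.

(** * The integer linear systems and their computed consequences *)

Definition sumz (f : kidx -> int) : int := foldr (fun a s => f a + s) 0 kidxs.

(* kip is 10 times the form with matrix gm *)
Definition gm (c d : kidx) : int :=
  if keq c d then (if keq c ph0 then 2 else 1)
  else if (keq c ph0 && keq d ph1) || (keq c ph1 && keq d ph0) then -1 else 0.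

(** Up to a constant factor, the inner product of a cochain with the Lie algebra differential of the
    elementary map sending e_r to e_s. *)
Definition normal_form (r s : kidx) : cform := fun a b c =>
  (if keq b r then sumz (fun d => gm c d * sc a s d) else 0)
  - (if keq a r then sumz (fun d => gm c d * sc b s d) else 0)
  - sc a b r * gm c s.

(** One cyclic term of the algebraic part of the Bianchi identity: the bracket of e_a with the
    curvature on e_b, e_c, and the curvature on [e_a, e_b], e_c. The derivative terms do not reach
    the lowest homogeneity. *)
Definition bianchi_term (a b c f : kidx) : cform := fun u v w =>
  (if keq u b && keq v c then sc a w f else 0)
  - (if keq v c && keq w f then sc a b u else 0).

Definition bianchi_form (a b c f : kidx) : cform := fun u v w =>
  bianchi_term a b c f u v w + bianchi_term b c a f u v w + bianchi_term c a b f u v w.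

Definition unit_form (a b c : kidx) : cform := fun u v w =>
  if [&& keq u a, keq v b & keq w c] then 1 else 0.

Definition sympz (a b : kidx) : int :=
  if [|| keq a om1 && keq b th3, keq a om2 && keq b th2 | keq a om3 && keq b th1] then 1
  else if [|| keq b om1 && keq a th3, keq b om2 && keq a th2 | keq b om3 && keq a th1] then -1
  else 0.

(** The component on e_a, e_b, e_c of T, the contraction of the curvature with rho_0. *)
Definition torsion_form (a b c : kidx) : cform := fun u v w =>
  (if keq u a && keq v b then sympz w c else 0)
  + (if keq u b && keq v c then sympz w a else 0)
  + (if keq u c && keq v a then sympz w b else 0).

Definition negs : seq kidx := [:: om1; om2; om3; th1; th2; th3; th0].

Definition neg3 : seq (kidx * kidx * kidx) :=
  [seq v : kidx * kidx * kidx <- [seq (u, c) | u <- [seq (a, b) | a <- negs, b <- negs], c <- negs] |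
    (v.1.1 < v.1.2 < v.2)%N].

Definition rows (h : int) : seq cform :=
  [seq normal_form v.1 v.2 | v <- [seq (r, s) | r <- negs, s <- kidxs] & kdeg v.2 - kdeg v.1 == h]
  ++ [seq bianchi_form v.1.1.1 v.1.1.2 v.1.2 v.2 | v <- [seq (t, f) | t <- neg3, f <- kidxs] &
       kdeg v.2 - kdeg v.1.1.1 - kdeg v.1.1.2 - kdeg v.1.2 == h].

Definition units (h : int) : seq cform :=
  [seq unit_form v.1.1 v.1.2 v.2 | v <- ktriples h].

(** The constant 4 comes from rho_0, which pairs only vectors whose degrees add up to -4. *)
Definition torsions (h : int) : seq cform :=
  [seq torsion_form v.1.1 v.1.2 v.2 | v <- neg3 &
    kdeg v.1.1 + kdeg v.1.2 + kdeg v.2 == - h - 4].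

Definition b12_forms : seq cform :=
  [:: unit_form th2 th3 om3; unit_form om2 th3 om3; unit_form om2 om3 om3;
      unit_form om2 om3 th3; unit_form th0 th3 om2; unit_form om3 th0 om2;
      unit_form om3 th0 th2].

Definition b3_form : cform := fun u v w =>
  unit_form om3 th0 om1 u v w - unit_form th0 th3 th1 u v w.

(* the components of the torsion which a form alpha /\ rho_0 cannot have *)
Definition primitive_torsions : seq cform :=
  [:: torsion_form om2 om3 th0; torsion_form om2 th3 th0; torsion_form th2 th3 th0;
      torsion_form th1 th2 th3; torsion_form om1 om2 om3; torsion_form om2 th1 th3;
      torsion_form om1 om3 th2].

(** Homogeneity 1 carries no free invariant. *)
Lemma consequence_1 : consequence 1 (rows 1) (units 1).
Proof. vm_cast_no_check (erefl true). Qed.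

(** The coefficients of b_1 and b_2 all have homogeneity 2 and account for all the freedom there. *)
Lemma consequence_2 : consequence 2 (rows 2 ++ b12_forms) (units 2).
Proof. vm_cast_no_check (erefl true). Qed.

(** The algebra behind necessity: b_1 and b_2 can be recovered from the primitive part of the
    torsion. *)
Lemma consequence_2' : consequence 2 (rows 2 ++ primitive_torsions) b12_forms.
Proof. vm_cast_no_check (erefl true). Qed.

(* a trace of the torsion which vanishes by normality and the Bianchi identity *)
Definition trace_form : cform := fun u v w =>
  torsion_form th0 om2 th3 u v w + torsion_form th0 om3 th2 u v w.

Lemma consequence_2s : consequence 2 (rows 2) [:: trace_form].
Proof. vm_cast_no_check (erefl true). Qed.

(** The invariant b_3 has homogeneity 3; from here on only the torsion has to be controlled, not the
    whole curvature. *)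
Lemma consequence_3 : consequence 3 (b3_form :: rows 3) (torsions 3).
Proof. vm_cast_no_check (erefl true). Qed.

(* Contracting the Bianchi identity with the symplectic pairing gives
   dT - phi_1 /\ T + K^{phi_1} /\ rho_0 = 0; these are its algebraic parts. *)
Definition wedge_form (a b c d : kidx) : cform := fun u v w =>
  if keq w ph1 then
    (if keq u a && keq v b then sympz c d else 0)
    - (if keq u a && keq v c then sympz b d else 0)
    + (if keq u a && keq v d then sympz b c else 0)
    + (if keq u b && keq v c then sympz a d else 0)
    - (if keq u b && keq v d then sympz a c else 0)
    + (if keq u c && keq v d then sympz a b else 0)
  else 0.

Definition dtorsion_form (a b c d : kidx) : cform := fun u v w =>
  let D a b c d :=
    sumz (fun e => let s := sc a b e in if s == 0 then 0 else s * torsion_form e c d u v w) in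
  - D a b c d + D a c b d - D a d b c - D b c a d + D b d a c - D c d a b.

Definition trick_form (a b c d : kidx) : cform := fun u v w =>
  dtorsion_form a b c d u v w + wedge_form a b c d u v w.

Definition neg4 : seq (kidx * kidx * kidx * kidx) :=
  [seq v : kidx * kidx * kidx * kidx <- [seq (t, d) | t <- neg3, d <- negs] |
    (v.1.2 < v.2)%N].

Definition quads (h : int) :=
  [seq v <- neg4 | kdeg v.1.1.1 + kdeg v.1.1.2 + kdeg v.1.2 + kdeg v.2 == - h - 4].

Definition tricks (h : int) : seq cform :=
  [seq trick_form v.1.1.1 v.1.1.2 v.1.2 v.2 | v <- quads h].

Definition wedges (h : int) : seq cform :=
  [seq wedge_form v.1.1.1 v.1.1.2 v.1.2 v.2 | v <- quads h].

Definition ph1_units (h : int) : seq cform :=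
  [seq unit_form v.1.1 v.1.2 ph1 | v <- ktriples h & v.2 == ph1].

(** Here the equations come only from differentiating d rho_0 once more, with the components of
    K^{phi_1} as additional unknowns. *)
Lemma consequence_4 : consequence 4 (tricks 4) (torsions 4).
Proof. vm_cast_no_check (erefl true). Qed.

(** Wedging 2-forms with rho_0 is injective since rho_0 has rank 6, as in the Lefschetz theorem. The
    homogeneities 2 to 6 arise because [ph1] has degree 0 and the arguments have degrees -1 to
    -3. *)
Lemma consequence_ph1 :
  all (fun h => consequence h (wedges h) (ph1_units h)) [:: 2; 3; 4; 5; 6].
Proof. vm_cast_no_check (erefl true). Qed.

(** * The inner product and normality *)

Section Killing.
Variable R : realType.

Lemma so_form_tr : (so_form R)^T = so_form R.
Proof.
apply/matrixP => i j; rewrite !mxE.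
by case: i => -[|[|[|[|[|[|[|//]]]]]]] h /=; case: j => -[|[|[|[|[|[|[|//]]]]]]] h' /=.
Qed.

Lemma so_form_sq : so_form R *m so_form R = 1%:M.
Proof.
apply/matrixP => i j; rewrite !mxE !big_ord_recl big_ord0 !mxE -val_eqE.
by case: i => -[|[|[|[|[|[|[|//]]]]]]] h /=;
   case: j => -[|[|[|[|[|[|[|//]]]]]]] h' /=; ring.
Qed.

Lemma in_so_tr (X : 'M[R]_7) : in_so X -> in_so X^T.
Proof.
rewrite /in_so => H.
have := congr1 (fun Z => so_form R *m Z *m so_form R) H.
rewrite mulmxDr mulmxDl !mulmxA so_form_sq mul1mx mulmx0 mul0mx -!mulmxA so_form_sq mulmx1.
by rewrite trmxK addrC.
Qed.

Lemma in_soE (X : 'M[R]_7) : in_so X -> so_form R *m X^T *m so_form R = - X.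
Proof.
move=> /eqP; rewrite /in_so addr_eq0 => /eqP H.
by rewrite -mulmxA H mulmxN mulmxA so_form_sq mul1mx.
Qed.

(** The trace on gl(n) of the map taking Z to P Z Q; the next lemma does the same for Z to P Z^T
    Q. *)
Lemma sum_delta_mul n (P Q : 'M[R]_n) :
  \sum_i \sum_j (P *m delta_mx i j *m Q) i j = \tr P * \tr Q.
Proof.
rewrite /mxtrace mulr_suml; apply: eq_bigr => i _; rewrite mulr_sumr.
apply: eq_bigr => j _; rewrite mxE (bigD1 j) //= [X in _ + X]big1 ?addr0.
  rewrite mxE (bigD1 i) //= [X in _ + X]big1 ?addr0 ?mxE ?eqxx ?mulr1 //.
  by move=> k /negbTE ki; rewrite mxE ki mulr0.
move=> k /negbTE kj; rewrite mxE big1 ?mul0r // => l _.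
by rewrite mxE kj andbF mulr0.
Qed.

Lemma sum_delta_tr_mul n (P Q : 'M[R]_n) :
  \sum_i \sum_j (P *m (delta_mx i j)^T *m Q) i j = \tr (P *m Q^T).
Proof.
rewrite /mxtrace; apply: eq_bigr => i _; rewrite mxE; apply: eq_bigr => j _.
rewrite trmx_delta mxE (bigD1 i) //= [X in _ + X]big1 ?addr0.
  rewrite mxE (bigD1 j) //= [X in _ + X]big1 ?addr0 ?mxE ?eqxx ?mulr1 //.
  by move=> k /negbTE ki; rewrite mxE ki mulr0.
move=> k /negbTE ki; rewrite mxE big1 ?mul0r // => l _.
by rewrite mxE ki andbF mulr0.
Qed.

Lemma in_so_trace (X : 'M[R]_7) : in_so X -> \tr X = 0.
Proof.
move=> /in_soE /(congr1 (fun Z => \tr Z)); rewrite mxtrace_mulC mulmxA so_form_sq.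
by rewrite mul1mx mxtrace_tr raddfN /=; lra.
Qed.

(** The factor 5 is n - 2 for so(n), n = 7. The untransposed half of [so_proj] contributes 7 tr(XY),
    as X and Y are trace-free; the transposed half subtracts 2 tr(XY). *)
Lemma killing_soE (X Y : 'M[R]_7) : in_so X -> in_so Y ->
  killing_so X Y = 5 * \tr (X *m Y).
Proof.
move=> sX sY; set S := so_form R.
have cZ (W Z : 'M[R]_7) a : commmx W (a *: Z) = a *: commmx W Z.
  by rewrite /commmx -scalemxAr -scalemxAl -scalerBr.
have cB (W Z Z' : 'M[R]_7) : commmx W (Z - Z') = commmx W Z - commmx W Z'.
  by rewrite /commmx mulmxBr mulmxBl !opprD opprK addrACA.
have G (Z : 'M[R]_7) : commmx X (commmx Y Z) =
    X *m Y *m Z - X *m Z *m Y - Y *m Z *m X + Z *m (Y *m X).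
  by rewrite /commmx mulmxBr mulmxBl !mulmxA opprD opprK addrA.
have ent (a b c d : 'M[R]_7) i j :
    (a - b - c + d) i j = a i j - b i j - c i j + d i j by rewrite !mxE.
have ent2 (a b : 'M[R]_7) i j : (2^-1 *: (a - b)) i j = 2^-1 * a i j - 2^-1 * b i j.
  by rewrite !mxE mulrBr.
have E i j : (commmx X (commmx Y (so_proj (delta_mx i j)))) i j =
  2^-1 * (((X *m Y) *m delta_mx i j *m 1%:M) i j - (X *m delta_mx i j *m Y) i j
     - (Y *m delta_mx i j *m X) i j + (1%:M *m delta_mx i j *m (Y *m X)) i j)
  - 2^-1 * (((X *m Y *m S) *m (delta_mx i j)^T *m S) i j
     - ((X *m S) *m (delta_mx i j)^T *m (S *m Y)) i j
     - ((Y *m S) *m (delta_mx i j)^T *m (S *m X)) i j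
     + (S *m (delta_mx i j)^T *m (S *m Y *m X)) i j).
  rewrite /so_proj -/S (cZ Y) (cZ X) (cB Y) (cB X) ent2 !G !ent mulmx1 mul1mx.
  by rewrite !mulmxA.
rewrite /killing_so.
under eq_bigr => i _ do under eq_bigr => j _ do rewrite E.
pose SS (G : 'I_7 -> 'I_7 -> R) := \sum_i \sum_j G i j.
have lin (a b c d : 'I_7 -> 'I_7 -> R) :
    \sum_i \sum_j 2^-1 * (a i j - b i j - c i j + d i j) =
    2^-1 * (SS a - SS b - SS c + SS d).
  under eq_bigr do rewrite -mulr_sumr; rewrite -mulr_sumr; congr (_ * _).
  under eq_bigr do rewrite big_split !sumrB /=.
  by rewrite big_split !sumrB.
under eq_bigr do rewrite sumrB; rewrite sumrB !lin.
rewrite /SS !sum_delta_mul !sum_delta_tr_mul.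
rewrite (in_so_trace sX) (in_so_trace sY) mxtrace1 !trmx_mul so_form_tr -/S.
have SXS := in_soE sX; have SYS := in_soE sY; rewrite -/S in SXS SYS.
have SS1 : S *m S = 1%:M by exact: so_form_sq.
have -> : X *m Y *m S *m S = X *m Y by rewrite -mulmxA SS1 mulmx1.
have -> : X *m S *m (Y^T *m S) = - (X *m Y) by rewrite -mulmxA mulmxA -mulmxN -SYS !mulmxA.
have -> : Y *m S *m (X^T *m S) = - (Y *m X) by rewrite -mulmxA mulmxA -mulmxN -SXS !mulmxA.
have -> : \tr (S *m (X^T *m (Y^T *m S))) = \tr (Y *m X).
  by rewrite mxtrace_mulC -!mulmxA SS1 mulmx1 -mxtrace_tr trmx_mul !trmxK.
rewrite !raddfN /= [\tr (Y *m X)]mxtrace_mulC.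
by field.
Qed.

Lemma mx_of_rowsE m n (s : seq (seq R)) i j :
  mx_of_rows m n s i j = nth 0 (nth [::] s i) j.
Proof. by rewrite mxE. Qed.

(** 10 is 5 times 2, as every nonzero entry of [k_to_so] occurs twice up to sign. The cross terms of
    [gm] come from the diagonal entries [ph0] and [ph1 - ph0]. *)
Lemma kipE (x y : 'rV[R]_13) :
  kip x y = 10 * \sum_c \sum_d (gm c d)%:~R * (x 0 c * y 0 d).
Proof.
rewrite /kip killing_soE; [|exact: k_to_so_in|]; last first.
  rewrite /cartan_invol; have := in_so_tr (k_to_so_in y); rewrite /in_so => H.
  by rewrite linearN /= mulNmx mulmxN -opprD H oppr0.
rewrite /cartan_invol mulmxN raddfN /= mulrN opprK.
have -> : \sum_c \sum_d (gm c d)%:~R * (x 0 c * y 0 d) =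
  \sum_c x 0 c * y 0 c + x 0 ph0 * y 0 ph0 - x 0 ph0 * y 0 ph1 - x 0 ph1 * y 0 ph0.
  rewrite !sum_kidxs /kidxs !big_cons !big_nil !sum_kidxs /kidxs !big_cons !big_nil /gm /=.
  ring.
have tr_mul (Y Z : 'M[R]_7) : \tr (Y *m Z^T) = \sum_i \sum_j Y i j * Z i j.
  by apply: eq_bigr => i _; rewrite mxE; apply: eq_bigr => j _; rewrite [Z^T _ _]mxE.
rewrite tr_mul sum_kidxs !big_cons big_nil.
under eq_bigr => i _ do rewrite !big_ord_recl big_ord0 !mx_of_rowsE /=.
rewrite !big_ord_recl big_ord0 /=; ring.
Qed.

Lemma kbr_brk (x y : 'rV[R]_13) c : kbr x y 0 c = brk (x 0) (y 0) c.
Proof.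
have E (X Y : 'M[R]_5) (i j : nat) :
   (X *m Y - Y *m X) (inord i) (inord j) =
   \sum_(k < 5) (X (inord i) k * Y k (inord j) - Y (inord i) k * X k (inord j)).
  by rewrite !mxE -sumrB.
by move: c; apply: kidx_ind; rewrite /kbr mxE /= !E !big_ord_recl !big_ord0
  !mx_of_rowsE !inordK //= /brk /=; field.
Qed.

End Killing.

Section Normality.
Variable R : realType.

Lemma sumzE (f : kidx -> int) : sumz f = \sum_d f d.
Proof. by rewrite sum_kidxs unlock. Qed.

(** The inverse of [gm]. It is the identity on the negative part, so raising the form indices of a
    curvature function changes nothing. *)
Definition gmV (c d : kidx) : int :=
  if c == d then (if c == ph1 then 2 else 1)
  else if ((c == ph0) && (d == ph1)) || ((c == ph1) && (d == ph0)) then 1 else 0.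

Lemma gm_gmV c e : sumz (fun d => gm c d * gmV d e) = (c == e)%:R.
Proof.
have : all (fun c => all (fun e => sumz (fun d => gm c d * gmV d e) == (c == e)%:R)
   kidxs) kidxs by vm_compute.
by move=> /allP/(_ c (mem_kidxs c))/allP/(_ e (mem_kidxs e))/eqP.
Qed.

Lemma kbasisE a b : kbasis R a 0 b = (a == b)%:R.
Proof. by rewrite mxE eqxx eq_sym. Qed.

Lemma kgramE a b : kgram R a b = 10 * (gm a b)%:~R.
Proof.
rewrite mxE kipE; congr (_ * _).
under eq_bigr => c _ do under eq_bigr => d _ do rewrite !kbasisE mulrC -mulrA.
under eq_bigr => c _ do rewrite -mulr_sumr sum_delta.
by rewrite sum_delta.
Qed.

Lemma invmx_kgram a b : invmx (kgram R) a b = 10^-1 * (gmV a b)%:~R.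
Proof.
pose G : 'M[R]_13 := \matrix_(a, b) (10^-1 * (gmV a b)%:~R).
have GG : kgram R *m G = 1%:M.
  apply/matrixP => c e; rewrite !mxE.
  transitivity ((sumz (fun d => gm c d * gmV d e))%:~R : R); last first.
    by rewrite gm_gmV rmorph_nat.
  rewrite sumzE rmorph_sum; apply: eq_bigr => d _.
  by rewrite kgramE mxE rmorphM /=; field.
have [uG _] := mulmx1_unit GG.
by rewrite -[invmx _]mulmx1 -GG mulKmx // mxE.
Qed.

Lemma gmV_neg a b : isneg a -> gmV a b = (a == b)%:R.
Proof.
have : all (fun a => all (fun b => isneg a ==> (gmV a b == (a == b)%:R)) kidxs) kidxs.
  by vm_compute.
move=> /allP/(_ a (mem_kidxs a))/allP/(_ b (mem_kidxs b)) H na.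
by move: H; rewrite na => /eqP.
Qed.

Lemma kip0 y : kip 0 y = 0 :> R.
Proof.
by rewrite kipE big1 ?mulr0 // => c _; rewrite big1 // => d _; rewrite mxE mul0r mulr0.
Qed.

Definition supported (K : kcochain2 R) :=
  forall a b, ~~ (isneg a && isneg b) -> K a b = 0.

Lemma kip2E (K H : kcochain2 R) : supported K ->
  kip2 K H = 2^-1 * (10^-1 * (10^-1 * \sum_a \sum_b kip (K a b) (H a b))).
Proof.
move=> sK; rewrite /kip2; congr (_ * _); rewrite !mulr_sumr; apply: eq_bigr => a _.
rewrite !mulr_sumr; apply: eq_bigr => b _.
have [/andP[na nb]|nab] := boolP (isneg a && isneg b); last first.
  rewrite sK // kip0 !mulr0 big1 // => a' _; rewrite big1 // => b' _.
  by rewrite kip0 mulr0.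
under eq_bigr => a' _ do under eq_bigr => b' _ do
  rewrite !invmx_kgram !gmV_neg // !rmorph_nat mulrACA -[_ * _ * kip _ _]mulrA -[(a == a')%:R * _ * _]mulrA.
under eq_bigr => a' _ do rewrite -mulr_sumr -mulr_sumr sum_delta.
by rewrite -mulr_sumr sum_delta mulrA.
Qed.

Lemma brk_basis a b c : brk (kbasis R a 0) (kbasis R b 0) c = (sc a b c)%:~R.
Proof.
rewrite brkE.
under eq_bigr => u _ do under eq_bigr => v _ do rewrite !kbasisE mulrC -mulrA.
under eq_bigr => u _ do rewrite -mulr_sumr sum_delta.
by rewrite sum_delta.
Qed.

Lemma kdiff_delta r s a b d : kdiff (delta_mx r s : 'M[R]_13) a b 0 d =
  (if b == r then (sc a s d)%:~R else 0) - (if a == r then (sc b s d)%:~R else 0)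
  - (sc a b r)%:~R * (s == d)%:R.
Proof.
have E u : kbasis R u *m delta_mx r s = (u == r)%:R *: kbasis R s.
  by rewrite mul_delta_mx_cond; case: (u == r); rewrite ?scale1r ?scale0r.
have Z u v (t : bool) : kbr (kbasis R u) (t%:R *: kbasis R v) 0 d =
    if t then (sc u v d)%:~R else 0.
  case: t; first by rewrite scale1r kbr_brk brk_basis.
  rewrite scale0r kbr_brk brkE big1 // => i _; rewrite big1 // => j _.
  by rewrite !mxE !mulr0.
have ent (x y z : 'rV[R]_13) : (x - y - z) 0 d = x 0 d - y 0 d - z 0 d by rewrite !mxE.
rewrite /kdiff !E ent !Z; congr (_ - _ - _).
rewrite mxE (bigD1 r) //= big1 ?addr0 => [|k /negbTE kr]; last first.
  by rewrite [delta_mx _ _ _ _]mxE kr mulr0.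
by rewrite [delta_mx _ _ _ _]mxE eqxx kbr_brk brk_basis eq_sym.
Qed.

(** Adjointness is tested on the elementary maps [delta_mx r s]; the constants of the inner products
    are nonzero and cancel. *)
Lemma normal_keval ds (K : kcochain2 R) r s : kadjoint ds -> ds K = 0 -> supported K ->
  keval (normal_form r s) (fun a b c => K a b 0 c) = 0.
Proof.
move=> adj dK sK; have := adj K (delta_mx r s); rewrite dK kip2E //.
have -> : kip1 (0 : 'M[R]_13) (delta_mx r s) = 0.
  by rewrite /kip1 big1 // => a _; rewrite big1 // => b _; rewrite row0 kip0 mulr0.
move=> /eqP; rewrite eq_sym !mulf_eq0 !invr_eq0 !pnatr_eq0 /= => /eqP E.
apply: (mulfI (x := 10)); first by rewrite pnatr_eq0.
rewrite mulr0 -[RHS]E /keval mulr_sumr; apply: eq_bigr => a _.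
rewrite mulr_sumr; apply: eq_bigr => b _; rewrite kipE; congr (_ * _).
apply: eq_bigr => c _; under [RHS]eq_bigr => d _ do rewrite mulrCA.
rewrite -mulr_sumr mulrC; congr (_ * _).
under eq_bigr => d _ do rewrite kdiff_delta !mulrBr.
rewrite !sumrB /normal_form !keqE !sumzE !rmorphB /=; congr (_ - _ - _).
- case: (b == r); last by rewrite big1 // => d _; rewrite mulr0.
  by rewrite rmorph_sum; apply: eq_bigr => d _; rewrite rmorphM.
- case: (a == r); last by rewrite big1 // => d _; rewrite mulr0.
  by rewrite rmorph_sum; apply: eq_bigr => d _; rewrite rmorphM.
under eq_bigr => d _ do rewrite mulrC -mulrA mulrCA.
by rewrite sum_delta rmorphM.
Qed.

End Normality.

(** * Moving frames *)

Section Contractions.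
Variables (A : comNzRingType) (n : nat) (d : 'I_n -> {additive A -> A}).
Hypothesis dM : forall i f g, d i (f * g) = d i f * g + f * d i g.
Notation vec := ('I_n -> A).
Implicit Types (Y Z V U : vec) (w : vec) (M : 'I_n -> vec) (N : 'I_n -> 'I_n -> vec).

(** Forms are arrays of coordinate components, and [ct1], [ct2], [ct3] evaluate them on vector
    fields. *)
Definition ct1 w Y : A := \sum_i Y i * w i.
Definition ct2 M Y Z : A := ct1 (fun i => ct1 (M i) Z) Y.
Definition ct3 N Y Z V : A := ct1 (fun i => ct2 (N i) Z V) Y.
Definition der Y (g : A) : A := ct1 (fun i => d i g) Y.
Definition dvec Y Z : vec := fun j => der Y (Z j).
Definition lie Y Z : vec := fun j => der Y (Z j) - der Z (Y j).

Lemma ct1D w w' Y : ct1 (fun i => w i + w' i) Y = ct1 w Y + ct1 w' Y.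
Proof. by rewrite -big_split; apply: eq_bigr => i _ /=; rewrite mulrDr. Qed.
Lemma ct1N w Y : ct1 (fun i => - w i) Y = - ct1 w Y.
Proof. by rewrite -sumrN; apply: eq_bigr => i _; rewrite mulrN. Qed.
Lemma ct1B w w' Y : ct1 (fun i => w i - w' i) Y = ct1 w Y - ct1 w' Y.
Proof. by rewrite ct1D ct1N. Qed.
Lemma ct1Bv w Y Z : ct1 w (fun i => Y i - Z i) = ct1 w Y - ct1 w Z.
Proof. by rewrite -sumrB; apply: eq_bigr => i _; rewrite mulrBl. Qed.
Lemma eq_ct1 w w' Y : (forall i, w i = w' i) -> ct1 w Y = ct1 w' Y.
Proof. by move=> E; apply: eq_bigr => i _; rewrite E. Qed.
Lemma ct1_0 Y : ct1 (fun=> 0) Y = 0.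
Proof. by rewrite /ct1 big1 // => i _; rewrite mulr0. Qed.
Lemma ct1C M Y Z : ct1 (fun i => ct1 (M i) Z) Y = ct1 (fun j => ct1 (fun i => M i j) Y) Z.
Proof.
rewrite /ct1; under eq_bigr do rewrite mulr_sumr.
rewrite exchange_big; apply: eq_bigr => i _; rewrite mulr_sumr.
by apply: eq_bigr => j _; rewrite mulrCA.
Qed.
Lemma ct1_lin (I : finType) w (c : I -> A) (Y : I -> vec) :
  ct1 w (fun j => \sum_e c e * Y e j) = \sum_e c e * ct1 w (Y e).
Proof.
rewrite /ct1; under eq_bigr do rewrite mulr_suml.
rewrite exchange_big; apply: eq_bigr => e _; rewrite mulr_sumr.
by apply: eq_bigr => i _; rewrite mulrA.
Qed.

Lemma ct3_rot N Y Z V : ct3 N Y Z V = ct3 (fun i j k => N k i j) Z V Y.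
Proof. rewrite /ct3 /ct2 ct1C; apply: eq_ct1 => i; rewrite ct1C; exact: eq_ct1. Qed.

Lemma ct3_wedge w M Y Z V :
  ct3 (fun i j k => w i * M j k + w j * M k i + w k * M i j) Y Z V =
  ct1 w Y * ct2 M Z V + ct1 w Z * ct2 M V Y + ct1 w V * ct2 M Y Z.
Proof.
have E U1 U2 U3 : ct3 (fun i j k => w i * M j k) U1 U2 U3 = ct1 w U1 * ct2 M U2 U3.
  rewrite /ct3 {1}/ct1 [ct1 w _]/ct1 mulr_suml; apply: eq_bigr => i _.
  rewrite -mulrA; congr (_ * _); rewrite /ct2 {1}/ct1 [ct1 _ U2]/ct1 mulr_sumr.
  apply: eq_bigr => j _; rewrite mulrCA; congr (_ * _).
  by rewrite /ct1 mulr_sumr; apply: eq_bigr => k _; rewrite mulrCA.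
rewrite -!E -[ct3 (fun i j k => w i * M j k) Z V Y](ct3_rot (fun i j k => w j * M k i)).
rewrite -[ct3 (fun i j k => w i * M j k) V Y Z](ct3_rot (fun i j k => w j * M k i)).
rewrite -[ct3 (fun i j k => w j * M k i) Z V Y](ct3_rot (fun i j k => w k * M i j)).
rewrite /ct3 /ct2 -!ct1D; apply: eq_ct1 => i; rewrite -!ct1D; apply: eq_ct1 => j.
by rewrite -!ct1D; apply: eq_ct1 => k.
Qed.

Lemma derM Y f g : der Y (f * g) = der Y f * g + f * der Y g.
Proof.
rewrite /der /ct1 mulr_suml mulr_sumr -big_split; apply: eq_bigr => i _ /=.
by rewrite dM; ring.
Qed.
Lemma derD Y f g : der Y (f + g) = der Y f + der Y g.
Proof. by rewrite -ct1D; apply: eq_ct1 => i; rewrite raddfD. Qed.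
Lemma der0 Y : der Y 0 = 0.
Proof. by apply: (addrI (der Y 0)); rewrite -derD !addr0. Qed.
Lemma der_sum (I : finType) Y (f : I -> A) : der Y (\sum_e f e) = \sum_e der Y (f e).
Proof. by apply: (big_morph (der Y) (derD Y) (der0 Y)). Qed.
Lemma d_int i (z : int) : d i z%:~R = 0.
Proof.
rewrite raddfMz (_ : d i 1 = 0) ?mul0rz //.
by apply: (addrI (d i 1)); rewrite addr0 -{3}[1]mulr1 dM mulr1 mul1r.
Qed.
Lemma der_int Y (z : int) : der Y z%:~R = 0.
Proof. by rewrite -(ct1_0 Y); apply: eq_ct1 => i; exact: d_int. Qed.

Lemma der_ct1 Y w Z :
  der Y (ct1 w Z) = ct1 w (dvec Y Z) + ct1 (fun i => der Y (w i)) Z.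
Proof.
rewrite {1}/ct1 der_sum -big_split; apply: eq_bigr => i _; exact: derM.
Qed.
Lemma der_ct2 Y M Z V : der Y (ct2 M Z V) =
  ct2 M (dvec Y Z) V + ct2 M Z (dvec Y V) + ct2 (fun i j => der Y (M i j)) Z V.
Proof.
rewrite /ct2 der_ct1 -addrA; congr (_ + _); rewrite -ct1D; apply: eq_ct1 => i.
by rewrite der_ct1.
Qed.
Lemma der_ct3 Y N Z V U : der Y (ct3 N Z V U) =
  ct3 N (dvec Y Z) V U + ct3 N Z (dvec Y V) U + ct3 N Z V (dvec Y U)
  + ct3 (fun i j k => der Y (N i j k)) Z V U.
Proof.
rewrite /ct3 der_ct1 -!addrA; congr (_ + _); rewrite -!ct1D; apply: eq_ct1 => i.
by rewrite der_ct2 addrA.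
Qed.

Lemma cartan1 w Y Z :
  ct2 (fun i j => d i (w j) - d j (w i)) Y Z =
  der Y (ct1 w Z) - der Z (ct1 w Y) - ct1 w (lie Y Z).
Proof.
rewrite !der_ct1 /lie ct1Bv -/(dvec Y Z) -/(dvec Z Y).
have -> : ct2 (fun i j => d i (w j) - d j (w i)) Y Z =
    ct1 (fun i => der Y (w i)) Z - ct1 (fun i => der Z (w i)) Y.
  rewrite /ct2; under eq_fun do rewrite ct1B.
  by rewrite ct1B; congr (_ - _); rewrite ct1C.
ring.
Qed.

Section Two.
Variable M : 'I_n -> vec.
Hypothesis MN : forall i j, M i j = - M j i.

Lemma ct2N Y Z : ct2 M Y Z = - ct2 M Z Y.
Proof.
rewrite /ct2 ct1C -ct1N; apply: eq_ct1 => j; rewrite -ct1N; apply: eq_ct1 => i.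
exact: MN.
Qed.

(** The coordinate-free formula for the exterior derivative of a 2-form: the terms that
    differentiate the vector fields recombine into Lie brackets. *)
Lemma cartan2 Y Z V :
  ct3 (fun i j k => d i (M j k) + d j (M k i) + d k (M i j)) Y Z V =
  (der Y (ct2 M Z V) - ct2 M (lie Y Z) V) + (der Z (ct2 M V Y) - ct2 M (lie Z V) Y)
  + (der V (ct2 M Y Z) - ct2 M (lie V Y) Z).
Proof.
have L a b c : ct2 M (lie a b) c = ct2 M (dvec a b) c + ct2 M c (dvec b a).
  by rewrite [ct2 M c _]ct2N /ct2 -ct1Bv.
have -> : ct3 (fun i j k => d i (M j k) + d j (M k i) + d k (M i j)) Y Z V =
   ct2 (fun i j => der Y (M i j)) Z V + ct2 (fun i j => der Z (M i j)) V Y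
   + ct2 (fun i j => der V (M i j)) Y Z.
  rewrite /ct3 /ct2.
  under eq_fun => i do under eq_fun => j do rewrite ct1D ct1D.
  under eq_fun => i do rewrite !ct1D.
  rewrite !ct1D; congr (_ + _ + _).
  - rewrite ct1C; apply: eq_ct1 => j; rewrite ct1C; exact: eq_ct1.
  - rewrite [RHS]ct1C; apply: eq_ct1 => i; rewrite [RHS]ct1C ct1C.
    by rewrite ct1C; apply: eq_ct1 => j; exact: eq_ct1.
rewrite !der_ct2 !L; ring.
Qed.
End Two.

Section Three.
Variable N : 'I_n -> 'I_n -> vec.
Hypothesis Ncyc : forall i j k, N i j k = N j k i.
Hypothesis NN : forall i j k, N i j k = - N j i k.
Hypothesis N_closed : forall i j k l,
  d i (N j k l) - d j (N i k l) + d k (N i j l) - d l (N i j k) = 0.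

Lemma ct3N Y Z V : ct3 N Y Z V = - ct3 N Z Y V.
Proof.
rewrite /ct3 /ct2 ct1C -ct1N; apply: eq_ct1 => j; rewrite -ct1N; apply: eq_ct1 => i.
by rewrite -ct1N; apply: eq_ct1 => k; exact: NN.
Qed.

Lemma ct3cyc Y Z V : ct3 N Y Z V = ct3 N Z V Y.
Proof.
rewrite /ct3 /ct2 ct1C; apply: eq_ct1 => j; rewrite ct1C; apply: eq_ct1 => k.
by apply: eq_ct1 => i; exact: Ncyc.
Qed.

(** The analogous formula for a closed 3-form; it will be applied to d rho_0. *)
Lemma cartan3 Y Z V U :
  der Y (ct3 N Z V U) - der Z (ct3 N Y V U) + der V (ct3 N Y Z U)
  - der U (ct3 N Y Z V)
  - ct3 N (lie Y Z) V U + ct3 N (lie Y V) Z U - ct3 N (lie Y U) Z V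
  - ct3 N (lie Z V) Y U + ct3 N (lie Z U) Y V - ct3 N (lie V U) Y Z = 0.
Proof.
have L a b c e : ct3 N (lie a b) c e = ct3 N (dvec a b) c e - ct3 N (dvec b a) c e.
  by rewrite /ct3 -ct1Bv.
have C0 : ct3 (fun i j k => der Y (N i j k)) Z V U
   - ct3 (fun i j k => der Z (N i j k)) Y V U
   + ct3 (fun i j k => der V (N i j k)) Y Z U
   - ct3 (fun i j k => der U (N i j k)) Y Z V = 0.
  pose c4 (Q : 'I_n -> 'I_n -> 'I_n -> vec) := ct1 (fun i => ct3 (Q i) Z V U) Y.
  have -> : ct3 (fun i j k => der Y (N i j k)) Z V U = c4 (fun i j k l => d i (N j k l)).
    rewrite /c4 /ct3 /ct2 [RHS]ct1C; apply: eq_ct1 => j; rewrite [RHS]ct1C.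
    by apply: eq_ct1 => k; rewrite [RHS]ct1C.
  have -> : ct3 (fun i j k => der Z (N i j k)) Y V U = c4 (fun i j k l => d j (N i k l)).
    rewrite /c4 /ct3 /ct2; apply: eq_ct1 => i; rewrite [RHS]ct1C.
    by apply: eq_ct1 => k; rewrite [RHS]ct1C.
  have -> : ct3 (fun i j k => der V (N i j k)) Y Z U = c4 (fun i j k l => d k (N i j l)).
    rewrite /c4 /ct3 /ct2; apply: eq_ct1 => i; apply: eq_ct1 => j; by rewrite [RHS]ct1C.
  have -> : ct3 (fun i j k => der U (N i j k)) Y Z V = c4 (fun i j k l => d l (N i j k)).
    by [].
  rewrite /c4 /ct3 /ct2 -!(ct1B, ct1D).
  rewrite -[RHS](ct1_0 Y); apply: eq_ct1 => i; rewrite -!(ct1B, ct1D).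
  rewrite -[RHS](ct1_0 Z); apply: eq_ct1 => j; rewrite -!(ct1B, ct1D).
  rewrite -[RHS](ct1_0 V); apply: eq_ct1 => k; rewrite -!(ct1B, ct1D).
  by rewrite -[RHS](ct1_0 U); apply: eq_ct1 => l; exact: N_closed.
rewrite -[RHS]C0 !der_ct3 !L.
have S1 a b c e : ct3 N a (dvec b c) e = - ct3 N (dvec b c) a e by exact: ct3N.
have S2 a b c e : ct3 N a b (dvec c e) = ct3 N (dvec c e) a b by rewrite [RHS]ct3cyc.
rewrite !S1 !S2; ring.
Qed.
End Three.

End Contractions.

Lemma isnegE a : isneg a = (kdeg a < 0).
Proof. by move: a; apply: kidx_ind. Qed.

Lemma foldr_cons (T S : Type) (f : T -> S -> S) z x s : foldr f z (x :: s) = f x (foldr f z s).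
Proof. by []. Qed.

(** * Structure equations and the Bianchi identity in the frame *)

Section Frame.
Variables (A : comNzRingType) (d : 'I_7 -> {additive A -> A}).
Hypothesis dM : forall i f g, d i (f * g) = d i f * g + f * d i g.
Hypothesis dC : forall i j f, d i (d j f) = d j (d i f).
Variables (P : 'I_7 -> kidx -> A) (X : kidx -> 'I_7 -> A).
Hypothesis X_out : forall a i, ~~ isneg a -> X a i = 0.
Hypothesis XP : forall a b, isneg a -> isneg b ->
  ct1 (fun i => P i b) (X a) = (a == b)%:R.
Hypothesis PX : forall i j, \sum_b P i b * X b j = (i == j)%:R.

(* [P i] is the value on the i-th coordinate field of the pullback of the Cartan
   connection by a section, and [X] the dual frame, extended by 0 on l; [Om] is
   the curvature form, [ps a] the connection on [X a], [KK] the curvature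
   function, and [Cc] the structure functions of the frame. *)
Definition Om i j (f : kidx) : A := d i (P j f) - d j (P i f) + brk (P i) (P j) f.
Definition ps (a f : kidx) : A := ct1 (fun i => P i f) (X a).
Definition KK (a b f : kidx) : A := ct2 (fun i j => Om i j f) (X a) (X b).
Definition Cc (a b e : kidx) : A := ct1 (fun i => P i e) (lie d (X a) (X b)).

Lemma brk_ctl (x : 'I_7 -> kidx -> A) y f Y :
  brk (fun g => ct1 (fun i => x i g) Y) y f = ct1 (fun i => brk (x i) y f) Y.
Proof.
rewrite /brk; elim: (nth _ _ _) => [|t l IH] /=; first by rewrite ct1_0.
rewrite IH ct1D; congr (_ + _); rewrite /ct1 !mulr_suml -sumrB mulr_sumr.
by apply: eq_bigr => i _; ring.
Qed.

Lemma brk_ctr (x : 'I_7 -> kidx -> A) y f Y :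
  brk y (fun g => ct1 (fun i => x i g) Y) f = ct1 (fun i => brk y (x i) f) Y.
Proof.
by rewrite brkC brk_ctl -ct1N; apply: eq_ct1 => i; rewrite [RHS]brkC.
Qed.

Lemma brkB_r (x y z : kidx -> A) f :
  brk x (fun g => y g - z g) f = brk x y f - brk x z f.
Proof.
rewrite /brk; elim: (nth _ _ _) => [|t l IH] /=; first by rewrite subr0.
by rewrite IH; ring.
Qed.

Lemma brkD_r (x y z : kidx -> A) f :
  brk x (fun g => y g + z g) f = brk x y f + brk x z f.
Proof.
rewrite /brk; elim: (nth _ _ _) => [|t l IH] /=; first by rewrite addr0.
by rewrite IH; ring.
Qed.

Lemma d_brk i x y f :
  d i (brk x y f) = brk (fun g => d i (x g)) y f + brk x (fun g => d i (y g)) f.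
Proof.
rewrite /brk; elim: (nth _ _ _) => [|t l IH]; first by rewrite /= raddf0 addr0.
rewrite !(foldr_cons _ _ t) raddfD {}IH dM (d_int dM) raddfB !dM.
set u := foldr _ _ _; set v := foldr _ _ _; set c := intmul _ _.
ring.
Qed.

Lemma OmN i j f : Om i j f = - Om j i f.
Proof. by rewrite /Om [brk (P j) _ _]brkC; ring. Qed.

(** Second derivatives cancel because the derivations commute, and triple brackets by the Jacobi
    identity. *)
Lemma bianchi_coord i j k f :
  d i (Om j k f) + d j (Om k i f) + d k (Om i j f) =
  - (brk (P i) (Om j k) f + brk (P j) (Om k i) f + brk (P k) (Om i j) f).
Proof.
have J := brk_jacobi (P i) (P j) (P k) f.
have E a b c : brk (P a) (Om b c) f = brk (P a) (fun g => d b (P c g)) f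
    - brk (P a) (fun g => d c (P b g)) f + brk (P a) (brk (P b) (P c)) f.
  by rewrite -brkB_r -brkD_r.
rewrite !E /Om !(raddfD, raddfB) /= !d_brk.
rewrite (dC i j) (dC j k) (dC k i) ![brk (fun g => d _ (P _ g)) _ _]brkC.
move/eqP: J; rewrite -addrA addr_eq0 => /eqP ->; ring.
Qed.

Lemma lieE a b j : lie d (X a) (X b) j = \sum_e Cc a b e * X e j.
Proof.
rewrite /Cc /ct1; under eq_bigr do rewrite mulr_suml.
rewrite exchange_big /=.
under eq_bigr => i _.
  under eq_bigr do rewrite -mulrA.
  rewrite -mulr_sumr PX; over.
rewrite (bigD1 j) //= eqxx mulr1 big1 ?addr0 // => i /negbTE ->.
by rewrite mulr0.
Qed.

Lemma ct1_lie w a b : ct1 w (lie d (X a) (X b)) = \sum_e Cc a b e * ct1 w (X e).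
Proof. by rewrite -ct1_lin; congr (ct1 w _); apply/funext => j; exact: lieE. Qed.

Lemma ct1_X_out w a : ~~ isneg a -> ct1 w (X a) = 0.
Proof. by move=> na; rewrite /ct1 big1 // => i _; rewrite X_out // mul0r. Qed.

Lemma KKN a b f : KK a b f = - KK b a f.
Proof. by apply: ct2N => i j; exact: OmN. Qed.

Lemma KK_out a b f : ~~ isneg a -> KK a b f = 0.
Proof. exact: ct1_X_out. Qed.

Lemma ps_neg a b : isneg b -> ps a b = (isneg a && (a == b))%:R.
Proof.
by move=> nb; case na: (isneg a); [exact: XP|rewrite /ps ct1_X_out ?na].
Qed.

Lemma KK_struct a b f : KK a b f =
  der d (X a) (ps b f) - der d (X b) (ps a f) - Cc a b f + brk (ps a) (ps b) f.
Proof.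
have -> : brk (ps a) (ps b) f = ct2 (fun i j => brk (P i) (P j) f) (X a) (X b).
  by rewrite brk_ctl; apply: eq_ct1 => i; rewrite brk_ctr.
rewrite -(cartan1 dM) /KK /ct2 -ct1D; apply: eq_ct1 => i.
by rewrite -ct1D.
Qed.

(** In negative degrees [ps] is constant on the frame, so the structure equation loses its
    derivatives. *)
Lemma Cc_neg a b e : isneg e -> Cc a b e = brk (ps a) (ps b) e - KK a b e.
Proof.
move=> ne; have D u v : der d (X u) (ps v e) = 0.
  by rewrite (ps_neg v ne) -[_%:R]/((isneg v && (v == e))%:Z%:~R) (der_int dM).
rewrite KK_struct !D; move: (Cc a b e) (brk _ _ _) => u v; ring.
Qed.

Lemma bianchi_frame a b c f :
  (der d (X a) (KK b c f) - \sum_e Cc a b e * KK e c f + brk (ps a) (KK b c) f)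
  + (der d (X b) (KK c a f) - \sum_e Cc b c e * KK e a f + brk (ps b) (KK c a) f)
  + (der d (X c) (KK a b f) - \sum_e Cc c a e * KK e b f + brk (ps c) (KK a b) f) = 0.
Proof.
have B u v w : brk (ps u) (KK v w) f =
    ct3 (fun i j k => brk (P i) (Om j k) f) (X u) (X v) (X w).
  rewrite brk_ctl; apply: eq_ct1 => i; rewrite /KK brk_ctr; apply: eq_ct1 => j.
  by rewrite brk_ctr.
have L u v w : \sum_e Cc u v e * KK e w f =
    ct2 (fun i j => Om i j f) (lie d (X u) (X v)) (X w).
  by rewrite [RHS]ct1_lie.
have := cartan2 dM (fun i j => OmN i j f) (X a) (X b) (X c).
rewrite !L -!/(KK _ _ _).
have -> : ct3 (fun i j k => d i (Om j k f) + d j (Om k i f) + d k (Om i j f))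
    (X a) (X b) (X c) = - (brk (ps a) (KK b c) f + brk (ps b) (KK c a) f
      + brk (ps c) (KK a b) f).
  rewrite !B.
  rewrite [ct3 _ (X c) (X a) (X b)]ct3_rot [ct3 _ (X b) (X c) (X a)]ct3_rot [ct3 _ (X c) (X a) (X b)]ct3_rot.
  rewrite /ct3 /ct2 -!ct1D -ct1N; apply: eq_ct1 => i; rewrite -!ct1D -ct1N /=.
  apply: eq_ct1 => j; rewrite -!ct1D -ct1N; apply: eq_ct1 => k /=.
  by rewrite bianchi_coord.
move/eqP; rewrite -subr_eq0 => /eqP H; rewrite -[RHS]oppr0 -H; ring.
Qed.

Lemma ps_deg a g : isneg a -> kdeg g <= kdeg a -> ps a g = (a == g)%:R.
Proof.
move=> na dg; have ng : isneg g by rewrite isnegE (le_lt_trans dg) // -isnegE.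
by rewrite ps_neg // na.
Qed.

(** Apart from e_a, [ps a] has only components of degree above that of [a]; these could reach [f]
    only from components of [y] below the bound. *)
Lemma brk_ps_lead a y f : isneg a ->
  (forall g, kdeg g < kdeg f - kdeg a -> y g = 0) ->
  brk (ps a) y f = \sum_g (sc a g f)%:~R * y g.
Proof.
move=> na Hy; rewrite brkE -[RHS](sum_delta a (fun b => \sum_g (sc b g f)%:~R * y g)).
apply: eq_bigr => b _; rewrite mulr_sumr; apply: eq_bigr => g _.
have [ab|ab] := leP (kdeg b) (kdeg a).
  by rewrite (ps_deg na ab) mulrCA.
have [->|/sc_deg dg] := eqVneq (sc b g f) 0; first by rewrite !mul0r mulr0.
by rewrite Hy ?mulr0 // -dg; lia.
Qed.

Hypothesis regular : forall a b f, kdeg f <= kdeg a + kdeg b -> KK a b f = 0.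

(** Regularity removes the curvature in these degrees, which leaves the brackets of the graded
    algebra. *)
Lemma Cc_lead a b e : isneg a -> isneg b -> isneg e -> kdeg e <= kdeg a + kdeg b ->
  Cc a b e = (sc a b e)%:~R.
Proof.
move=> na nb ne de; rewrite Cc_neg // (regular de) subr0 brk_ps_lead //.
  rewrite -[RHS](sum_delta b (fun g => (sc a g e)%:~R)).
  apply: eq_bigr => g _; rewrite mulrC.
  have [->|/sc_deg dg] := eqVneq (sc a g e) 0; first by rewrite !mulr0.
  by rewrite ps_deg //; lia.
move=> g dg; rewrite ps_deg //; last by lia.
by have /negbTE -> : b != g by [apply/eqP => bg; rewrite bg in de; lia].
Qed.

Lemma keval_bianchi_term a b c f (K : kidx -> kidx -> kidx -> A) :
  keval (bianchi_term a b c f) K =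
  \sum_g (sc a g f)%:~R * K b c g - \sum_e (sc a b e)%:~R * K e c f.
Proof.
rewrite /keval /bianchi_term.
under eq_bigr => u _ do under eq_bigr => v _ do under eq_bigr => w _ do
  rewrite rmorphB mulrBl /=.
under eq_bigr => u _ do under eq_bigr => v _ do rewrite sumrB.
under eq_bigr => u _ do rewrite sumrB.
rewrite sumrB; congr (_ - _).
  rewrite -(sum_delta b (fun b => \sum_g (sc a g f)%:~R * K b c g)).
  apply: eq_bigr => u _.
  rewrite -(sum_delta c (fun c => \sum_g (sc a g f)%:~R * K u c g)) mulr_sumr.
  apply: eq_bigr => v _; rewrite !mulr_sumr; apply: eq_bigr => w _.
  rewrite !keqE [u == b]eq_sym [v == c]eq_sym.
  by case: (b == u); case: (c == v); rewrite /= ?mul1r ?mul0r.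
apply: eq_bigr => u _; rewrite -[RHS](sum_delta c (fun c => (sc a b u)%:~R * K u c f)).
apply: eq_bigr => v _; rewrite -(sum_delta f (fun f => (sc a b u)%:~R * K u v f)) mulr_sumr.
apply: eq_bigr => w _; rewrite !keqE [w == f]eq_sym [v == c]eq_sym.
by case: (f == w); case: (c == v); rewrite /= ?mul1r ?mul0r.
Qed.

Lemma kevalD l m (K : kidx -> kidx -> kidx -> A) :
  keval (fun a b c => l a b c + m a b c) K = keval l K + keval m K.
Proof.
rewrite /keval -big_split; apply: eq_bigr => a _; rewrite -big_split.
apply: eq_bigr => b _; rewrite -big_split; apply: eq_bigr => c _ /=.
by rewrite rmorphD mulrDl.
Qed.

(** [a] has negative degree, so the component differentiated along [X a] has homogeneity below [h]
    and vanishes; [ps] and [Cc] then contribute only their leading parts. *)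
Lemma lowest_bianchi h a b c f : 0 < h ->
  (forall a b f, kdeg f - kdeg a - kdeg b < h -> KK a b f = 0) ->
  isneg a -> isneg b -> isneg c -> kdeg f - kdeg a - kdeg b - kdeg c = h ->
  keval (bianchi_form a b c f) KK = 0.
Proof.
move=> h0 Kh na nb nc df.
rewrite (kevalD (fun u v w => bianchi_term a b c f u v w + bianchi_term b c a f u v w)).
rewrite (kevalD (bianchi_term a b c f)) !keval_bianchi_term.
have E u v w : isneg u -> isneg v -> isneg w -> kdeg f - kdeg u - kdeg v - kdeg w = h ->
   der d (X u) (KK v w f) - \sum_e Cc u v e * KK e w f + brk (ps u) (KK v w) f =
   \sum_g (sc u g f)%:~R * KK v w g - \sum_e (sc u v e)%:~R * KK e w f.
  move=> nu nv nw df'; rewrite Kh; last by move: nu; rewrite isnegE; lia.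
  rewrite der0 add0r brk_ps_lead // => [|g dg]; last by apply: Kh; lia.
  rewrite addrC; congr (_ - _); apply: eq_bigr => e _.
  have [ne|ne] := boolP (isneg e); last by rewrite KK_out // !mulr0.
  have [le|lt] := leP (kdeg e) (kdeg u + kdeg v); first by rewrite Cc_lead.
  by rewrite Kh ?mulr0 //; lia.
rewrite -!E //; [exact: bianchi_frame|lia|lia].
Qed.

Lemma eq_keval l m (K : kidx -> kidx -> kidx -> A) :
  (forall a b c, l a b c = m a b c) -> keval l K = keval m K.
Proof.
move=> E; apply: eq_bigr => a _; apply: eq_bigr => b _; apply: eq_bigr => c _.
by rewrite E.
Qed.

Lemma keval0 (K : kidx -> kidx -> kidx -> A) : keval (fun _ _ _ => 0) K = 0.
Proof.
by rewrite /keval big1 // => a _; rewrite big1 // => b _; rewrite big1 // => c _; rewrite mul0r.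
Qed.

Lemma kevalZ z l (K : kidx -> kidx -> kidx -> A) :
  keval (fun a b c => z * l a b c) K = z%:~R * keval l K.
Proof.
rewrite /keval mulr_sumr; apply: eq_bigr => a _; rewrite mulr_sumr.
apply: eq_bigr => b _; rewrite mulr_sumr; apply: eq_bigr => c _.
by rewrite rmorphM /= mulrA.
Qed.

Lemma kevalN l (K : kidx -> kidx -> kidx -> A) :
  keval (fun a b c => - l a b c) K = - keval l K.
Proof.
rewrite -[RHS]mulN1r -[-1 : A]/((-1 : int)%:~R) -kevalZ.
by apply: eq_keval => a b c; rewrite mulN1r.
Qed.

Lemma keval_sum (r : seq kidx) (F : kidx -> cform) (K : kidx -> kidx -> kidx -> A) :
  keval (fun u v w => foldr (fun e s => F e u v w + s) 0 r) K =
  \sum_(e <- r) keval (F e) K.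
Proof.
by elim: r => [|e r IH]; rewrite ?big_nil ?keval0 // big_cons -IH -kevalD.
Qed.

Lemma keval_pair a b g (K : kidx -> kidx -> kidx -> A) :
  keval (fun u v w => if keq u a && keq v b then g w else 0) K =
  \sum_w (g w)%:~R * K a b w.
Proof.
rewrite /keval -[RHS](sum_delta a (fun a => \sum_w (g w)%:~R * K a b w)).
apply: eq_bigr => u _.
rewrite -(sum_delta b (fun b => \sum_w (g w)%:~R * K u b w)) mulr_sumr.
apply: eq_bigr => v _; rewrite !mulr_sumr; apply: eq_bigr => w _.
rewrite !keqE [u == a]eq_sym [v == b]eq_sym.
by case: (a == u); case: (b == v); rewrite /= ?mul1r ?mul0r.
Qed.

Lemma keval_unit a b c (K : kidx -> kidx -> kidx -> A) : keval (unit_form a b c) K = K a b c.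
Proof.
transitivity (\sum_w ((if keq w c then 1 else 0) : int)%:~R * K a b w).
  rewrite -keval_pair; apply: eq_keval => u v w; rewrite /unit_form andbA.
  by case: (keq u a && keq v b).
rewrite -(sum_delta c (fun w => K a b w)); apply: eq_bigr => w _; rewrite keqE eq_sym.
by case: eqP.
Qed.

(** * The torsion and the exterior derivative of rho_0 *)

Definition Tor a b c : A := keval (torsion_form a b c) KK.

Lemma TorE a b c : Tor a b c = \sum_w (sympz w c)%:~R * KK a b w
  + \sum_w (sympz w a)%:~R * KK b c w + \sum_w (sympz w b)%:~R * KK c a w.
Proof.
rewrite /Tor /torsion_form.
rewrite (kevalD (fun u v w => (if keq u a && keq v b then sympz w c else 0)
  + (if keq u b && keq v c then sympz w a else 0))).
rewrite (kevalD (fun u v w => (if keq u a && keq v b then sympz w c else 0))).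
by rewrite !(keval_pair _ _ (fun w => sympz w _)).
Qed.

Lemma Tor_cyc a b c : Tor a b c = Tor b c a.
Proof. by rewrite !TorE -addrA addrC. Qed.

Lemma TorN a b c : Tor a b c = - Tor b a c.
Proof.
have E u v w : \sum_z (sympz z u)%:~R * KK v w z = - \sum_z (sympz z u)%:~R * KK w v z.
  by rewrite -sumrN; apply: eq_bigr => z _; rewrite KKN mulrN.
by rewrite !TorE (E c a b) (E a b c) (E b c a); ring.
Qed.

Lemma Tor_b3 : Tor om3 th3 th0 = - keval b3_form KK.
Proof.
have -> : keval b3_form KK = KK om3 th0 om1 - KK th0 th3 th1.
  by rewrite (kevalD (unit_form om3 th0 om1)) kevalN !keval_unit.
rewrite TorE !sum_kidxs !big_cons !big_nil /sympz /keq /=.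
rewrite !(mul0r, mul1r, mulN1r, addr0, add0r) [KK th3 th0 th1]KKN [KK th0 om3 om1]KKN; ring.
Qed.

(* the form rho_0 *)
Definition rh i j : A := symp (P i) (P j).
Definition Rz a b : A := (sympz a b)%:~R.

Lemma sympzE c : (sympz om1 c = (c == th3)) * (sympz om2 c = (c == th2))
  * (sympz om3 c = (c == th1)) * (sympz th3 c = - (c == om1)%:Z)
  * (sympz th2 c = - (c == om2)%:Z) * (sympz th1 c = - (c == om3)%:Z).
Proof. by move: c; apply: kidx_ind. Qed.

Lemma sympz_out e c : ~~ isneg e -> sympz e c = 0.
Proof.
have : all (fun e => all (fun c => isneg e || (sympz e c == 0)) kidxs) kidxs by vm_compute.
move=> /allP/(_ e (mem_kidxs e))/allP/(_ c (mem_kidxs c)) H ne.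
by move: H; rewrite (negbTE ne) => /eqP.
Qed.

Lemma symp_ps y c : symp y (ps c) = \sum_w Rz w c * y w.
Proof.
have Ro w : w \notin [:: om1; om2; om3; th1; th2; th3] -> Rz w c * y w = 0.
  move=> wn; suff -> : Rz w c = 0 by rewrite mul0r.
  rewrite /Rz; apply/eqP; rewrite -(rmorph0 (intmul 1)) //; apply/eqP; congr _%:~R.
  by move: w c wn; apply: kidx_ind => //; apply: kidx_ind.
have P1 b : isneg b -> ps c b = (c == b)%:R.
  by move=> nb; rewrite ps_neg //; case: eqP => [->|_]; rewrite ?nb ?andbF.
rewrite /symp sum_kidxs !big_cons big_nil ![Rz _ c * _ + 0]addr0.
rewrite (Ro th0) // (Ro ph0) // (Ro ph1) // (Ro ph2) // (Ro xi0) // (Ro om0) // (Ro ga0) //.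
rewrite /Rz !sympzE !P1 // !rmorphN /= -!pmulrn.
move: (_ == _)%:R (_ == _)%:R (_ == _)%:R (_ == _)%:R (_ == _)%:R (_ == _)%:R => *; ring.
Qed.

Lemma symp_psps b c : symp (ps b) (ps c) = Rz b c.
Proof.
rewrite symp_ps -[RHS](sum_delta b (fun w => Rz w c)); apply: eq_bigr => w _.
have [nw|nw] := boolP (isneg w); last by rewrite /Rz sympz_out // mul0r mulr0.
rewrite ps_neg // mulrC; have [nb|nb] := boolP (isneg b) => //=.
by case: eqP nb => // ->; rewrite nw.
Qed.

Lemma ct2_rh Y Z : ct2 rh Y Z = symp (fun g => ct1 (fun i => P i g) Y) (fun g => ct1 (fun i => P i g) Z).
Proof.
have L (x : kidx -> A) : ct1 (fun j => symp x (P j)) Z = symp x (fun g => ct1 (fun i => P i g) Z).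
  rewrite /ct1 /symp !mulr_sumr -!sumrB -!big_split; apply: eq_bigr => i _ /=; ring.
rewrite /ct2 /rh; under eq_ct1 do rewrite L.
rewrite /ct1 /symp !mulr_suml -!sumrB -!big_split; apply: eq_bigr => i _ /=; ring.
Qed.

Lemma rhN i j : rh i j = - rh j i.
Proof. by rewrite /rh /symp; ring. Qed.

Definition Nh i j k : A := d i (rh j k) + d j (rh k i) + d k (rh i j).

Definition phR a b c : A := ps a ph1 * Rz b c + ps b ph1 * Rz c a + ps c ph1 * Rz a b.

Definition GG a b c : A := \sum_e Cc a b e * Rz e c.

Lemma Nh_GG a b c : ct3 Nh (X a) (X b) (X c) = - (GG a b c + GG b c a + GG c a b).
Proof.
rewrite (cartan2 dM rhN) !ct2_rh !(symp_psps, der_int dM).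
have E u v w : symp (fun g => ct1 (fun i => P i g) (lie d (X u) (X v))) (ps w) = GG u v w.
  by rewrite symp_ps; apply: eq_bigr => e _; rewrite mulrC.
rewrite !E; ring.
Qed.

Lemma Rz_th0 b : Rz th0 b = 0.
Proof. by rewrite /Rz (_ : sympz th0 b = 0) //; move: b; apply: kidx_ind. Qed.

Lemma GGE a b c : GG a b c = symp (brk (ps a) (ps b)) (ps c) - \sum_w (sympz w c)%:~R * KK a b w.
Proof.
rewrite symp_ps -sumrB; apply: eq_bigr => e _; rewrite -mulrBr mulrC.
have [ne|ne] := boolP (isneg e); first by rewrite Cc_neg.
by rewrite /Rz sympz_out // !mul0r.
Qed.

(** rho_0 is constant on the frame, so only brackets contribute. By [symp_cyc] their connection part
    is phi_1 /\ rho_0, and their curvature part is the torsion. *)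
Lemma Nh_frame a b c : ct3 Nh (X a) (X b) (X c) = phR a b c + Tor a b c.
Proof.
rewrite Nh_GG !GGE TorE /phR -!symp_psps -[X in X + _ + _](opprK) .
have := symp_cyc (ps a) (ps b) (ps c).
move: (symp (brk _ _) _) (symp (brk _ _) _) (symp (brk _ _) _) => x y z.
move=> /eqP; rewrite eq_sym eqr_oppLR => /eqP E.
rewrite opprK E; ring.
Qed.

Lemma Nh_cyc i j k : Nh i j k = Nh j k i.
Proof. by rewrite /Nh -addrA addrC. Qed.

Lemma NhN i j k : Nh i j k = - Nh j i k.
Proof.
rewrite /Nh; move: rh rhN => r rN.
rewrite [r i k]rN [r k j]rN [r j i]rN !raddfN /=; ring.
Qed.

Lemma Nh_closed i j k l :
  d i (Nh j k l) - d j (Nh i k l) + d k (Nh i j l) - d l (Nh i j k) = 0.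
Proof.
rewrite /Nh; move: rh rhN => r rN.
rewrite !raddfD /= [r l i]rN [r l j]rN [r k i]rN !raddfN /=.
rewrite (dC j i) (dC k i) (dC k j) (dC l i) (dC l j) (dC l k); ring.
Qed.

Lemma KK_ph1 a b : KK a b ph1 =
  der d (X a) (ps b ph1) - der d (X b) (ps a ph1) - \sum_e Cc a b e * ps e ph1.
Proof.
rewrite KK_struct [brk _ _ _]/= addr0; congr (_ - _); rewrite -ct1_lie.
by [].
Qed.

Definition wedgeK a b c e : A :=
  KK a b ph1 * Rz c e - KK a c ph1 * Rz b e + KK a e ph1 * Rz b c
  + KK b c ph1 * Rz a e - KK b e ph1 * Rz a c + KK c e ph1 * Rz a b.

Lemma RzN a b : Rz a b = - Rz b a.
Proof. by rewrite -!symp_psps /symp; ring. Qed.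

(* The part of d T - phi_1 /\ T + K^{phi_1} /\ rho_0 = 0 in the lowest
   homogeneity in which T does not vanish. *)
Lemma trick_frame a b c e :
  (forall u v w, kdeg a + kdeg b + kdeg c + kdeg e < kdeg u + kdeg v + kdeg w ->
     Tor u v w = 0) ->
  isneg a -> isneg b -> isneg c -> isneg e ->
  (let D u v x y := \sum_g (sc u v g)%:~R * Tor g x y in
   - D a b c e + D a c b e - D a e b c - D b c a e + D b e a c - D c e a b)
  + wedgeK a b c e = 0.
Proof.
move=> T0 na nb nc ne.
have H := cartan3 dM Nh_cyc NhN Nh_closed (X a) (X b) (X c) (X e).
(* Omitting an index of negative degree raises the sum of the degrees, so the torsion vanishes on
   each of the four triples. *)
have T3 u v w x : isneg x -> kdeg a + kdeg b + kdeg c + kdeg e = kdeg x + kdeg u + kdeg v + kdeg w ->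
  Tor u v w = 0.
  by rewrite isnegE => nx dx; apply: T0; lia.
(* d rho_0 with a bracket as one argument: the torsion survives only in degrees where the structure
   functions are the constants [sc]. *)
have L u v x y : isneg u -> isneg v -> isneg x -> isneg y ->
   kdeg a + kdeg b + kdeg c + kdeg e = kdeg u + kdeg v + kdeg x + kdeg y ->
   ct3 Nh (lie d (X u) (X v)) (X x) (X y) =
   (\sum_g Cc u v g * ps g ph1) * Rz x y + ps x ph1 * (- GG u v y) + ps y ph1 * GG u v x
   + \sum_g (sc u v g)%:~R * Tor g x y.
  move=> nu nv nx ny E; rewrite /ct3 ct1_lie.
  rewrite mulr_suml mulrN !mulr_sumr -sumrN -!big_split; apply: eq_bigr => g _ /=.
  have [ng|ng] := boolP (isneg g); last first.
    rewrite ct1_X_out // {1}/ps ct1_X_out // /Rz !(sympz_out _ ng).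
    suff -> : sc u v g = 0 by ring.
    apply/eqP/negPn/negP => /sc_deg dg.
    by move: nu nv ng; rewrite !isnegE -dg; lia.
  rewrite -/(ct3 Nh (X g) (X x) (X y)) Nh_frame /phR [Rz y g]RzN mulrDr.
  have [le|lt] := leP (kdeg g) (kdeg u + kdeg v).
    by rewrite (Cc_lead nu nv ng le); ring.
  by rewrite (T0 g x y); [ring|lia].
have GN u v w : GG u v w = - GG v u w.
  rewrite /GG -sumrN; apply: eq_bigr => g _; rewrite -mulNr; congr (_ * _).
  by rewrite /Cc /ct1 -sumrN; apply: eq_bigr => i _; rewrite /lie; ring.
have G u v w : Tor u v w = 0 -> GG u w v = GG u v w + GG v w u + phR u v w.
  move=> t0; have := Nh_GG u v w; rewrite Nh_frame t0 addr0 => ->.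
  by rewrite (GN w u); ring.
have Tabc : Tor a b c = 0 by apply: (T3 _ _ _ e); [|lia].
have Tabe : Tor a b e = 0 by apply: (T3 _ _ _ c); [|lia].
have Tace : Tor a c e = 0 by apply: (T3 _ _ _ b); [|lia].
have Tbce : Tor b c e = 0 by apply: (T3 _ _ _ a); [|lia].
move: H; rewrite !L //; [|lia|lia|lia|lia|lia].
rewrite !Nh_frame Tabc Tabe Tace Tbce !addr0 /= /wedgeK !KK_ph1.
rewrite (G a b c) // (G a b e) // (G a c e) // (G b c e) //.
have der_phR x u v w : der d (X x) (phR u v w) = der d (X x) (ps u ph1) * Rz v w
    + der d (X x) (ps v ph1) * Rz w u + der d (X x) (ps w ph1) * Rz u v.
  by rewrite /phR !derD !(derM dM) !(der_int dM); ring.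
rewrite !der_phR /phR ?(RzN c a) ?(RzN e a) ?(RzN e b) ?(RzN e c) ?(RzN c b) ?(RzN b a).
move=> H; rewrite -[RHS]H.
move: (\sum_g _) (\sum_g _) (\sum_g _) (\sum_g _) (\sum_g _) (\sum_g _) => x1 x2 x3 x4 x5 x6.
ring.
Qed.

Lemma keval_dtorsion a b c e : keval (dtorsion_form a b c e) KK =
  let D u v x y := \sum_g (sc u v g)%:~R * Tor g x y in
   - D a b c e + D a c b e - D a e b c - D b c a e + D b e a c - D c e a b.
Proof.
pose D u v x y : A := \sum_g (sc u v g)%:~R * Tor g x y.
rewrite -[RHS]/(- D a b c e + D a c b e - D a e b c - D b c a e + D b e a c - D c e a b).
pose Df x y u v : cform := fun p q w => sumz (fun g => let s := sc x y g in
  if s == 0 then 0 else s * torsion_form g u v p q w).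
have DE x y u v : keval (Df x y u v) KK = D x y u v.
  rewrite /Df /sumz keval_sum /D sum_kidxs; apply: eq_bigr => g _ /=.
  rewrite -kevalZ; apply: eq_keval => p q w.
  by case: eqP => // ->; rewrite mul0r.
rewrite -!DE -!(kevalN, kevalD).
by apply: eq_keval => p q w.
Qed.

Lemma keval_wedge a b c e : keval (wedge_form a b c e) KK = wedgeK a b c e.
Proof.
pose W x y u v : cform := fun p q w =>
  if keq p x && keq q y then (if keq w ph1 then sympz u v else 0) else 0.
have WE x y u v : keval (W x y u v) KK = KK x y ph1 * Rz u v.
  rewrite (keval_pair x y (fun w => if keq w ph1 then sympz u v else 0)).
  rewrite -(sum_delta ph1 (fun w => KK x y w * Rz u v)); apply: eq_bigr => w _.
  by rewrite keqE eq_sym; case: eqP => _; rewrite ?mul0r // mul1r mulrC.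
rewrite /wedgeK -!WE -!(kevalN, kevalD); apply: eq_keval => p q w.
rewrite /wedge_form /W; case: (keq w ph1) => //.
by rewrite !if_same !oppr0 !addr0.
Qed.

Lemma keval_trick a b c e :
  keval (trick_form a b c e) KK = keval (dtorsion_form a b c e) KK + wedgeK a b c e.
Proof. by rewrite -keval_wedge -kevalD. Qed.

(* satisfied by rings of functions, where it can be checked pointwise *)
Hypothesis lin : forall h rows ts (K : kidx -> kidx -> kidx -> A),
  (forall a b c, K a b c = - K b a c) ->
  (forall a b c, ~~ isneg a -> K a b c = 0) ->
  consequence h rows ts ->
  (forall l, List.In l rows -> keval l K = 0) ->
  forall t, List.In t ts -> keval t K = 0.
Hypothesis tf2 : forall x : A, x = - x -> x = 0.
Hypothesis tf3 : forall x : A, x + x + x = 0 -> x = 0.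
Hypothesis normal : forall r s, keval (normal_form r s) KK = 0.

Definition KK_below (h : int) := forall a b f, kdeg f - kdeg a - kdeg b < h -> KK a b f = 0.

Lemma lin_KK h rows ts : consequence h rows ts ->
  (forall l, List.In l rows -> keval l KK = 0) ->
  forall t, List.In t ts -> keval t KK = 0.
Proof. exact: lin KKN KK_out. Qed.

Lemma In_cat (T : Type) (x : T) s t : List.In x (s ++ t) -> List.In x s \/ List.In x t.
Proof. by elim: s => [|y s IH] /=; [right|case=> [->|/IH]; tauto]. Qed.

Lemma In_cons (T : Type) (x y : T) s : List.In x (y :: s) -> y = x \/ List.In x s.
Proof. by []. Qed.

Lemma In_map (S T : Type) (f : S -> T) (s : seq S) x :
  List.In x (map f s) -> exists2 y, List.In y s & x = f y.
Proof.
elim: s => //= y s IH [<-|/IH[z zs ->]]; first by exists y; [left|].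
by exists z; [right|].
Qed.

Lemma In_mem (T : eqType) (x : T) s : List.In x s -> x \in s.
Proof. by elim: s => //= y s IH [->|/IH]; rewrite inE ?eqxx // => ->; rewrite orbT. Qed.

Lemma mem_In_map (S : eqType) (T : Type) (f : S -> T) (s : seq S) y :
  y \in s -> List.In (f y) (map f s).
Proof. by elim: s => //= z s IH; rewrite inE => /orP[/eqP <-|/IH]; [left|right]. Qed.

Lemma negsE a : (a \in negs) = isneg a.
Proof. by move: a; apply: kidx_ind. Qed.

Lemma neg3P t : t \in neg3 -> [/\ isneg t.1.1, isneg t.1.2 & isneg t.2].
Proof.
have /allP H : all (fun t => [&& isneg t.1.1, isneg t.1.2 & isneg t.2]) neg3 by vm_compute.
by move=> /H /and3P.
Qed.

Lemma mem_neg3 a b c : isneg a -> isneg b -> isneg c -> (a < b < c)%N -> (a, b, c) \in neg3.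
Proof.
by move=> na nb nc abc; rewrite mem_filter abc; do 2?apply: allpairs_f; rewrite negsE.
Qed.

Lemma rows_vanish h : 0 < h -> KK_below h -> forall l, List.In l (rows h) -> keval l KK = 0.
Proof.
move=> h0 Kh l; rewrite /rows => lr; case: (In_cat lr) => lr'; have [v vs E] := In_map lr'.
  by rewrite E normal.
have := In_mem vs; rewrite mem_filter => /andP[/eqP dv].
case/allpairsP=> -[t g] /= [/neg3P[n1 n2 n3] _ vE].
by rewrite E {}vE /= in dv *; apply: (lowest_bianchi h0 Kh).
Qed.

Lemma mem_ktriples (a b : kidx) c : (a < b)%N -> isneg b ->
  (a, b, c) \in ktriples (kdeg c - kdeg a - kdeg b).
Proof.
move=> ab nb; rewrite mem_filter ab nb eqxx /=.
exact: (allpairs_f pair (allpairs_f pair (mem_kidxs a) (mem_kidxs b)) (mem_kidxs c)).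
Qed.

Lemma units_below h : KK_below h -> (forall t, List.In t (units h) -> keval t KK = 0) ->
  KK_below (h + 1).
Proof.
move=> Kh Ht a b f df; have [lt|ge] := ltP (kdeg f - kdeg a - kdeg b) h; first exact: Kh.
have {ge df}dh : kdeg f - kdeg a - kdeg b = h by lia.
have [na|na] := boolP (isneg a); last exact: KK_out.
have [nb|nb] := boolP (isneg b); last by rewrite KKN KK_out ?oppr0.
have M (u v : kidx) : (u < v)%N -> isneg v -> kdeg f - kdeg u - kdeg v = h -> KK u v f = 0.
  move=> uv nv dh'; rewrite -keval_unit; apply: Ht.
  apply: (mem_In_map (fun v => unit_form v.1.1 v.1.2 v.2) (y := (u, v, f))).
  by rewrite -dh'; exact: mem_ktriples.
case: (ltngtP a b) => [ab|ba|/val_inj E]; first exact: M.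
  by rewrite KKN (M b a ba na) ?oppr0 // -dh addrAC.
by apply: tf2; rewrite E {1}KKN.
Qed.

Lemma KK_below1 : KK_below 1.
Proof. by move=> a b f df; apply: regular; lia. Qed.

Lemma KK_below2 : KK_below 2.
Proof.
by apply: (units_below KK_below1); apply: (lin_KK consequence_1); apply: (rows_vanish _ KK_below1).
Qed.

Lemma sympz_deg w c : sympz w c != 0 -> kdeg w + kdeg c = -4.
Proof.
have : all (fun w => all (fun c => (sympz w c == 0) || (kdeg w + kdeg c == -4)) kidxs) kidxs.
  by vm_compute.
by move=> /allP/(_ w (mem_kidxs w))/allP/(_ c (mem_kidxs c))/orP[->|/eqP].
Qed.

Lemma Tor_below h a b c : KK_below h -> - kdeg a - kdeg b - kdeg c - 4 < h -> Tor a b c = 0.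
Proof.
move=> Kh lt; have Z u v w : - kdeg u - kdeg v - kdeg w - 4 < h ->
    \sum_z (sympz z w)%:~R * KK u v z = 0.
  move=> lt'; rewrite big1 // => z _.
  have [->|/sympz_deg dz] := eqVneq (sympz z w) 0; first by rewrite mul0r.
  by rewrite Kh ?mulr0 //; lia.
by rewrite TorE !Z ?addr0 //; lia.
Qed.

Lemma Tor_out a b c : ~~ isneg a -> Tor a b c = 0.
Proof.
move=> na; rewrite TorE big1 => [|w _]; last by rewrite KK_out // mulr0.
rewrite big1 => [|w _]; last by rewrite -/(Rz w a) RzN /Rz sympz_out // oppr0 mul0r.
by rewrite big1 ?addr0 // => w _; rewrite KKN KK_out // oppr0 mulr0.
Qed.

Lemma Tor_sorted (s : int) :
  (forall a b c, (a, b, c) \in neg3 -> kdeg a + kdeg b + kdeg c = s -> Tor a b c = 0) ->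
  forall a b c, kdeg a + kdeg b + kdeg c = s -> Tor a b c = 0.
Proof.
move=> H.
have M (a b c : kidx) : (a < b)%N -> (b < c)%N -> kdeg a + kdeg b + kdeg c = s -> Tor a b c = 0.
  move=> ab bc ds; have [nc|nc] := boolP (isneg c); last by rewrite -Tor_cyc Tor_out.
  have nb : isneg b by exact: ltn_trans bc nc.
  by apply: H => //; apply: mem_neg3; rewrite ?ab //; exact: ltn_trans ab nb.
have M2 (a b c : kidx) : (a < b)%N -> kdeg a + kdeg b + kdeg c = s -> Tor a b c = 0.
  move=> ab ds; case: (ltngtP b c) => [bc|cb|/val_inj E]; first exact: M.
    rewrite -Tor_cyc; case: (ltngtP a c) => [ac|ca|/val_inj E].
    - by rewrite TorN (M a c b) ?oppr0 //; lia.
    - by apply: M => //; lia.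
    - by apply: tf2; rewrite E {1}TorN.
  by apply: tf2; rewrite -E Tor_cyc {1}TorN.
move=> a b c ds; case: (ltngtP a b) => [ab|ba|/val_inj E]; first exact: M2.
  by rewrite TorN M2 ?oppr0 //; lia.
by apply: tf2; rewrite E {1}TorN.
Qed.

Lemma torsions_zero h : (forall t, List.In t (torsions h) -> keval t KK = 0) ->
  forall a b c, kdeg a + kdeg b + kdeg c = - h - 4 -> Tor a b c = 0.
Proof.
move=> H; apply: Tor_sorted => a b c abc ds; apply: H.
apply: (mem_In_map (fun v => torsion_form v.1.1 v.1.2 v.2) (y := (a, b, c))).
by rewrite mem_filter abc ds eqxx.
Qed.

Lemma neg3_deg a b c : (a, b, c) \in neg3 -> - 8 <= kdeg a + kdeg b + kdeg c.
Proof.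
have /allP H : all (fun t => - 8 <= kdeg t.1.1 + kdeg t.1.2 + kdeg t.2) neg3 by vm_compute.
exact: H.
Qed.

Lemma neg4P t : t \in neg4 ->
  [/\ isneg t.1.1.1, isneg t.1.1.2, isneg t.1.2 & isneg t.2].
Proof.
have /allP H : all (fun t => [&& isneg t.1.1.1, isneg t.1.1.2, isneg t.1.2 & isneg t.2]) neg4.
  by vm_compute.
by move=> /H /and4P.
Qed.

Lemma quadsP h (F : kidx -> kidx -> kidx -> kidx -> cform) :
  (forall a b c e, isneg a -> isneg b -> isneg c -> isneg e ->
     kdeg a + kdeg b + kdeg c + kdeg e = - h - 4 -> keval (F a b c e) KK = 0) ->
  forall l, List.In l [seq F v.1.1.1 v.1.1.2 v.1.2 v.2 | v <- quads h] -> keval l KK = 0.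
Proof.
move=> H l lr; have [v vs E] := In_map lr; rewrite E; apply: H;
  by have := In_mem vs; rewrite mem_filter => /andP[/eqP ? /neg4P[]].
Qed.

Lemma frame_ext w : (forall a, isneg a -> ct1 w (X a) = 0) -> forall i, w i = 0.
Proof.
move=> H i; rewrite -(sum_delta i w); under eq_bigr do rewrite -PX mulr_suml.
rewrite exchange_big /= big1 // => b _.
under eq_bigr do rewrite -mulrA; rewrite -mulr_sumr -/(ct1 w (X b)).
have [nb|nb] := boolP (isneg b); first by rewrite H // mulr0.
by rewrite ct1_X_out // mulr0.
Qed.

Lemma rh_th0 j : ct1 (fun i => rh i j) (X th0) = 0.
Proof.
apply: (frame_ext (w := fun j => ct1 (fun i => rh i j) (X th0))) => b _.
rewrite -(ct1C rh); rewrite -[LHS]/(ct2 rh (X th0) (X b)) ct2_rh symp_psps.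
exact: Rz_th0.
Qed.

(** * Vanishing invariants make d rho_0 = phi_1 /\ rho_0 with phi_1 closed *)

Section Vanishing.
Hypothesis b12_0 : forall t, List.In t b12_forms -> keval t KK = 0.
Hypothesis b3_0 : keval b3_form KK = 0.

Lemma KK_below3 : KK_below 3.
Proof.
apply: (units_below KK_below2); apply: (lin_KK consequence_2) => l lr.
case: (In_cat lr); [exact: (rows_vanish _ KK_below2)|exact: b12_0].
Qed.

Lemma Tor3 a b c : - 8 < kdeg a + kdeg b + kdeg c -> Tor a b c = 0.
Proof.
move=> lt; have [ds|ds] := eqVneq (kdeg a + kdeg b + kdeg c) (- 3 - 4); last first.
  by apply: (Tor_below KK_below3); lia.
apply: torsions_zero ds; apply: (lin_KK consequence_3) => l lr.
case: (In_cons lr) => [<-|lr']; [exact: b3_0|exact: (rows_vanish _ KK_below3 lr')].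
Qed.

(** By [neg3_deg] only homogeneity 4 is left after [Tor3], and there the vanishing below makes
    [trick_frame] applicable. *)
Lemma Tor_zero a b c : Tor a b c = 0.
Proof.
apply: (Tor_sorted (s := kdeg a + kdeg b + kdeg c)) => // {}a {}b {}c abc _.
have [lt|ge] := ltP (- 8) (kdeg a + kdeg b + kdeg c); first exact: Tor3.
have ds : kdeg a + kdeg b + kdeg c = - 4 - 4 by have := neg3_deg abc; lia.
apply: torsions_zero ds; apply: (lin_KK consequence_4).
apply: quadsP => a' b' c' e na nb nc ne ds'.
rewrite keval_trick keval_dtorsion; apply: trick_frame => // u v w lt.
by apply: Tor3; lia.
Qed.

(** With T = 0, [trick_frame] reads K^{phi_1} /\ rho_0 = 0 in every degree. *)
Lemma wedges_zero h l : List.In l (wedges h) -> keval l KK = 0.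
Proof.
move: l; apply: (quadsP (F := wedge_form)) => u v x y nu nv nx ny _; rewrite keval_wedge.
have := trick_frame (a := u) (b := v) (c := x) (e := y) (fun _ _ _ _ => Tor_zero _ _ _) nu nv nx ny.
move=> /= H; rewrite -[RHS]H; do 6?rewrite [\sum_g _]big1 => [|g _]; rewrite ?Tor_zero ?mulr0 //.
by ring.
Qed.

Lemma ph1_units_zero (h : int) t : h \in [:: 2; 3; 4; 5; 6] ->
  List.In t (ph1_units h) -> keval t KK = 0.
Proof.
move=> hh; have /allP/(_ h hh) C := consequence_ph1.
exact: (lin_KK C (@wedges_zero h)).
Qed.

Lemma mem_ph1_units (u v : kidx) : (u < v)%N -> isneg v ->
  List.In (unit_form u v ph1) (ph1_units (kdeg ph1 - kdeg u - kdeg v)).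
Proof.
move=> uv nv.
apply: (mem_In_map (fun v => unit_form v.1.1 v.1.2 ph1) (y := (u, v, ph1))).
by rewrite mem_filter (mem_ktriples ph1 uv nv) andbT.
Qed.

Lemma neg2_deg u v : isneg u -> isneg v ->
  kdeg ph1 - kdeg u - kdeg v \in [:: 2; 3; 4; 5; 6 : int].
Proof. by move: u v; apply: kidx_ind => //; apply: kidx_ind. Qed.

Lemma KK_ph1_zero a b : KK a b ph1 = 0.
Proof.
have [na|na] := boolP (isneg a); last exact: KK_out.
have [nb|nb] := boolP (isneg b); last by rewrite KKN KK_out ?oppr0.
have M (u v : kidx) : (u < v)%N -> isneg u -> isneg v -> KK u v ph1 = 0.
  move=> uv nu nv; rewrite -keval_unit.
  exact: (ph1_units_zero (neg2_deg nu nv) (mem_ph1_units uv nv)).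
case: (ltngtP a b) => [ab|ba|/val_inj E]; first exact: M.
  by rewrite KKN M ?oppr0.
by apply: tf2; rewrite E {1}KKN.
Qed.

(** Brackets in k have no [ph1] component, so K^{phi_1} is the exterior derivative of phi_1. *)
Lemma ph1_closed i j : d i (P j ph1) = d j (P i ph1).
Proof.
apply/eqP; rewrite -subr_eq0; apply/eqP.
transitivity (Om i j ph1); first by rewrite /Om [brk _ _ _]/= addr0.
apply: (frame_ext (w := fun i => Om i j ph1)) => a na.
apply: (frame_ext (w := fun j => ct1 (fun i => Om i j ph1) (X a))) => b nb.
by rewrite -(ct1C (fun i j => Om i j ph1)); exact: KK_ph1_zero.
Qed.

Lemma Nh_wedge i j k :
  Nh i j k = P i ph1 * rh j k + P j ph1 * rh k i + P k ph1 * rh i j.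
Proof.
apply/eqP; rewrite -subr_eq0; apply/eqP.
pose Q i j k := P i ph1 * rh j k + P j ph1 * rh k i + P k ph1 * rh i j.
pose E i j k := Nh i j k - Q i j k; rewrite -[LHS]/(E i j k).
apply: (frame_ext (w := fun k => E i j k)) => c nc.
apply: (frame_ext (w := fun j => ct1 (E i j) (X c))) => b nb.
apply: (frame_ext (w := fun i => ct2 (E i) (X b) (X c))) => a na.
rewrite -[LHS]/(ct3 E (X a) (X b) (X c)).
have -> : ct3 E (X a) (X b) (X c) = ct3 Nh (X a) (X b) (X c) - ct3 Q (X a) (X b) (X c).
  rewrite /ct3 /ct2 -ct1B; apply: eq_ct1 => x; rewrite -ct1B; apply: eq_ct1 => y.
  by rewrite -ct1B.
rewrite Nh_frame Tor_zero addr0 (ct3_wedge (fun i => P i ph1)) !ct2_rh !symp_psps.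
by rewrite subrr.
Qed.

End Vanishing.

(** * Closed forms satisfying the Helmholtz conditions are multiples of rho_0 *)

Section ClosedForm.
Variable rho : 'I_7 -> 'I_7 -> A.
Hypothesis rhoN : forall i j, rho i j = - rho j i.
Hypothesis rho_closed : forall i j k, d i (rho j k) + d j (rho k i) + d k (rho i j) = 0.
Let r a b := ct2 rho (X a) (X b).
Hypothesis r_th0 : forall b, r th0 b = 0.
Hypothesis r_V : r om1 th1 = 0.
Hypothesis r_lie : forall u v, u \in [:: om1; th1] -> v \in [:: om1; th1] ->
  ct2 rho (lie d (X th0) (X u)) (X v) = 0.

Let rN a b : r a b = - r b a. Proof. exact: ct2N. Qed.
Let r_out a b : ~~ isneg a -> r a b = 0. Proof. exact: ct1_X_out. Qed.
Let rlieE u v w : ct2 rho (lie d (X u) (X v)) (X w) = \sum_e Cc u v e * r e w.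
Proof. by rewrite /ct2 ct1_lie. Qed.

Lemma r_closed a b c :
  (der d (X a) (r b c) - \sum_e Cc a b e * r e c)
  + (der d (X b) (r c a) - \sum_e Cc b c e * r e a)
  + (der d (X c) (r a b) - \sum_e Cc c a e * r e b) = 0.
Proof.
rewrite -!rlieE -(cartan2 dM rhoN) /ct3 /ct2.
rewrite -[RHS](ct1_0 (X a)); apply: eq_ct1 => i; rewrite -[RHS](ct1_0 (X b)).
apply: eq_ct1 => j; rewrite -[RHS](ct1_0 (X c)); apply: eq_ct1 => k; exact: rho_closed.
Qed.

Let be := r om1 th3.
Let s a b := r a b - be * Rz a b.
(* by the argument below, s := r - be rho_0 vanishes; al is d be + be phi_1 *)
Let al a := der d (X a) be + be * ps a ph1.

Let sN a b : s a b = - s b a.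
Proof. by rewrite /s rN RzN; ring. Qed.

Let saa a : s a a = 0. Proof. by apply: tf2; rewrite {1}sN. Qed.

Let s_th0 b : s th0 b = 0.
Proof. by rewrite /s r_th0 Rz_th0 mulr0 subr0. Qed.

(** The equation d rho = 0 for rho = be rho_0 + s, with d rho_0 = phi_1 /\ rho_0 + T inserted. *)
Lemma s_closed a b c :
  (al a * Rz b c + al b * Rz c a + al c * Rz a b + be * Tor a b c)
  + (der d (X a) (s b c) - \sum_e Cc a b e * s e c)
  + (der d (X b) (s c a) - \sum_e Cc b c e * s e a)
  + (der d (X c) (s a b) - \sum_e Cc c a e * s e b) = 0.
Proof.
rewrite -[RHS](r_closed a b c).
have D u v w : der d (X u) (r v w) = der d (X u) be * Rz v w + der d (X u) (s v w).
  rewrite -{1}[r v w](subrK (be * Rz v w)) derD (derM dM) (der_int dM) -/(s v w); ring.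
have S u v w : \sum_e Cc u v e * r e w = be * GG u v w + \sum_e Cc u v e * s e w.
  by rewrite /GG mulr_sumr -big_split; apply: eq_bigr => e _ /=; rewrite /s; ring.
rewrite (D a b c) (D b c a) (D c a b) !S /al.
have := Nh_GG a b c; rewrite Nh_frame /phR => H.
have -> : GG a b c = - (ps a ph1 * Rz b c + ps b ph1 * Rz c a + ps c ph1 * Rz a b
   + Tor a b c) - GG b c a - GG c a b by rewrite H; ring.
ring.
Qed.

(** The leading part of the bracket with [X th0]. Up to sign it moves [om1] to [om2] to [om3] and
    [th1] to [th2] to [th3], which drives the induction on the weight. *)
Let sc0 x f := \sum_e (sc th0 x e)%:~R * f e : A.
Let sc0E f : (sc0 om1 f = f om2) * (sc0 om2 f = - f om3) * (sc0 om3 f = 0) *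
  (sc0 th1 f = f th2) * (sc0 th2 f = - f th3) * (sc0 th3 f = 0).
Proof.
rewrite /sc0 !sum_kidxs !big_cons !big_nil /sc /=.
by rewrite !(mul0r, mul1r, mulN1r, addr0, add0r).
Qed.

Let s_below W := forall x y, isneg x -> isneg y -> - kdeg x - kdeg y < W -> s x y = 0.

(* Only the leading structure functions contribute, as s vanishes in lower weight. *)
Lemma s_step W x y : s_below W -> isneg x -> isneg y -> - kdeg x - kdeg y + 1 = W ->
  al th0 * Rz x y + be * Tor th0 x y = sc0 x (fun e => s e y) + sc0 y (fun e => s x e).
Proof.
move=> sW nx ny Wxy; have := s_closed th0 x y.
have Z u : Rz u th0 = 0 by rewrite RzN Rz_th0 oppr0.
have sZ u : s u th0 = 0 by rewrite sN s_th0 oppr0.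
rewrite !Rz_th0 !Z !mulr0 !addr0 !s_th0 !sZ !(der0 d) sW //; last by lia.
rewrite (der0 d) !sub0r [\sum_e Cc x y e * s e th0]big1 => [|e _]; last by rewrite sZ mulr0.
have L u v : isneg u -> isneg v -> - kdeg u - kdeg v + 1 = W ->
    \sum_e Cc th0 u e * s e v = sc0 u (fun e => s e v).
  move=> nu nv Wuv; apply: eq_bigr => e _.
  have [ne|ne] := boolP (isneg e); last first.
    by rewrite /s r_out // /Rz sympz_out //; ring.
  have [le|lt] := leP (kdeg e) (kdeg th0 + kdeg u); first by rewrite Cc_lead.
  by rewrite sW ?mulr0 //; move: lt; rewrite (_ : kdeg th0 = -1) //; lia.
have -> : \sum_e Cc y th0 e * s e x = sc0 y (fun e => s x e).
  transitivity (\sum_e - (Cc th0 y e * s e x)); last first.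
    rewrite sumrN L //; last by lia.
    by rewrite /sc0 -sumrN; apply: eq_bigr => e _; rewrite [s e x]sN mulrN opprK.
  apply: eq_bigr => e _; rewrite -mulNr; congr (_ * _).
  by rewrite /Cc /ct1 -sumrN; apply: eq_bigr => i _; rewrite /lie; ring.
rewrite L // oppr0 addr0.
move=> /eqP; rewrite -addrA -opprD subr_eq0 => /eqP; exact.
Qed.

Let r_neg u v : u \in [:: om1; th1] -> v \in [:: om1; th1] -> r u v = 0.
Proof.
have raa a : r a a = 0 by apply: tf2; rewrite {1}rN.
by rewrite !inE => /orP[] /eqP -> /orP[] /eqP ->; rewrite ?raa // rN r_V oppr0.
Qed.

Let r_lie0 u v : u \in [:: om1; th1] -> v \in [:: om1; th1] -> sc0 u (fun e => r e v) = 0.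
Proof.
move=> uV vV; rewrite -(r_lie uV vV) rlieE; apply: eq_bigr => e _.
have [ne|ne] := boolP (isneg e); last by rewrite r_out // !mulr0.
have nu : isneg u by move: uV; rewrite !inE => /orP[] /eqP ->.
have du : kdeg u = -1 by move: uV; rewrite !inE => /orP[] /eqP ->.
have [le|lt] := leP (kdeg e) (kdeg th0 + kdeg u); first by rewrite Cc_lead.
have : e \in [:: om1; th1; th0].
  by move: lt ne; rewrite du; move: e; apply: kidx_ind.
rewrite !inE => /or3P[] /eqP ->; last by rewrite r_th0 !mulr0.
  by rewrite (@r_neg om1 v) ?mulr0.
by rewrite (@r_neg th1 v) ?mulr0.
Qed.

Let r_om2 v : v \in [:: om1; th1] -> r om2 v = 0.
Proof. by move=> vV; rewrite -(@r_lie0 om1 v _ vV) ?sc0E // inE eqxx. Qed.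

Let r_th2 v : v \in [:: om1; th1] -> r th2 v = 0.
Proof. by move=> vV; rewrite -(@r_lie0 th1 v _ vV) ?sc0E // !inE eqxx orbT. Qed.

(** The conditions on V and [E, V] settle all pairs of weight at most 3. *)
Let s_below4 : s_below 4.
Proof.
have Z u : s u th0 = 0 by rewrite sN s_th0 oppr0.
have sE x y : sympz x y = 0 -> r x y = 0 -> s x y = 0.
  by move=> z0 r0; rewrite /s r0 /Rz z0 mulr0 subr0.
have F1 : s om1 th1 = 0 by apply: sE.
have F2 : s om2 om1 = 0 by apply: sE => //; exact: r_om2.
have F3 : s om2 th1 = 0 by apply: sE => //; exact: r_om2.
have F4 : s th2 om1 = 0 by apply: sE => //; exact: r_th2.
have F5 : s th2 th1 = 0 by apply: sE => //; exact: r_th2.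
move=> x y nx ny; move: x nx y ny; apply: kidx_ind => // _;
  apply: kidx_ind => // _ w; first [exact: saa | exact: s_th0 | exact: Z
  | exact: F1 | exact: F2 | exact: F3 | exact: F4 | exact: F5
  | by rewrite sN ?F1 ?F2 ?F3 ?F4 ?F5 oppr0 | by []].
Qed.

Let Tor_th0 x y : - kdeg x - kdeg y < 5 -> Tor th0 x y = 0.
Proof. by move=> lt; apply: (Tor_below KK_below2); rewrite (_ : kdeg th0 = -1) //; lia. Qed.

Let s_below5 : s_below 5.
Proof.
have step x y : isneg x -> isneg y -> - kdeg x - kdeg y + 1 = 4 -> sympz x y = 0 ->
    sc0 x (fun e => s e y) + sc0 y (fun e => s x e) = 0.
  move=> nx ny w z0; rewrite -(s_step s_below4 nx ny w) Tor_th0; last by lia.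
  by rewrite /Rz z0 !mulr0 addr0.
have Z u : s u th0 = 0 by rewrite sN s_th0 oppr0.
have F0 : s om1 th3 = 0 by rewrite /s /be /Rz (_ : sympz _ _ = 1) // mulr1 subrr.
have F1 : s om1 om3 = 0.
  by have := step om1 om2 isT isT erefl erefl; rewrite !sc0E saa add0r => /eqP; rewrite oppr_eq0 => /eqP.
have F2 : s th1 th3 = 0.
  by have := step th1 th2 isT isT erefl erefl; rewrite !sc0E saa add0r => /eqP; rewrite oppr_eq0 => /eqP.
have F3 : s om2 th2 = 0.
  by have := step om1 th2 isT isT erefl erefl; rewrite !sc0E F0 oppr0 addr0.
have F4 : s th1 om3 = 0.
  have := step th1 om2 isT isT erefl erefl; rewrite !sc0E sN F3 oppr0 add0r.
  by move/eqP; rewrite oppr_eq0 => /eqP.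
move=> x y nx ny; have [lt _|ge] := ltP (- kdeg x - kdeg y) 4; first exact: s_below4.
move: x nx y ny ge; apply: kidx_ind => // _;
  apply: kidx_ind => // _ w w'; first [exact: saa | exact: s_th0 | exact: Z
  | exact: F0 | exact: F1 | exact: F2 | exact: F3 | exact: F4
  | by rewrite sN ?F0 ?F1 ?F2 ?F3 ?F4 oppr0 | by []].
Qed.

Let s_below6 : s_below 6.
Proof.
have step x y : isneg x -> isneg y -> - kdeg x - kdeg y + 1 = 5 ->
    al th0 * Rz x y = sc0 x (fun e => s e y) + sc0 y (fun e => s x e).
  by move=> nx ny w; rewrite -(s_step s_below5 nx ny w) Tor_th0 ?mulr0 ?addr0 //; lia.
have Z u : s u th0 = 0 by rewrite sN s_th0 oppr0.
have F1 : s om2 om3 = 0.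
  by have := step om1 om3 isT isT erefl; rewrite !sc0E addr0 mulr0 => <-.
have F2 : s th2 th3 = 0.
  by have := step th1 th3 isT isT erefl; rewrite !sc0E addr0 mulr0 => <-.
have E3 : al th0 = s om2 th3.
  by have := step om1 th3 isT isT erefl; rewrite !sc0E addr0 mulr1.
have E4 : al th0 = s om3 th2.
  by have := step om3 th1 isT isT erefl; rewrite !sc0E add0r mulr1.
(* [E3] and [E4] identify [al th0] with [s om2 th3] and with [s om3 th2], while the pair [om2],
   [th2] gives minus their sum; hence three times [al th0] is 0. *)
have a0 : al th0 = 0.
  apply: tf3; have := step om2 th2 isT isT erefl; rewrite !sc0E mulr1 -E3 -E4.
  by move=> {1}->; ring.
have F3 : s om2 th3 = 0 by rewrite -E3.
have F4 : s om3 th2 = 0 by rewrite -E4.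
move=> x y nx ny; have [lt _|ge] := ltP (- kdeg x - kdeg y) 5; first exact: s_below5.
move: x nx y ny ge; apply: kidx_ind => // _;
  apply: kidx_ind => // _ w w'; first [exact: saa | exact: s_th0 | exact: Z
  | exact: F1 | exact: F2 | exact: F3 | exact: F4
  | by rewrite sN ?F1 ?F2 ?F3 ?F4 oppr0 | by []].
Qed.

Let s_zero x y : s x y = 0.
Proof.
have Z u : s u th0 = 0 by rewrite sN s_th0 oppr0.
have so a b : ~~ isneg a -> s a b = 0.
  by move=> na; rewrite /s r_out // /Rz sympz_out // mulr0 subr0.
have [nx|/so //] := boolP (isneg x); have [ny|/so so'] := boolP (isneg y); last first.
  by rewrite sN so' oppr0.
(* Two equations express [s om3 th3] by torsion of homogeneity 2, which need not vanish. Their sum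
   involves only the trace that [consequence_2s] kills. *)
have F : s om3 th3 = 0.
  have E1 := s_step s_below6 (isT : isneg om2) (isT : isneg th3) erefl.
  have E2 := s_step s_below6 (isT : isneg om3) (isT : isneg th2) erefl.
  rewrite !sc0E !mulr0 add0r addr0 in E1; rewrite !sc0E !mulr0 !add0r in E2.
  have T0 : Tor th0 om2 th3 + Tor th0 om3 th2 = 0.
    rewrite /Tor -kevalD; apply: (lin_KK consequence_2s (rows_vanish _ KK_below2)) => //.
    by left.
  apply: tf2; apply/eqP; rewrite -subr_eq0 opprK -[s om3 th3]opprK -{1}E1 -E2.
  by rewrite -opprD -mulrDr T0 mulr0 oppr0.
have [lt|ge] := ltP (- kdeg x - kdeg y) 6; first exact: s_below6.
move: x nx y ny ge; apply: kidx_ind => // _;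
  apply: kidx_ind => // _ w; first [exact: saa | exact: s_th0 | exact: Z
  | exact: F | by rewrite sN F oppr0 | by []].
Qed.

Lemma closed_form_rh a b : r a b = r om1 th3 * Rz a b.
Proof. by apply/eqP; rewrite -subr_eq0; apply/eqP; exact: s_zero. Qed.

(** With s = 0, [s_closed] says al /\ rho_0 + be T = 0, and al /\ rho_0 vanishes on triples
    isotropic for rho_0. *)
Lemma closed_form_Tor a b c : sympz a b = 0 -> sympz b c = 0 -> sympz c a = 0 ->
  r om1 th3 * Tor a b c = 0.
Proof.
move=> ab bc ca; have := s_closed a b c; rewrite !s_zero !(der0 d) /Rz ab bc ca.
have Z u v w : \sum_e Cc u v e * s e w = 0 by rewrite big1 // => e _; rewrite s_zero mulr0.
by rewrite !Z !mulr0 !subrr !addr0 !add0r.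
Qed.

End ClosedForm.

(** * The frame in jet coordinates *)

Section EquationManifold.
Notation J s i := (@jy 2 s i).
Notation x0 := (@jx 2).
Variables (sol : 'I_7 -> A) (c : A).
Hypothesis sol_x : sol x0 = 1.
Hypothesis d_sol0 : forall j i, d j (sol (J 0 i)) = (J 1 i == j)%:R.
Hypothesis d_sol1 : forall j i, d j (sol (J 1 i)) = (J 2 i == j)%:R.
Hypothesis solX : forall j, sol j = c * X th0 j.
Hypothesis P_vert : forall i b, isneg b -> b \notin [:: om1; th1] -> P (J 2 i) b = 0.
Hypothesis X_vert : forall u, u \in [:: om1; th1] ->
  [/\ X u x0 = 0, forall i, X u (J 0 i) = 0 & forall i, X u (J 1 i) = 0].

Let c' := X th0 x0.
Let cc' : c' * c = 1. Proof. by rewrite mulrC -solX sol_x. Qed.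
Let Xsol j : X th0 j = c' * sol j. Proof. by rewrite solX mulrA cc' mul1r. Qed.

Let ct1Zv (w : 'I_7 -> A) a (Y : 'I_7 -> A) : ct1 w (fun j => a * Y j) = a * ct1 w Y.
Proof. by rewrite /ct1 mulr_sumr; apply: eq_bigr => j _; rewrite mulrA. Qed.

Let ct1_sol (w : 'I_7 -> A) : ct1 w sol = c * ct1 w (X th0).
Proof. by rewrite -ct1Zv; apply: eq_bigr => j _; rewrite solX. Qed.

Let d_nat i (n : nat) : d i n%:R = 0.
Proof. by rewrite -[n%:R]/((Posz n)%:~R) (d_int dM). Qed.

(** The bracket of the solution field with d/dy_2^i is - d/dy_1^i modulo V, whereas by degree
    brackets of [X th0] with V have no [om3] or [th3] component. Both enter the exterior derivative
    of the form [e] on the solution field and d/dy_2^i. *)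
Lemma P_second i e : e \in [:: om3; th3] -> P (J 1 i) e = 0.
Proof.
move=> e3; pose w j := P j e; pose dl (j : 'I_7) : A := (J 2 i == j)%:R.
have ne : isneg e by move: e3; rewrite !inE => /orP[] /eqP ->.
have wV b : b \in [:: om1; th1; th0] -> ct1 w (X b) = 0.
  move=> bV; have nb : isneg b by move: bV; rewrite !inE => /or3P[] /eqP ->.
  rewrite (XP nb ne); move: bV e3; rewrite !inE.
  by move=> /or3P[] /eqP -> /orP[] /eqP ->.
have w2 k : w (J 2 k) = 0 by apply: P_vert => //; move: e3; rewrite !inE => /orP[] /eqP ->.
have ct1_dl (v : 'I_7 -> A) : ct1 v dl = v (J 2 i).
  by rewrite /ct1 -(sum_delta (J 2 i) v).
pose M a b := d a (w b) - d b (w a).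
have B0 u : u \in [:: om1; th1] -> ct2 M (X th0) (X u) = 0.
  move=> uV; have nu : isneg u by move: uV; rewrite !inE => /orP[] /eqP ->.
  have uV' : u \in [:: om1; th1; th0] by move: uV; rewrite !inE => /orP[] /eqP ->.
  rewrite (cartan1 dM) (wV _ uV') (wV th0) // !der0 subrr sub0r.
  rewrite -/(Cc th0 u e) Cc_lead //.
    by move: uV e3; rewrite !inE => /orP[] /eqP -> /orP[] /eqP ->; rewrite oppr0.
  by move: uV e3; rewrite !inE => /orP[] /eqP -> /orP[] /eqP ->.
have dlE j : dl j = \sum_b P (J 2 i) b * X b j by rewrite PX.
have B1 : ct2 M sol dl = 0.
  rewrite {1}/ct2 ct1_sol.
  rewrite (_ : ct1 _ _ = \sum_b P (J 2 i) b * ct2 M (X th0) (X b)); last first.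
    rewrite -/(ct2 M (X th0) dl) /ct2 ct1C (_ : dl = fun j => \sum_b P (J 2 i) b * X b j).
      rewrite ct1_lin; apply: eq_bigr => b _; congr (_ * _); by rewrite [RHS]ct1C.
    by apply/funext.
  rewrite big1 ?mulr0 // => b _; have [bV|bV] := boolP (b \in [:: om1; th1]).
    by rewrite B0 ?mulr0.
  have [nb|nb] := boolP (isneg b); first by rewrite P_vert // mul0r.
  by rewrite /ct2 ct1C ct1_X_out // mulr0.
have := cartan1 dM w sol dl; rewrite -/M B1 ct1_sol (wV th0) // mulr0 ct1_dl w2 !der0 subrr sub0r.
move/eqP; rewrite eq_sym oppr_eq0 => /eqP.
rewrite /ct1 /lie; under eq_bigr => j _.
  rewrite (_ : der d dl (sol j) = d (J 2 i) (sol j)); last by rewrite /der ct1_dl.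
  rewrite (_ : der d sol (dl j) = 0); last first.
    by rewrite -(ct1_0 sol); apply: eq_ct1 => k; exact: d_nat.
  rewrite sub0r; over.
rewrite sum7 sol_x -[1 : A]/(1%:R) d_nat oppr0 mul0r add0r.
rewrite big1 => [|k _]; last by rewrite d_sol0 jy_eq // oppr0 mul0r.
rewrite [X in _ + X]big1 => [|k _]; last by rewrite w2 mulr0.
rewrite add0r addr0 => /eqP.
under eq_bigr => k _ do rewrite d_sol1 jy_eq // eqxx mulNr.
rewrite sumrN oppr_eq0 => /eqP.
under eq_bigr do rewrite andTb eq_sym.
by rewrite (sum_delta i (fun k => w (J 1 k))).
Qed.

Lemma rh_sol b : \sum_a sol a * rh a b = 0.
Proof. by rewrite -/(ct1 (fun a => rh a b) sol) ct1_sol rh_th0 mulr0. Qed.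

Lemma rh_vert i a : rh (J 2 i) a = P (J 2 i) om1 * P a th3 - P (J 2 i) th1 * P a om3.
Proof. by rewrite /rh /symp !(@P_vert i om2, @P_vert i om3, @P_vert i th2, @P_vert i th3) //; ring. Qed.

Lemma rh22 i j : rh (J 2 i) (J 2 j) = 0.
Proof. by rewrite rh_vert !(@P_vert j om3, @P_vert j th3) //; ring. Qed.

Lemma rh21 i j : rh (J 2 i) (J 1 j) = 0.
Proof. by rewrite rh_vert !P_second // !mulr0 subrr. Qed.

(** The matrix is the product of the pairing of V with [om1], [th1] and that of d/dy_0 with [th3],
    [om3]. The signs [sg] are those in [rh_vert]. *)
Lemma rh_nondegenerate : exists N : 'M[A]_2,
  (\matrix_(i, j) rh (J 2 i) (J 0 j)) *m N = 1%:M.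
Proof.
pose u (k : 'I_2) : kidx := if k == 0 then om1 else th1.
pose f (k : 'I_2) : kidx := if k == 0 then th3 else om3.
pose sg (k : 'I_2) : A := if k == 0 then 1 else -1.
pose A0 : 'M[A]_2 := \matrix_(i, k) P (J 2 i) (u k).
pose XX : 'M[A]_2 := \matrix_(k, j) X (u k) (J 2 j).
pose Q : 'M[A]_2 := \matrix_(j, k) (sg k * P (J 0 j) (f k)).
(* Subtracting a multiple of [sol] removes the x-component of the frame vector without changing its
   [th3] and [om3] values; then only its y_0 components pair. *)
pose C : 'M[A]_2 := \matrix_(k, j) (sg k * (X (f k) (J 0 j) - X (f k) x0 * sol (J 0 j))).
have sum2 (G : 'I_2 -> A) : \sum_k G k = G 0 + G 1.
  by rewrite !big_ord_recl big_ord0 addr0; congr (_ + G _); exact: val_inj.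
have J2 i j : ((J 2 i : 'I_7) == J 2 j) = (i == j) by exact: (@jy_eq 2 2 i 2 j isT isT).
have E1 : A0 *m XX = 1%:M.
  apply/matrixP => i j; rewrite !mxE sum2 !mxE /=.
  transitivity (\sum_b P (J 2 i) b * X b (J 2 j)); last by rewrite PX J2.
  rewrite sum_kidxs !big_cons big_nil.
  rewrite !(@P_vert i om2, @P_vert i om3, @P_vert i th2, @P_vert i th3, @P_vert i th0) //.
  by rewrite !(@X_out ph0, @X_out ph1, @X_out ph2, @X_out xi0, @X_out om0, @X_out ga0) //;
    rewrite !(mul0r, mulr0, add0r, addr0).
have fneg k : isneg (f k) by rewrite /f; case: ifP.
have E2 : C *m Q = 1%:M.
  apply/matrixP => k l; rewrite !mxE.
  have H1 : \sum_a X (f k) a * P a (f l) = (f k == f l)%:R by exact: XP.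
  have H2 : \sum_a sol a * P a (f l) = 0.
    rewrite -/(ct1 (fun a => P a (f l)) sol) ct1_sol XP // /f.
    by case: ifP; rewrite mulr0.
  have Z2 i : P (J 2 i) (f l) = 0 by apply: P_vert; rewrite // /f; case: ifP.
  have Z1 i : P (J 1 i) (f l) = 0 by apply: P_second; rewrite /f; case: ifP.
  move: H1 H2; rewrite !sum7 !sum2 !Z1 !Z2 sol_x mul1r !mulr0 !addr0 => H1 H2.
  transitivity (sg k * sg l * (f k == f l)%:R); last first.
    by rewrite /sg /f; case: k l {H1 H2 Z1 Z2} => [[|[|//]] ?] [[|[|//]] ?] /=;
      rewrite ?mulr0 ?mulr1 ?mulrNN ?mulr1.
  rewrite !mxE -H1 -[RHS]subr0 -(mulr0 (sg k * sg l * X (f k) x0)) -H2; ring.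
exists (C^T *m XX).
have -> : \matrix_(i, j) rh (J 2 i) (J 0 j) = A0 *m Q^T.
  apply/matrixP => i j; rewrite !mxE rh_vert sum2 !mxE /sg /f /u /=; ring.
by rewrite mulmxA -(mulmxA A0) -trmx_mul E2 trmx1 mulmx1.
Qed.

Section Multiplier.
Variable rho : 'I_7 -> 'I_7 -> A.
Hypothesis rhoN : forall i j, rho i j = - rho j i.
Hypothesis rho_closed : forall i j k, d i (rho j k) + d j (rho k i) + d k (rho i j) = 0.
Hypothesis rho_sol : forall b, \sum_a sol a * rho a b = 0.
Hypothesis rho22 : forall i j, rho (J 2 i) (J 2 j) = 0.
Hypothesis rho21 : forall i j, rho (J 2 i) (J 1 j) = 0.

Let r_th0 (Y : 'I_7 -> A) : ct2 rho (X th0) Y = 0.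
Proof.
rewrite /ct2 ct1C -[RHS](ct1_0 Y); apply: eq_ct1 => j; rewrite /ct1.
under eq_bigr do rewrite Xsol -mulrA.
by rewrite -mulr_sumr rho_sol mulr0.
Qed.

Let ct1_vert (w : 'I_7 -> A) u : u \in [:: om1; th1] -> ct1 w (X u) = \sum_i X u (J 2 i) * w (J 2 i).
Proof.
move=> uV; have [x1 x2 x3] := X_vert uV; rewrite /ct1 sum7 x1 mul0r add0r.
rewrite big1 => [|i _]; last by rewrite x2 mul0r.
by rewrite [X in _ + X + _]big1 ?add0r // => i _; rewrite x3 mul0r.
Qed.

Let w_vert v j : v \in [:: om1; th1] ->
  (ct1 (rho (J 1 j)) (X v) = 0) * (ct1 (rho (J 2 j)) (X v) = 0).
Proof.
move=> vV; rewrite !ct1_vert // !big1 // => i _; first by rewrite rho22 mulr0.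
by rewrite rhoN rho21 oppr0 mulr0.
Qed.

Let r_V : ct2 rho (X om1) (X th1) = 0.
Proof.
rewrite /ct2 ct1_vert // big1 // => i _.
by rewrite (w_vert i (v := th1)) ?mulr0 // !inE eqxx orbT.
Qed.

(** Up to a multiple of [sol], which rho annihilates, the bracket has only y_1 and y_2 components,
    and these pair to zero with V. *)
Let r_lie u v : u \in [:: om1; th1] -> v \in [:: om1; th1] ->
  ct2 rho (lie d (X th0) (X u)) (X v) = 0.
Proof.
move=> uV vV; pose w i := ct1 (rho i) (X v).
have [x1 x2 x3] := X_vert uV.
have w0 : \sum_i sol i * w i = 0.
  rewrite -/(ct1 w sol) ct1C -[RHS](ct1_0 (X v)); apply: eq_ct1 => j; exact: rho_sol.
transitivity (\sum_i (- der d (X u) c') * (sol i * w i)); last by rewrite -mulr_sumr w0 mulr0.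
have key i : der d (X u) (sol i) = 0 -> X u i = 0 ->
    lie d (X th0) (X u) i * w i = - der d (X u) c' * (sol i * w i).
  by move=> ds xi; rewrite /lie xi der0 Xsol (derM dM) ds; ring.
have der_nat (b : bool) : der d (X u) b%:R = 0.
  by rewrite -(ct1_0 (X u)); apply: eq_ct1 => k; exact: d_nat.
rewrite /ct2 {1}/ct1 -/w; apply: eq_bigr => i _; rewrite -/(w i).
have [->|[s [j [s2 ->]]]] := ord7P i.
  by apply: key; [rewrite sol_x; exact: (der_nat true)|exact: x1].
case: s s2 => [|[|[|//]]] _.
- apply: key; [|exact: x2]; rewrite /der (_ : ct1 _ _ = X u (J 1 j)) ?x3 //.
  rewrite /ct1; under eq_bigr do rewrite d_sol0 mulrC.
  by rewrite (sum_delta (J 1 j) (X u)).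
- by rewrite /w (w_vert j vV) !mulr0.
by rewrite /w (w_vert j vV) !mulr0.
Qed.

Definition multiplier : A := ct2 rho (X om1) (X th3).

Lemma rho_multiplier i j : rho i j = multiplier * rh i j.
Proof.
have H := closed_form_rh rhoN rho_closed (fun b => r_th0 (X b)) r_V r_lie.
apply/eqP; rewrite -subr_eq0; apply/eqP.
pose E i j := rho i j - multiplier * rh i j; rewrite -[LHS]/(E i j).
apply: (frame_ext (w := fun j => E i j)) => b nb.
apply: (frame_ext (w := fun i => ct1 (E i) (X b))) => a na.
rewrite -[LHS]/(ct2 E (X a) (X b)).
have -> : ct2 E (X a) (X b) = ct2 rho (X a) (X b) - multiplier * ct2 rh (X a) (X b).
  rewrite /ct2 {3}/ct1 mulr_sumr -sumrB; apply: eq_bigr => k _.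
  rewrite mulrCA -mulrBr; congr (_ * _); rewrite /ct1 mulr_sumr -sumrB.
  by apply: eq_bigr => l _; rewrite /E; ring.
by rewrite H ct2_rh symp_psps subrr.
Qed.

Lemma multiplier_Tor a b e : sympz a b = 0 -> sympz b e = 0 -> sympz e a = 0 ->
  multiplier * Tor a b e = 0.
Proof. exact: (closed_form_Tor rhoN rho_closed (fun b => r_th0 (X b)) r_V r_lie). Qed.

End Multiplier.

End EquationManifold.

End Frame.

(** * The Poincare lemma *)

Section OneVariable.
Variable R : realType.

Lemma mean_bound (h dh : R -> R) (a b M : R) :
  (forall x, Num.min a b <= x <= Num.max a b -> is_derive x 1 h (dh x) /\ `|dh x| <= M) ->
  `|h b - h a| <= M * `|b - a|.
Proof.
wlog ab : a b / a <= b => [W|].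
  have [/W //|] := boolP (a <= b); rewrite -ltNge => /ltW ba H.
  by rewrite distrC [`|b - a|]distrC W // minC maxC.
rewrite min_l // max_r // => H.
have [x||x] := @MVT_segment R h dh a b ab.
- by rewrite in_itv /= => /andP[ax xb]; have [] : _ /\ _ := H x _; rewrite ?(ltW ax) ?(ltW xb).
- by apply: derivable_within_continuous => x; rewrite in_itv /= => /H[[]].
rewrite in_itv /= => /H[_ dM] ->; rewrite normrM.
by apply: ler_wpM2r.
Qed.

Lemma antiderivative_cst (h : R -> R) (c x r : R) : `|x - c| < r ->
  (forall y, `|y - c| < r -> is_derive y 1 h 0) -> h x = h c.
Proof.
move=> xr H; apply/eqP; rewrite -subr_eq0 -normr_le0.
rewrite -[X in _ <= X](mul0r `|x - c|).
apply: (@mean_bound h (fun=> 0)) => y yx; rewrite normr0; split=> //; apply: H.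
apply: le_lt_trans xr; move: yx; rewrite /Num.min /Num.max; case: ltP => cx /andP[y1 y2].
  by rewrite !ger0_norm; lra.
by rewrite !ler0_norm; lra.
Qed.

Lemma antiderivative_closed (f : R -> R) (c r : R) : 0 < r ->
  (forall x, `|x - c| <= r -> {for x, continuous f}) ->
  exists F : R -> R, F c = 0 /\ forall x, `|x - c| < r -> is_derive x 1 F (f x).
Proof.
move=> r0 cf; pose mu := @lebesgue_measure R.
pose F0 (x : R) := Rintegral mu `[c - r, x] f.
have intf : mu.-integrable `[c - r, c + r] (EFin \o f).
  apply: continuous_compact_integrable; first exact: segment_compact.
  apply: continuous_in_subspaceT => x; rewrite inE /= in_itv /= => /andP[x1 x2].
  by apply: cf; rewrite ler_norml; lra.
exists (fun x => F0 x - F0 c); split; first by rewrite subrr.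
move=> x; rewrite ltr_norml => /andP[x1 x2].
have [dF0 F0E] : derivable F0 x 1 /\ derive1 F0 x = f x.
  by apply: (continuous_FTC1_closed _ intf); [lra|lra|apply: cf; rewrite ler_norml; lra].
have D : is_derive x 1 F0 (f x).
  by rewrite -F0E derive1E; exact: derivableP.
rewrite -[f x]subr0; apply: is_deriveB.
Qed.

(** Antiderivatives on smaller intervals, normalised at [c], agree where they overlap and can be
    glued. [rad x] is halfway between the distance of [x] from [c] and [r]. *)
Lemma antiderivative (f : R -> R) (c r : R) : 0 < r ->
  (forall x, `|x - c| < r -> {for x, continuous f}) ->
  exists F : R -> R, F c = 0 /\ forall x, `|x - c| < r -> is_derive x 1 F (f x).
Proof.
move=> r0 cf.
have H (e : R) : exists F : R -> R, 0 < e < r ->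
    F c = 0 /\ forall x, `|x - c| < e -> is_derive x 1 F (f x).
  have [/andP[e0 er]|ne] := boolP (0 < e < r); last by exists (fun=> 0).
  have [|F HF] := @antiderivative_closed f c e e0; last by exists F.
  by move=> x xe; apply: cf; exact: le_lt_trans er.
have {H}[G HG] := choice H.
pose rad x := (`|x - c| + r) / 2.
have radP x : `|x - c| < r -> (0 < rad x < r) /\ `|x - c| < rad x.
  by move=> xr; have := normr_ge0 (x - c); rewrite /rad; split; [apply/andP; split|]; lra.
exists (fun x => G (rad x) x); split.
  by have [] := HG (rad c); [have [] := radP c; rewrite // subrr normr0|].
move=> x xr; have [xrad xx] := radP x xr; have [G0 dG] := HG _ xrad.
apply: near_eq_is_derive (dG x xx).
have N (e : R) : `|x - c| < e -> \forall y \near x, `|y - c| < e.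
  move=> xe; have d0 : 0 < e - `|x - c| by rewrite subr_gt0.
  near=> y; have yx : `|y - x| < e - `|x - c| by near: y; apply/nbhs_ballP; exists (e - `|x - c|) => // z; rewrite /ball /= distrC.
  by have := ler_distD x y c; lra.
near=> y.
have y1 : `|y - c| < rad x by near: y; exact: N.
have y2 : `|y - c| < r by near: y; exact: N.
have [yrad yy] := radP y y2; have [G0' dG'] := HG _ yrad.
apply/eqP; rewrite -subr_eq0.
pose m := Num.min (rad x) (rad y).
have ym : `|y - c| < m by rewrite lt_min y1 yy.
have -> : G (rad x) y - G (rad y) y = (G (rad x) - G (rad y)) c.
  apply: (@antiderivative_cst _ c y m ym) => z; rewrite lt_min => /andP[z1 z2].
  have := is_deriveB (dG z z1) (dG' z z2); by rewrite subrr.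
by rewrite -[X in X == _]/(G (rad x) c - G (rad y) c) G0 G0' subrr.
Unshelve. all: by end_near.
Qed.

End OneVariable.

(** * Antiderivatives along one coordinate, depending smoothly on the others *)

Section CoordinatePrimitive.
Variables (R : realType) (n : nat) (c : 'rV[R]_n.+1) (r : R) (r0 : 0 < r).
Notation V := 'rV[R]_n.+1.
Let W : set V := ball c r.
Variable i : 'I_n.+1.
Implicit Types (p q : V) (s t : R) (g : V -> R).

Definition upd p s : V := (s - p 0 i) *: delta_mx 0 i + p.

Lemma updE p s k : upd p s 0 k = if k == i then s else p 0 k.
Proof.
rewrite !mxE eqxx /= eq_sym; case: eqP => [->|_]; first by rewrite mulr1 subrK.
by rewrite mulr0 add0r.
Qed.

Lemma upd_id p : upd p (p 0 i) = p.
Proof. by apply/rowP => k; rewrite updE; case: eqP => [->|]. Qed.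

Lemma ballP p e q : 0 < e -> ball p e q <-> forall k, `|q 0 k - p 0 k| < e.
Proof.
move=> e0; split=> [[_ H] k|]; last exact: ball_rowP.
by have := H 0 k; rewrite /ball /= distrC.
Qed.

Lemma upd_ball2 p q s t e : ball p e q -> `|t - s| < e -> ball (upd p s) e (upd q t).
Proof.
move=> [e0 pq] st; apply/ballP => // k; rewrite !updE; case: eqP => // _.
by have := pq 0 k; rewrite /ball /= distrC.
Qed.

Lemma upd_dom p s : W p -> `|s - c 0 i| < r -> W (upd p s).
Proof. by move=> Wp sr; rewrite /W -(upd_id c); exact: upd_ball2. Qed.

Lemma dom_dist p : W p -> `|p 0 i - c 0 i| < r.
Proof. by move/(ballP _ _ r0). Qed.

Definition cont g := forall p, W p -> {for p, continuous g}.

Lemma cont_ball g p e : cont g -> W p -> 0 < e ->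
  exists2 d, 0 < d & forall q, ball p d q -> `|g q - g p| < e.
Proof.
move=> cg Wp e0; have /cvgrPdist_lt/(_ e e0)/nbhs_ballP[d /= d0 H] := cg p Wp.
by exists d => // q /H; rewrite distrC.
Qed.

(** Compactness of the segment makes continuity of [g] uniform along the path of integration. *)
Lemma upd_near g p (K : set R) e : cont g -> compact K ->
  (forall s, K s -> `|s - c 0 i| < r) -> W p -> 0 < e ->
  \forall q \near p, forall s, K s -> `|g (upd q s) - g (upd p s)| < e.
Proof.
move=> cg cK Kr Wp e0; have e2 : 0 < e / 2 by rewrite divr_gt0.
have /compact_near_coveringP near_K := cK.
suff : \forall q \near nbhs p, K `<=` [set s | `|g (upd q s) - g (upd p s)| < e] by [].
apply: (near_K _ (nbhs p) (fun q s => `|g (upd q s) - g (upd p s)| < e)) => s0 Ks0.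
have [d d0 H] := cont_ball cg (upd_dom Wp (Kr _ Ks0)) e2.
exists (ball s0 d, ball p d); first by split; exact: nbhsx_ballx.
move=> [s q] [/= s0s pq]; have st : `|s - s0| < d by rewrite distrC.
have H1 := H _ (upd_ball2 pq st); have H2 := H _ (upd_ball2 (ballxx p d0) st).
rewrite distrC in H2; have := ler_distD (g (upd p s0)) (g (upd q s)) (g (upd p s)).
by lra.
Qed.

Definition anti (f : R -> R) : set (R -> R) :=
  [set F | F (c 0 i) = 0 /\ forall s, `|s - c 0 i| < r -> is_derive s 1 F (f s)].

Definition line g p : R -> R := fun s => g (upd p s).
(* [prim1] is the antiderivative of g along the i-th coordinate line through p
   which vanishes at c; [xget] selects it, so that it only depends on the line *)
Definition prim1 g p : R -> R := xget (fun=> 0) (anti (line g p)).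
Definition prim g p : R := prim1 g p (p 0 i).

Lemma line_upd g p s : line g (upd p s) = line g p.
Proof.
apply/funext => t; congr (g _); apply/rowP => k; rewrite !updE.
by case: eqP.
Qed.

Lemma prim_upd g p s : prim g (upd p s) = prim1 g p s.
Proof. by rewrite /prim /prim1 line_upd updE eqxx. Qed.

Lemma prim1P g p : cont g -> W p -> anti (line g p) (prim1 g p).
Proof.
move=> cg Wp; apply: xgetPex; have [|F [F0 HF]] := @antiderivative R (line g p) (c 0 i) r r0.
  move=> s sr; apply/cvgrPdist_lt => e e0.
  have [d d0 H] := cont_ball cg (upd_dom Wp sr) e0.
  apply/nbhs_ballP; exists d => //= t st; rewrite distrC; apply: H.
  by apply: upd_ball2; [exact: ballxx|rewrite distrC].
by exists F.
Qed.

Lemma seg_compact (a b : R) : compact [set s : R | Num.min a b <= s <= Num.max a b].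
Proof.
have := @segment_compact R (Num.min a b) (Num.max a b).
by congr compact; apply/seteqP; split=> s /=; rewrite in_itv.
Qed.

Lemma seg_dom p s : W p ->
  Num.min (c 0 i) (p 0 i) <= s <= Num.max (c 0 i) (p 0 i) -> `|s - c 0 i| < r.
Proof.
move=> /dom_dist; rewrite !ltr_norml => /andP[p1 p2].
by rewrite /Num.min /Num.max; case: ltP => cp /andP[s1 s2]; apply/andP; split; lra.
Qed.

(** Two errors are estimated: moving the endpoint, by a local bound on [g], and changing the line,
    uniformly by [upd_near]. *)
Lemma prim_cont g : cont g -> cont (prim g).
Proof.
move=> cg p Wp; apply/(@cvgrPdist_lt _ _ _ (nbhs p) (nbhs_filter p)) => e e0.
have [d d0 Hd] := cont_ball cg Wp ltr01.
pose M := `|g p| + 1; have M0 : 0 < M by rewrite /M; have := normr_ge0 (g p); lra.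
pose L := `|p 0 i - c 0 i| + 1; have L0 : 0 < L.
  by rewrite /L; have := normr_ge0 (p 0 i - c 0 i); lra.
have eL : 0 < e / 2 / L by rewrite !divr_gt0.
have eM : 0 < e / 2 / M by rewrite !divr_gt0.
have Kr s : [set s | Num.min (c 0 i) (p 0 i) <= s <= Num.max (c 0 i) (p 0 i)] s ->
  `|s - c 0 i| < r by exact: seg_dom.
have N := upd_near cg (@seg_compact (c 0 i) (p 0 i)) Kr Wp eL.
near=> q.
have Wq : W q by near: q; apply: open_nbhs_nbhs; split; [exact: ball_open|].
have pq : ball p d q by near: q; exact: nbhsx_ballx.
have pqM : ball p (e / 2 / M) q by near: q; exact: nbhsx_ballx.
have U s : Num.min (c 0 i) (p 0 i) <= s <= Num.max (c 0 i) (p 0 i) ->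
    `|g (upd q s) - g (upd p s)| < e / 2 / L.
  by move: s; near: q; move: N; apply: filterS => q Hq s; exact: Hq.
have [Fq0 dFq] := prim1P cg Wq; have [Fp0 dFp] := prim1P cg Wp.
have B1 : `|prim1 g q (q 0 i) - prim1 g q (p 0 i)| <= M * `|q 0 i - p 0 i|.
  apply: (@mean_bound _ _ (line g q)) => s sb.
  have sp : `|s - p 0 i| <= `|q 0 i - p 0 i|.
    move: sb; rewrite /Num.min /Num.max; case: ltP => cp /andP[s1 s2].
      by rewrite !ger0_norm; lra.
    by rewrite !ler0_norm; lra.
  have sd (f : R) : `|q 0 i - p 0 i| < f -> `|s - p 0 i| < f by exact: le_lt_trans.
  have sr : `|s - c 0 i| < r.
    have := dom_dist Wp; have := dom_dist Wq; rewrite !ltr_norml => /andP[+ +] /andP[+ +].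
    clear - sb; move: sb; rewrite /Num.min /Num.max.
    by case: ltP => cp /andP[s1 s2] h1 h2 h3 h4; apply/andP; split; lra.
  split; first exact: dFq.
  have : `|line g q s - g p| < 1.
    apply: Hd; rewrite -{1}(upd_id p); apply: upd_ball2 => //; apply: sd.
    by have /(ballP _ _ d0) := pq.
  by rewrite /M; have := ler_normD (line g q s - g p) (g p); rewrite subrK; lra.
have B2 : `|(prim1 g q (p 0 i) - prim1 g p (p 0 i)) - (prim1 g q (c 0 i) - prim1 g p (c 0 i))|
    <= e / 2 / L * `|p 0 i - c 0 i|.
  apply: (@mean_bound _ (fun s => prim1 g q s - prim1 g p s) (fun s => line g q s - line g p s)).
  move=> s sb; split; last exact/ltW/U.
  by apply: is_deriveB; [apply: dFq|apply: dFp]; exact: Kr.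
rewrite Fq0 Fp0 subrr subr0 in B2.
have C1 : M * `|q 0 i - p 0 i| < e / 2.
  by have /(ballP _ _ eM)/(_ i) := pqM; rewrite ltr_pdivlMr // mulrC.
have C2 : e / 2 / L * `|p 0 i - c 0 i| < e / 2.
  by rewrite -mulrA gtr_pMr ?divr_gt0 // mulrC ltr_pdivrMr // mul1r /L; lra.
rewrite /prim distrC.
have := ler_distD (prim1 g q (p 0 i)) (prim1 g q (q 0 i)) (prim1 g p (p 0 i)).
by lra.
Unshelve. all: by end_near.
Qed.

Lemma prim_pd_same g p : cont g -> W p -> is_derive p (delta_mx 0 i) (prim g) (g p).
Proof.
move=> cg Wp; have [_ dF] := prim1P cg Wp; have := dF _ (dom_dist Wp).
rewrite /line upd_id => D.
have E : (fun h : R => h^-1 *: (((prim1 g p) \o shift (p 0 i)) (h *: 1) - prim1 g p (p 0 i))) =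
    (fun h => h^-1 *: ((prim g \o shift p) (h *: delta_mx 0 i) - prim g p)).
  apply/funext => h /=; congr (_ *: (_ - _)); rewrite -prim_upd; congr prim.
  apply/rowP => k; rewrite updE !mxE eqxx /= eq_sym; case: eqP => [->|_]; first by rewrite mulr1 [h%:A]mulr1.
  by rewrite mulr0 add0r.
have [d v] := D; split.
  by move: d; rewrite /derivable E.
by rewrite -v /derive E.
Qed.

(** Differentiation under the integral sign: the mean value theorem in direction [j] compares
    difference quotients of [g] with [pd j g] uniformly on the segment, and [mean_bound] integrates
    the comparison. *)
Lemma prim_pd_other g j p : cont g -> j != i ->
  (forall q, W q -> derivable g q (delta_mx 0 j)) -> cont (pd j g) -> W p ->
  is_derive p (delta_mx 0 j) (prim g) (prim (pd j g) p).
Proof.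
move=> cg ji dg cdg Wp.
suff H : (fun h => h^-1 *: ((prim g \o shift p) (h *: delta_mx 0 j) - prim g p)) @ 0^' -->
    prim (pd j g) p.
  by apply: DeriveDef; [apply/cvg_ex; exists (prim (pd j g) p)|apply/cvg_lim].
apply/cvgrPdist_lt => e e0.
pose L := `|p 0 i - c 0 i| + 1; have L0 : 0 < L.
  by rewrite /L; have := normr_ge0 (p 0 i - c 0 i); lra.
have eL : 0 < e / L by rewrite !divr_gt0.
have Kr s : [set s | Num.min (c 0 i) (p 0 i) <= s <= Num.max (c 0 i) (p 0 i)] s ->
  `|s - c 0 i| < r by exact: seg_dom.
have /nbhs_ballP[d /= d0 U] := upd_near cdg (@seg_compact (c 0 i) (p 0 i)) Kr Wp eL.
have [d' d'0 W'] : exists2 d' : R, 0 < d' & ball p d' `<=` W.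
  have : nbhs p W by apply: open_nbhs_nbhs; split; [exact: ball_open|].
  by move/nbhs_ballP => [d' /= d'0 H]; exists d'.
have ejE (h : R) (p' : V) k : (h *: delta_mx 0 j + p' : V) 0 k = p' 0 k + (if k == j then h else 0).
  by rewrite !mxE eqxx /= addrC; case: eqP => _; rewrite ?mulr1 ?mulr0.
have pb (h f : R) : 0 < f -> `|h| < f -> ball p f (h *: delta_mx 0 j + p).
  move=> f0 hf; apply/ballP => // k; rewrite ejE addrAC subrr add0r.
  by case: eqP => // _; rewrite normr0.
near=> h.
have h0 : h != 0 by near: h; exact: nbhs_dnbhs_neq.
have hd : `|h| < d.
  near: h; apply: dnbhs0_lt; exact: d0.
have hd' : `|h| < d' by near: h; exact: dnbhs0_lt.
pose q := h *: delta_mx 0 j + p : V.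
have Wq : W q by apply: W'; exact: pb.
have qi : q 0 i = p 0 i by rewrite ejE eq_sym (negbTE ji) addr0.
have [Fq0 dFq] := prim1P cg Wq; have [Fp0 dFp] := prim1P cg Wp.
have [H0 dH] := prim1P cdg Wp.
have B : `|(prim1 g q (p 0 i) - prim1 g p (p 0 i) - h * prim1 (pd j g) p (p 0 i))
    - (prim1 g q (c 0 i) - prim1 g p (c 0 i) - h * prim1 (pd j g) p (c 0 i))|
    <= `|h| * (e / L) * `|p 0 i - c 0 i|.
  apply: (@mean_bound _ (fun s => prim1 g q s - prim1 g p s - h * prim1 (pd j g) p s)
     (fun s => line g q s - line g p s - h * line (pd j g) p s)).
  move=> s sb; have sr := Kr s sb; split.
    apply: is_deriveB; first by apply: is_deriveB; [exact: dFq|exact: dFp].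
    have := @is_deriveZ _ _ _ _ h _ _ _ (dH s sr); exact.
  have qE (h' : R) : upd (h' *: delta_mx 0 j + p) s = h' *: delta_mx 0 j + upd p s.
    apply/rowP => k; rewrite updE !ejE updE; case: eqP => [->|//].
    by rewrite eq_sym (negbTE ji) addr0.
  have [|t t01 E] := @MVT_pd R n W g (upd p s) j h dg.
    move=> t; rewrite in_itv /= => /andP[t0 t1]; rewrite -qE; apply: upd_dom => //.
    apply: W'; apply: pb => //; apply: le_lt_trans hd'.
    by rewrite normrM ger0_norm // ler_piMl.
  have -> : line g q s - line g p s - h * line (pd j g) p s =
      h * (pd j g (upd ((t * h) *: delta_mx 0 j + p) s) - pd j g (upd p s)).
    by rewrite mulrBr qE -E /line /q qE.
  rewrite normrM; apply: ler_wpM2l => //; apply: ltW; apply: U => //.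
  move: t01; rewrite in_itv /= => /andP[t0 t1]; apply: pb => //; apply: le_lt_trans hd.
  by rewrite normrM gtr0_norm // ler_piMl // ltW.
rewrite Fq0 Fp0 H0 mulr0 !subr0 in B.
rewrite /= -/q /prim qi -[X in X - _](mulKf h0) -[h^-1 *: _]/(h^-1 * _) -mulrBr normrM normfV.
rewrite distrC -(ltr_pM2l (x := `|h|)) ?normr_gt0 // mulVKf ?normr_eq0 //.
apply: le_lt_trans B _; rewrite -mulrA; rewrite ltr_pM2l ?normr_gt0 //.
by rewrite -mulrA gtr_pMr // mulrC ltr_pdivrMr // mul1r /L; lra.
Unshelve. all: by end_near.
Qed.

(** The induction runs over all smooth [g] at once, since a partial derivative of [prim g] is [g] or
    the primitive of a partial derivative of [g]. *)
Lemma prim_Ck m : forall g, smooth_on W g -> Ck_on m W (prim g).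
Proof.
have cont_smooth g : smooth_on W g -> cont g by move=> /(_ 0%N)[].
have smooth_pd g j : smooth_on W g -> smooth_on W (pd j g).
  by move=> sg k; have [_ /(_ j)[]] := sg k.+1.
have smooth_der g j p : smooth_on W g -> W p -> derivable g p (delta_mx 0 j).
  by move=> sg; have [_ /(_ j)[dg _]] := sg 1%N; exact: dg.
elim: m => [|m IH] g sg; split=> //; try exact/prim_cont/cont_smooth.
move=> j; have [->|ji] := eqVneq j i.
  split=> [p Wp|]; first by have [] := prim_pd_same (cont_smooth _ sg) Wp.
  apply: Ck_on_congr (sg m); first exact: ball_open.
  by move=> q Wq; have [_ ] := prim_pd_same (cont_smooth _ sg) Wq.
have D p : W p -> is_derive p (delta_mx 0 j) (prim g) (prim (pd j g) p).
  by apply: prim_pd_other; [exact: cont_smooth| |move=> q; exact: smooth_der|exact/cont_smooth/smooth_pd].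
split=> [p Wp|]; first by have [] := D p Wp.
apply: Ck_on_congr (IH _ (smooth_pd _ j sg)); first exact: ball_open.
by move=> q Wq; have [] := D q Wq.
Qed.

Lemma pd_prim_same g p : smooth_on W g -> W p -> pd i (prim g) p = g p.
Proof. by move=> sg Wp; have [_] := prim_pd_same (proj1 (sg 0%N)) Wp. Qed.

Lemma pd_prim_other g j p : smooth_on W g -> j != i -> W p ->
  pd j (prim g) p = prim (pd j g) p.
Proof.
move=> sg ji Wp; have [_ /(_ j)[dg [cdg _]]] := sg 1%N.
by have [] := prim_pd_other (proj1 (sg 0%N)) ji dg cdg Wp.
Qed.

Lemma prim_eq0 g p : cont g -> W p -> (forall q, W q -> g q = 0) -> prim g p = 0.
Proof.
move=> cg Wp g0; have [F0 dF] := prim1P cg Wp; rewrite -F0.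
apply: (antiderivative_cst (dom_dist Wp)) => s sr.
by have := dF s sr; rewrite /line g0 //; exact: upd_dom.
Qed.

End CoordinatePrimitive.

Section PoincareLemma.
Variables (R : realType) (n : nat) (c : 'rV[R]_n.+1) (r : R) (r0 : 0 < r).

(** For the sup norm a ball is a cube, so coordinate segments towards the slice through the centre
    stay inside. *)
Definition ball_domain : domain R n := Domain (ball_open c r) (ballxx c r0).
Notation W := ball_domain.

Lemma prim_eq i f g p : dom_set W p -> (forall q, dom_set W q -> f q = g q) ->
  prim c r i f p = prim c r i g p.
Proof.
move=> Wp fg; rewrite /prim /prim1; congr (xget _ _ _).
apply/seteqP; split=> F [F0 dF]; split=> // s sr; have := dF s sr;
  by rewrite /line fg //; exact: upd_dom.
Qed.

Definition sint (i : 'I_n.+1) (g : sfun W) : sfun W :=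
  mk_sfun (W := W) (fun m => prim_Ck r0 i m (sfun_smooth g)).

Lemma spd_sint i g : spd i (sint i g) = g.
Proof.
apply: sfun_evP => p Wp; rewrite (@pd_sfun _ _ _ _ _ (prim c r i g)) => [|q Wq].
  exact: (pd_prim_same r0 i (sfun_smooth g) Wp).
exact: ev_mk_sfun.
Qed.

Lemma spd_sint_neq i j g : j != i -> spd j (sint i g) = sint i (spd j g).
Proof.
move=> ji; apply: sfun_evP => p Wp.
rewrite (@pd_sfun _ _ _ _ _ (prim c r i g)) => [|q Wq]; last exact: ev_mk_sfun.
rewrite ev_mk_sfun (pd_prim_other r0 (sfun_smooth g) ji Wp); apply: prim_eq => // q Wq.
by rewrite -[RHS]/(ev Wq (spd j g)) ev_spd.
Qed.

Lemma sint0 i : sint i 0 = 0.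
Proof.
apply: sfun_evP => p Wp; rewrite ev_mk_sfun rmorph0; apply: prim_eq0 => // [q Wq|q Wq].
  by have [] := sfun_smooth (0 : sfun W) 0%N => + _; exact.
by rewrite -[LHS]/(@ev R n W q Wq 0) rmorph0.
Qed.

(** Only the coordinates in [l] are solved for. The correction for a new coordinate [i] is
    integrated along [i]; its integrand has zero derivative in the other listed coordinates, so
    these equations persist. *)
Lemma closed1_exact (l : seq 'I_n.+1) (w : 'I_n.+1 -> sfun W) : uniq l ->
  {in l &, forall i j, spd i (w j) = spd j (w i)} ->
  exists f, {in l, forall i, spd i f = w i}.
Proof.
elim: l => [|i l IH] /=; first by exists 0.
move=> /andP[il ul] cw; have [|f Hf] := IH ul.
  by move=> a b al bl; apply: cw; rewrite inE ?al ?bl orbT.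
exists (f + sint i (w i - spd i f)) => j; rewrite inE => /orP[/eqP ->|jl].
  by rewrite raddfD /= spd_sint addrC subrK.
have ji : j != i by apply: contraNneq il => <-.
rewrite raddfD /= spd_sint_neq // raddfB /= spdC Hf //.
by rewrite (cw j i) ?inE ?jl ?eqxx ?orbT // subrr sint0 addr0.
Qed.

(** A new coordinate [i] needs a component [- g] of the potential where [g] has prescribed
    derivatives in the listed coordinates; closedness of [rho] is the integrability condition. *)
Lemma closed2_exact (l : seq 'I_n.+1) (rho : 'I_n.+1 -> 'I_n.+1 -> sfun W) : uniq l ->
  (forall i j, rho i j = - rho j i) ->
  (forall i j k, spd i (rho j k) + spd j (rho k i) + spd k (rho i j) = 0) ->
  exists w, {in l &, forall i j, rho i j = spd i (w j) - spd j (w i)}.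
Proof.
move=> ul rN rC; elim: l ul => [|i l IH] /=; first by exists (fun=> 0).
move=> /andP[il /[dup] ul /IH[w Hw]].
have [|g Hg] := @closed1_exact l (fun j => rho i j - spd i (w j)) ul.
  move=> j k jl kl; rewrite !raddfB /= (spdC j i) (spdC k i).
  have := rC i j k; rewrite (Hw j k jl kl) (rN k i) raddfB raddfN /= => /eqP.
  rewrite addrAC addr_eq0 opprK => /eqP <-; ring.
have ri : rho i i = 0.
  apply: sfun_evP => p Wp; have := congr1 (ev Wp) (rN i i); rewrite rmorphN rmorph0 /=; lra.
exists (fun j => if j == i then - g else w j) => j k; rewrite !inE.
have ne j' : j' \in l -> (j' == i) = false by move=> jl; apply: contraNF il => /eqP <-.
move=> /orP[/eqP ->|jl] /orP[/eqP ->|kl]; rewrite ?eqxx ?ne // ?subrr //.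
- by rewrite raddfN /= (Hg k kl) opprK; ring.
- by rewrite rN raddfN /= (Hg j jl); ring.
exact: Hw.
Qed.

End PoincareLemma.

Section Exponential.
Variables (R : realType) (n : nat) (W : domain R n).

Lemma is_derive_expR_comp (f : 'rV[R]_n.+1 -> R) p v : derivable f p v ->
  is_derive p v (expR \o f) (expR (f p) * 'D_v f p).
Proof.
move=> df; have D0 := @line_is_derive R n f p v 0.
rewrite scale0r add0r in D0; have {}D0 := D0 df.
have D1 : is_derive (0 : R) 1 (expR \o (fun s => f (s *: v + p))) (expR (f p) * 'D_v f p).
  have := @is_derive1_comp R expR (fun s => f (s *: v + p)) 0 _ _ (is_derive_expR _) D0.
  by rewrite scale0r add0r.
have E : (fun h : R => h^-1 *: (((expR \o (fun s => f (s *: v + p))) \o shift 0) (h *: 1) -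
      (expR \o (fun s => f (s *: v + p))) 0)) =
    (fun h => h^-1 *: (((expR \o f) \o shift p) (h *: v) - (expR \o f) p)).
  by apply/funext => h /=; rewrite [h%:A]mulr1 addr0 scale0r add0r.
have [d e] := D1; split; first by move: d; rewrite /derivable E.
by rewrite -e /derive E.
Qed.

Lemma expR_smooth (f : sfun W) : smooth_on W (expR \o f).
Proof.
elim=> [|m IH]; have cf : forall p, dom_set W p -> {for p, continuous (expR \o f)}.
- move=> p Wp; apply: continuous_comp; first by have [+ _] := sfun_smooth f 0%N; exact.
  exact: continuous_expR.
- by split.
- move=> p Wp; apply: continuous_comp; first by have [+ _] := sfun_smooth f 0%N; exact.
  exact: continuous_expR.
split=> // i; have [_ /(_ i)[df _]] := sfun_smooth f 1%N.
split=> [p Wp|]; first by have [] := is_derive_expR_comp (df p Wp).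
apply: (@Ck_on_congr _ _ _ _ (fun p => (expR \o f) p * pd i f p)); first exact: dom_open.
  by move=> q Wq; have [_ e] := is_derive_expR_comp (df q Wq); rewrite /pd e.
by apply: Ck_onM; [exact: dom_open|exact: IH|exact: pd_smooth (sfun_smooth f) m].
Qed.

Definition sexp f : sfun W := mk_sfun (expR_smooth f).

Lemma spd_sexp i f : spd i (sexp f) = sexp f * spd i f.
Proof.
apply: sfun_evP => p Wp; rewrite (@pd_sfun _ _ _ _ _ (expR \o f)) => [|q Wq]; last exact: ev_mk_sfun.
rewrite rmorphM /= ev_mk_sfun ev_spd.
by have [_ e] := is_derive_expR_comp (@sfun_derivable R n W i f p Wp); rewrite /pd e.
Qed.

Lemma ev_sexp_neq0 f p (Wp : dom_set W p) : ev Wp (sexp f) != 0.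
Proof. by rewrite ev_mk_sfun; apply: lt0r_neq0; exact: expR_gt0. Qed.

End Exponential.

(** * From Helmholtz forms to Lagrangians *)

Section Lagrangian.
Variables (R : realType) (V : domain R (3).*2).
Variables (F : 'I_2 -> sfun V) (rho : 'I_(jdim 2) -> 'I_(jdim 2) -> sfun V).
Variable Th : 'I_(jdim 2) -> sfun V.
Hypothesis rhoE : forall a b, rho a b = spd a (Th b) - spd b (Th a).
Hypothesis Th2 : forall i, Th (jy 2 i) = 0.
Hypothesis rho_sol : forall b, \sum_a sol F a * rho a b = 0.
Hypothesis rho22 : forall i j, rho (jy 2 i) (jy 2 j) = 0.
Hypothesis rho21 : forall i j, rho (jy 2 i) (jy 1 j) = 0.

Let y s i : sfun V := scoord V (jy s i).

(** The contraction of [Th] with the solution field; the terms with [F] are absent because [Th]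
    vanishes on V. *)
Definition lagrangian : sfun V :=
  Th jx + (\sum_i y 1 i * Th (jy 0 i) + \sum_i y 2 i * Th (jy 1 i)).

Let E (g : sfun V) : sfun V := spd jx g +
  (\sum_i y 1 i * spd (jy 0 i) g + \sum_i y 2 i * spd (jy 1 i) g).

(** Cartan's formula for the Lie derivative of [Th] along the solution field, which annihilates rho.
    [E] is that field without its [F] part. *)
Let spd_lag b : spd b lagrangian = \sum_i F i * rho (jy 2 i) b + E (Th b)
  + (\sum_i spd b (y 1 i) * Th (jy 0 i) + \sum_i spd b (y 2 i) * Th (jy 1 i)).
Proof.
have X1 r : \sum_i y r.+1 i * rho (jy r i) b =
    \sum_i y r.+1 i * spd (jy r i) (Th b) - \sum_i y r.+1 i * spd b (Th (jy r i)).
  by rewrite -sumrB; apply: eq_bigr => i _; rewrite rhoE mulrBr.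
have Y1 r : spd b (\sum_i y r.+1 i * Th (jy r i)) =
    \sum_i spd b (y r.+1 i) * Th (jy r i) + \sum_i y r.+1 i * spd b (Th (jy r i)).
  by rewrite raddf_sum -big_split; apply: eq_bigr => i _; exact: spdM.
have H : rho jx b + (\sum_i y 1 i * rho (jy 0 i) b + \sum_i y 2 i * rho (jy 1 i) b +
    \sum_i F i * rho (jy 2 i) b) = 0.
  rewrite -[RHS](rho_sol b) sum7 {1}/sol eqxx mul1r; congr (_ + (_ + _ + _));
    by apply: eq_bigr => i _; rewrite solE.
have {H}-> : \sum_i F i * rho (jy 2 i) b = - (rho jx b + (\sum_i y 1 i * rho (jy 0 i) b
    + \sum_i y 2 i * rho (jy 1 i) b)).
  by apply/eqP; rewrite -addr_eq0 -[X in _ == X]H; apply/eqP; ring.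
rewrite !X1 rhoE /lagrangian /E !raddfD /= !Y1; ring.
Qed.

Let spd_y b s i : (s <= 2)%N -> spd b (y s i) = (jy s i == b)%:R.
Proof. by move=> _; rewrite spd_scoord. Qed.

Let sum_jy r s j (G : 'I_2 -> sfun V) : (r <= 2)%N -> (s <= 2)%N ->
  \sum_i spd (jy r j) (y s i) * G i = if r == s then G j else 0.
Proof.
move=> r2 s2; under eq_bigr do rewrite spd_y // jy_eq // eq_sym.
by rewrite (sum_eqb (r == s) j G).
Qed.

Lemma spd_lag2 j : spd (jy 2 j) lagrangian = Th (jy 1 j).
Proof.
rewrite spd_lag !sum_jy //= Th2 add0r big1 => [|i _]; last by rewrite rho22 mulr0.
rewrite /E raddf0 big1 => [|i _]; last by rewrite raddf0 mulr0.
by rewrite big1 ?addr0 ?add0r // => i _; rewrite raddf0 mulr0.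
Qed.

Lemma spd_lag1 j : spd (jy 1 j) lagrangian = E (Th (jy 1 j)) + Th (jy 0 j).
Proof.
rewrite spd_lag !sum_jy //= big1 => [|i _]; last by rewrite rho21 mulr0.
by rewrite addr0 add0r.
Qed.

Lemma spd_lag0 j : spd (jy 0 j) lagrangian =
  \sum_i F i * rho (jy 2 i) (jy 0 j) + E (Th (jy 0 j)).
Proof. by rewrite spd_lag !sum_jy //= !addr0. Qed.

Let m2 : (2 <= 2 * 2)%N. Proof. by []. Qed.
Let W := jdom V m2.
Let pull : sfun V -> sfun W :=
  @spull R _ _ W V _ _ (jup_down m2) (fun z Wz => Wz).
Let Y s i : sfun W := scoord W (jy s i).

Definition total (f : sfun W) : sfun W :=
  spd jx f + \sum_(s < 2 * 2) \sum_(j < 2) Y s.+1 j * spd (jy s j) f.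

Lemma ev_total (f : sfun W) g : (forall z (Wz : dom_set W z), ev Wz f = g z) ->
  forall z (Wz : dom_set W z), ev Wz (total f) = Dx g z.
Proof.
move=> fg z Wz; rewrite rmorphD rmorph_sum /= (pd_sfun _ fg); congr (_ + _).
apply: eq_bigr => s _; rewrite rmorph_sum; apply: eq_bigr => j _.
by rewrite rmorphM /= (pd_sfun _ fg) ev_scoord.
Qed.

Let pd_pull r i f : (r <= 4)%N ->
  spd (jy r i) (pull f) = if (r <= 2)%N then pull (spd (jy r i) f) else 0.
Proof. by move=> r4; rewrite spd_spull jdown_jy //; case: ifP. Qed.

Let ev_pull z (Wz : dom_set W z) f : ev Wz (pull f) = ev (Wz : dom_set V (jtrunc 2 z)) f.
Proof. exact: ev_spull. Qed.

Let pullD : {morph pull : f g / f + g}.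
Proof. by move=> f g; apply: sfun_evP => z Wz; rewrite rmorphD /= !ev_pull rmorphD. Qed.
Let pullM : {morph pull : f g / f * g}.
Proof. by move=> f g; apply: sfun_evP => z Wz; rewrite rmorphM /= !ev_pull rmorphM. Qed.
Let pull_sum (G : 'I_2 -> sfun V) : pull (\sum_i G i) = \sum_i pull (G i).
Proof.
by apply: sfun_evP => z Wz; rewrite rmorph_sum ev_pull rmorph_sum; apply: eq_bigr => i _ /=; rewrite ev_pull.
Qed.
Let pull_y s i : (s <= 2)%N -> pull (y s i) = Y s i.
Proof.
by move=> s2; apply: sfun_evP => z Wz; rewrite ev_pull !ev_scoord jtrunc_jy.
Qed.

Let totalD f g : total (f + g) = total f + total g.
Proof.
rewrite /total raddfD /= addrACA -big_split; congr (_ + _); apply: eq_bigr => s _ /=.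
by rewrite -big_split; apply: eq_bigr => j _ /=; rewrite raddfD mulrDr.
Qed.

Lemma total_pull f : total (pull f) =
  pull (E f) + \sum_i Y 3 i * pull (spd (jy 2 i) f).
Proof.
have -> : total (pull f) = spd jx (pull f) + (\sum_i Y 1 i * spd (jy 0 i) (pull f)
   + \sum_i Y 2 i * spd (jy 1 i) (pull f) + \sum_i Y 3 i * spd (jy 2 i) (pull f)
   + \sum_i Y 4 i * spd (jy 3 i) (pull f)).
  pose G s := \sum_(j < 2) Y s.+1 j * spd (jy s j) (pull f).
  have G4 (H : nat -> sfun W) : \sum_(s < 4) H s = H 0%N + H 1%N + H 2%N + H 3%N.
    by rewrite !big_ord_recl big_ord0 addr0 /= !addrA.
  by rewrite /total (G4 G).
have -> : spd jx (pull f) = pull (spd jx f).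
  rewrite spd_spull; have := jup_down m2 jx jx.
  by rewrite (_ : jup _ jx = jx) ?eqxx; [move=> /esym/eqP ->|apply: val_inj; rewrite /= inordK].
rewrite [\sum_i Y 4 i * _]big1 => [|i _]; last by rewrite pd_pull // mulr0.
rewrite addr0 /E !pullD !pull_sum !addrA; congr (_ + _ + _ + _).
- by apply: eq_bigr => i _; rewrite pd_pull // pullM pull_y.
- by apply: eq_bigr => i _; rewrite pd_pull // pullM pull_y.
by apply: eq_bigr => i _; rewrite pd_pull.
Qed.

Let rho2 i b : rho (jy 2 i) b = spd (jy 2 i) (Th b).
Proof. by rewrite rhoE Th2 raddf0 subr0. Qed.

Lemma jtrunc22 (w : 'rV[R]_(jdim 2)) : jtrunc 2 w = w.
Proof. by apply/rowP => i; rewrite mxE inord_val. Qed.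

(** The momenta are the components of [Th]: dL/dy_2 is [Th] on d/dy_1 and, as rho vanishes on V and
    d/dy_1, dL/dy_1 minus its total derivative is [Th] on d/dy_0. In the last step only terms with
    y_3 - F survive. *)
Lemma euler_lagrangian z : dom_set V (jtrunc 2 z) -> forall j : 'I_2,
  euler_lagrange (k := 2) lagrangian j z =
  \sum_(i < 2) - rho (jy 2 i) (jy 0 j) (jtrunc 2 z) * (z 0 (jy 3 i) - F i (jtrunc 2 z)).
Proof.
move=> Vz j; have Wz : dom_set W z by [].
have ev0 s z' (Wz' : dom_set W z') : ev Wz' (spd (jy s j) (pull lagrangian)) =
    pd (jy s j) (lagrangian \o @jtrunc R (2 * 2) 2) z'.
  by apply: pd_sfun => {}z' {}Wz'; rewrite ev_pull.
have evt s n z' (Wz' : dom_set W z') : ev Wz' (iter n total (spd (jy s j) (pull lagrangian))) =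
    iter n (@Dx R (2 * 2)) (pd (jy s j) (lagrangian \o @jtrunc R (2 * 2) 2)) z'.
  by elim: n z' Wz' => [|n IH] z' Wz' /=; [exact: ev0|exact: ev_total].
have -> : euler_lagrange (k := 2) lagrangian j z =
    ev Wz (\sum_(s < 3) (-1) ^+ s * iter s total (spd (jy s j) (pull lagrangian))).
  rewrite rmorph_sum; apply: eq_bigr => s _.
  by rewrite rmorphM rmorphXn rmorphN rmorph1 /= evt.
rewrite (sum_ord3 (fun s => (-1) ^+ s * iter s total (spd (jy s j) (pull lagrangian)))) /=.
rewrite expr0 expr1 !mul1r sqrrN expr1n mul1r mulN1r.
have dl r : (r <= 2)%N -> spd (jy r j) (pull lagrangian) = pull (spd (jy r j) lagrangian).
  by move=> r2; rewrite pd_pull ?r2 // (leq_trans r2).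
rewrite !dl // spd_lag0 spd_lag1 spd_lag2.
have T1 : total (pull (Th (jy 1 j))) = pull (E (Th (jy 1 j))).
  by rewrite total_pull [X in _ + X]big1 ?addr0 // => i _; rewrite -rho2 rho21 -(mulr0 (Y 3 i));
     congr (_ * _); apply: sfun_evP => u Wu; rewrite ev_pull !rmorph0.
rewrite T1 (pullD _ (E (Th (jy 0 j)))) (pullD (E (Th (jy 1 j)))) totalD.
rewrite (total_pull (Th (jy 0 j))).
have -> (x y' z' t : sfun W) : x + y' - (z' + (y' + t)) + z' = x - t by ring.
rewrite pull_sum.
rewrite rmorphB !rmorph_sum -sumrB; apply: eq_bigr => i _ /=.
rewrite rmorphM /= !ev_pull rmorphM /= ev_scoord -rho2 /ev; ring.
Qed.

End Lagrangian.

Lemma helmholtz_variational (R : realType) (c : 'rV[R]_(jdim 2)) (r : R) (r0 : 0 < r)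
    (F : 'I_2 -> sfun (ball_domain c r0))
    (rho : 'I_(jdim 2) -> 'I_(jdim 2) -> sfun (ball_domain c r0)) :
  helmholtz_form F rho ->
  exists (B : 'rV[R]_(jdim 2) -> 'M[R]_2) (k : nat) (L : 'rV[R]_(jdim k) -> R),
    let V := dom_set (ball_domain c r0) in
    [/\ forall i j, smooth_on V (fun q => B q i j),
        forall q, V q -> B q \in unitmx,
        (2 <= k)%N,
        smooth_on [set w | V (@jtrunc R k 2 w)] L
      & forall z : 'rV[R]_(jdim (2 * k)), V (jtrunc 2 z) ->
          forall j, euler_lagrange L j z =
            \sum_(i < 2) B (jtrunc 2 z) i j *
                         (z 0 (jy 3 i) - F i (jtrunc 2 z))].
Proof.
move=> [rN rC rsol r2 runit].
have [th Hth] := closed2_exact (enum_uniq 'I_(jdim 2)) rN rC.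
pose l2 : seq 'I_(jdim 2) := [:: jy 2 0; jy 2 1].
(* rho vanishes on V x V, so its potential is closed along V; subtracting the differential of [g]
   makes the potential vanish on V. *)
have [||g Hg] := @closed1_exact R _ c r r0 l2 th.
- by rewrite /l2 /= inE jy_eq.
- have : forall i j, spd (jy 2 i) (th (jy 2 j)) = spd (jy 2 j) (th (jy 2 i)).
    move=> i j; apply/eqP; rewrite -subr_eq0 -Hth ?mem_enum //.
    by have [-> _] := r2 i j.
  by move=> H a b; rewrite !inE => /orP[] /eqP -> /orP[] /eqP ->; exact: H.
pose Th a := th a - spd a g.
have rhoE a b : rho a b = spd a (Th b) - spd b (Th a).
  by rewrite (Hth a b) ?mem_enum // /Th !raddfB /= (spdC a b); ring.
have Th2 i : Th (jy 2 i) = 0.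
  rewrite /Th Hg ?subrr // !inE.
  by case: i => [[|[|//]]] h; apply/orP; [left|right]; apply/eqP; congr jy; exact: val_inj.
have rho_sol b : \sum_a sol F a * rho a b = 0.
  apply: sfun_evP => p Wp; rewrite rmorph_sum rmorph0 -[RHS](rsol p Wp b).
  by apply: eq_bigr => a _; rewrite rmorphM /= ev_sol.
exists (fun q => \matrix_(i, j) - rho (jy 2 i) (jy 0 j) q), 2%N, (lagrangian Th) => V; split=> //.
- move=> i j; rewrite (_ : (fun q => _) = (fun q => - rho (jy 2 i) (jy 0 j) q)); last first.
    by apply/funext => q; rewrite mxE.
  move=> m; apply: (@Ck_on_congr _ _ _ _ (- rho (jy 2 i) (jy 0 j) : sfun _)); first exact: ball_open.
    by move=> q Vq; rewrite -[LHS]/(@ev R _ (ball_domain c r0) q Vq _) rmorphN.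
  exact: sfun_smooth.
- move=> q Vq; have := runit q Vq; rewrite -(unitmxZ _ (a := -1)) ?unitrN1 // scaleN1r.
  set M := - _; rewrite (_ : M = \matrix_(i, j) - rho (jy 2 i) (jy 0 j) q) //.
  by apply/matrixP => i j; rewrite !mxE.
- rewrite (_ : [set w | _] = dom_set (ball_domain c r0)); first exact: sfun_smooth.
  by apply/seteqP; split=> w /=; rewrite jtrunc22.
move=> z Vz j; rewrite (euler_lagrangian rhoE Th2 rho_sol) //.
- by apply: eq_bigr => i _; rewrite mxE.
- by move=> i' j'; have [] := r2 i' j'.
by move=> i' j'; have [] := r2 i' j'.
Qed.

(** * Gauges of the Cartan connection *)

Section KmxLinear.
Variable R : realType.

Lemma kmx_is_linear (a : R) (x y : 'rV[R]_13) : kmx (a *: x + y) = a *: kmx x + kmx y.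
Proof.
have E f : (a *: x + y) 0 f = a * x 0 f + y 0 f by rewrite !mxE.
rewrite /kmx /= !E.
move: (x 0 om1) (x 0 om2) (x 0 om3) (x 0 th1) (x 0 th2) (x 0 th3) (x 0 th0)
  (x 0 ph0) (x 0 ph1) (x 0 ph2) (x 0 xi0) (x 0 om0) (x 0 ga0)
  (y 0 om1) (y 0 om2) (y 0 om3) (y 0 th1) (y 0 th2) (y 0 th3) (y 0 th0)
  (y 0 ph0) (y 0 ph1) (y 0 ph2) (y 0 xi0) (y 0 om0) (y 0 ga0).
move=> x1 x2 x3 x4 x5 x6 x7 x8 x9 x10 x11 x12 x13 y1 y2 y3 y4 y5 y6 y7 y8 y9 y10 y11 y12 y13.
apply/matrixP => i j; rewrite !mxE.
by case: i => -[|[|[|[|[|//]]]]] h /=; case: j => -[|[|[|[|[|//]]]]] h' /=; ring.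
Qed.

Lemma kmx0 : kmx (0 : 'rV[R]_13) = 0.
Proof. by have := kmx_is_linear (-1) 0 0; rewrite scaler0 addr0 scaleN1r addNr. Qed.

Lemma kmx_basis (x : 'rV[R]_13) i j : kmx x i j = \sum_f x 0 f * kmx (kbasis R f) i j.
Proof.
transitivity (kmx (\sum_f x 0 f *: kbasis R f) i j); first by rewrite -row_sum_delta.
have -> (s : seq 'I_13) : kmx (\sum_(f <- s) x 0 f *: kbasis R f) i j =
    \sum_(f <- s) x 0 f * kmx (kbasis R f) i j; last by [].
elim: s => [|f s IH]; first by rewrite !big_nil kmx0 mxE.
by rewrite !big_cons kmx_is_linear mxE mxE IH.
Qed.

Lemma kcoordD (Y Z : 'M[R]_5) : kcoord (Y + Z) = kcoord Y + kcoord Z.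
Proof.
by apply/rowP => a; rewrite !mxE; move: a; apply: kidx_ind => /=; ring.
Qed.

End KmxLinear.

Section GaugeFrame.
Variables (R : realType) (W : domain R 6) (psi : kform R).
Hypothesis psi_smooth : forall a b, smooth_on W (fun p => psi p a b).
Hypothesis coframe_unit : forall p, dom_set W p -> coframe psi p \in unitmx.

Definition gauge_mx : 'M[sfun W]_(7, 7 + 6) := \matrix_(i, b) mk_sfun (psi_smooth i b).
Definition coframe_mx : 'M[sfun W]_7 := lsubmx gauge_mx.
Definition frame_mx : 'M[sfun W]_(7 + 6, 7) := col_mx (invmx coframe_mx) 0.
Definition Pc (i : 'I_7) (f : kidx) : sfun W := gauge_mx i f.
Definition Xc (a : kidx) (i : 'I_7) : sfun W := frame_mx a i.
Definition dc (i : 'I_7) : {additive sfun W -> sfun W} := spd i.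

Lemma ev_Pc p (Wp : dom_set W p) i f : ev Wp (Pc i f) = psi p i f.
Proof. by rewrite /Pc mxE ev_mk_sfun. Qed.

Lemma map_coframe p (Wp : dom_set W p) : map_mx (ev Wp) coframe_mx = coframe psi p.
Proof. by apply/matrixP => i j; rewrite !mxE ev_mk_sfun. Qed.

Lemma coframe_mx_unit : coframe_mx \in unitmx.
Proof.
rewrite unitmxE; apply/sfun_unitE => p Wp.
change (ev Wp (\det coframe_mx) != 0); rewrite -det_map_mx map_coframe.
by rewrite -unitfE -unitmxE; exact: coframe_unit.
Qed.

Lemma map_inv_coframe p (Wp : dom_set W p) :
  map_mx (ev Wp) (invmx coframe_mx) = invmx (coframe psi p).
Proof.
have E : coframe psi p *m map_mx (ev Wp) (invmx coframe_mx) = 1%:M.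
  by rewrite -(map_coframe Wp) -map_mxM mulmxV ?coframe_mx_unit // map_mx1.
by rewrite -[RHS]mulmx1 -E mulKmx // coframe_unit.
Qed.

Lemma ev_Xc p (Wp : dom_set W p) a i : ev Wp (Xc a i) = dual_frame psi p a i.
Proof.
have -> : ev Wp (Xc a i) = (map_mx (ev Wp) frame_mx) a i by rewrite mxE.
by rewrite /frame_mx map_col_mx map_inv_coframe map_mx0.
Qed.

Lemma ord13P (a : kidx) : (exists j : 'I_7, a = lshift 6 j) \/ (exists j : 'I_6, a = rshift 7 j).
Proof.
by case: (splitP (a : 'I_(7 + 6))) => j aj; [left|right]; exists j; exact: val_inj.
Qed.

Lemma Xc_out a i : ~~ isneg a -> Xc a i = 0.
Proof.
have [[j ->]|[j ->]] := ord13P a; first by rewrite /isneg /= ltn_ord.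
by move=> _; rewrite /Xc /frame_mx col_mxEd mxE.
Qed.

Lemma negP7 a : isneg a -> exists j : 'I_7, a = lshift 6 j.
Proof. by have [//|[j ->]] := ord13P a; rewrite /isneg. Qed.

Lemma Xc_Pc a b : isneg a -> isneg b -> ct1 (fun i => Pc i b) (Xc a) = (a == b)%:R.
Proof.
move=> /negP7[j ->] /negP7[k ->].
transitivity ((invmx coframe_mx *m coframe_mx) j k).
  by rewrite mxE; apply: eq_bigr => i _; rewrite /Xc /frame_mx col_mxEu /Pc [coframe_mx i k]mxE.
by rewrite mulVmx ?coframe_mx_unit // mxE.
Qed.

Lemma Pc_Xc i j : \sum_b Pc i b * Xc b j = (i == j)%:R.
Proof.
rewrite -[LHS]/(\sum_(b < 7 + 6) Pc i b * Xc b j) big_split_ord /= [X in _ + X]big1 ?addr0.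
  transitivity ((coframe_mx *m invmx coframe_mx) i j).
    by rewrite mxE; apply: eq_bigr => k _; rewrite /Xc /frame_mx col_mxEu /Pc [coframe_mx i k]mxE.
  by rewrite mulmxV ?coframe_mx_unit // mxE.
by move=> k _; rewrite Xc_out ?mulr0.
Qed.

Lemma pd_kmx p (Wp : dom_set W p) i j a b :
  pd i (fun q => kmx (row j (psi q)) a b) p =
  kmx (\row_f pd i (fun q => psi q j f) p) a b.
Proof.
pose k f : sfun W := mk_sfun (fun m => @Ck_on_cst _ _ m W (kmx (kbasis R f) a b)).
have dk f : spd i (k f) = 0.
  apply: sfun_evP => q Wq; rewrite (@pd_sfun _ _ _ _ _ (fun=> kmx (kbasis R f) a b)).
    by rewrite rmorph0; have [_] := is_derive_cst (kmx (kbasis R f) a b) q (delta_mx 0 i : 'rV[R]_7).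
  by move=> u Wu; exact: ev_mk_sfun.
rewrite -(@pd_sfun _ _ W i (\sum_f Pc j f * k f) _ _ p Wp); last first.
  move=> q Wq; rewrite kmx_basis rmorph_sum; apply: eq_bigr => f _.
  by rewrite rmorphM /= ev_Pc ev_mk_sfun [row j _ _ _]mxE.
rewrite kmx_basis raddf_sum rmorph_sum; apply: eq_bigr => f _ /=.
rewrite spdM dk mulr0 addr0 rmorphM /=; congr (_ * _); last exact: ev_mk_sfun.
transitivity (pd i (fun q => psi q j f) p); last by rewrite mxE.
exact: (@pd_sfun _ _ W i (Pc j f) (fun q => psi q j f) (fun q Wq => ev_Pc Wq j f) p Wp).
Qed.

Lemma ev_Om p (Wp : dom_set W p) i j f :
  ev Wp (Om dc Pc i j f) = kcoord (curvature_mx psi p i j) 0 f.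
Proof.
have ev_d a b g : ev Wp (spd a (Pc b g)) = pd a (fun q => psi q b g) p.
  exact: (@pd_sfun _ _ W a (Pc b g) (fun q => psi q b g) (fun q Wq => ev_Pc Wq b g) p Wp).
rewrite /curvature_mx kcoordD -/(kbr (row i (psi p)) (row j (psi p))) mxE kbr_brk /Om.
rewrite rmorphD rmorphB /= !ev_d; congr (_ + _).
  have -> : (\matrix_(a, b) (pd i (fun q => kmx (row j (psi q)) a b) p -
        pd j (fun q => kmx (row i (psi q)) a b) p)) =
      kmx ((-1) *: (\row_g pd j (fun q => psi q i g) p) + \row_g pd i (fun q => psi q j g) p).
    apply/matrixP => a b; rewrite kmx_is_linear [RHS]mxE [X in _ = X + _]mxE [LHS]mxE.
    by rewrite !pd_kmx // mulN1r addrC.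
  by rewrite kmxK !mxE mulN1r addrC.
rewrite !brkE rmorph_sum; apply: eq_bigr => a _; rewrite rmorph_sum; apply: eq_bigr => b _.
by rewrite !rmorphM /= rmorph_int !ev_Pc !mxE.
Qed.

Lemma ev_KK p (Wp : dom_set W p) a b f :
  ev Wp (KK dc Pc Xc a b f) = curvature psi p a b 0 f.
Proof.
rewrite /curvature summxE rmorph_sum; apply: eq_bigr => i _.
rewrite summxE rmorphM /= rmorph_sum mulr_sumr; apply: eq_bigr => j _.
by rewrite rmorphM /= !ev_Xc ev_Om [RHS]mxE mulrA.
Qed.

Lemma ev_keval p (Wp : dom_set W p) l (K : kidx -> kidx -> kidx -> sfun W) :
  ev Wp (keval l K) = keval l (fun a b c => ev Wp (K a b c)).
Proof.
rewrite rmorph_sum; apply: eq_bigr => a _; rewrite rmorph_sum; apply: eq_bigr => b _.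
rewrite rmorph_sum; apply: eq_bigr => c _ /=; by rewrite rmorphM /= rmorph_int.
Qed.

(** The elimination argument needs a field, which the ring of functions is not; evaluation at each
    point provides one. *)
Lemma sfun_lin h rows ts (K : kidx -> kidx -> kidx -> sfun W) :
  (forall a b c, K a b c = - K b a c) ->
  (forall a b c, ~~ isneg a -> K a b c = 0) ->
  consequence h rows ts ->
  (forall l, List.In l rows -> keval l K = 0) ->
  forall t, List.In t ts -> keval t K = 0.
Proof.
move=> KN K0 H Hrows t tts; apply: sfun_evP => p Wp; rewrite ev_keval rmorph0.
apply: (consequenceP _ _ H _ tts) => [a b c|a b c na|l lr].
- by rewrite KN rmorphN.
- by rewrite K0 // rmorph0.
by rewrite -ev_keval Hrows // rmorph0.
Qed.

Lemma sfun_tf2 (x : sfun W) : x = - x -> x = 0.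
Proof.
move=> E; apply: sfun_evP => p Wp; have := congr1 (ev Wp) E; rewrite rmorphN rmorph0 /=; lra.
Qed.

Lemma sfun_tf3 (x : sfun W) : x + x + x = 0 -> x = 0.
Proof.
move=> E; apply: sfun_evP => p Wp; have := congr1 (ev Wp) E; rewrite !rmorphD !rmorph0 /=; lra.
Qed.

Lemma dcM i f g : dc i (f * g) = dc i f * g + f * dc i g. Proof. exact: spdM. Qed.
Lemma dcC i j f : dc i (dc j f) = dc j (dc i f). Proof. exact: spdC. Qed.

Lemma gauge_regular :
  (forall p, dom_set W p -> forall a b c, curvature psi p a b 0 c != 0 -> kdeg a + kdeg b < kdeg c) ->
  forall a b f, kdeg f <= kdeg a + kdeg b -> KK dc Pc Xc a b f = 0.
Proof.
move=> reg a b f df; apply: sfun_evP => p Wp; rewrite ev_KK rmorph0; apply/eqP.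
by apply: contraTT df => /(reg p Wp); rewrite -ltNge.
Qed.

Lemma gauge_normal ds : kadjoint ds -> (forall p, dom_set W p -> ds (curvature psi p) = 0) ->
  forall r s, keval (normal_form r s) (KK dc Pc Xc) = 0.
Proof.
move=> adj nds r s; apply: sfun_evP => p Wp; rewrite ev_keval rmorph0.
rewrite (_ : (fun a b c => _) = (fun a b c => curvature psi p a b 0 c)); last first.
  by apply/funext => a; apply/funext => b; apply/funext => c; exact: ev_KK.
apply: (normal_keval r s adj (nds p Wp)) => a b nab; apply/rowP => c.
rewrite -(ev_KK Wp) [RHS]mxE; move: nab; rewrite negb_and => /orP[na|nb].
  by rewrite KK_out ?rmorph0 //; exact: Xc_out.
by rewrite KKN KK_out ?oppr0 ?rmorph0 //; exact: Xc_out.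
Qed.

End GaugeFrame.

Lemma forall_In (T : Type) (Q : T -> Prop) s :
  foldr (fun x q => Q x /\ q) True s -> forall x, List.In x s -> Q x.
Proof. by elim: s => //= y s IH [Qy /IH H] x [<-|/H]. Qed.

(** * Both implications in a single gauge *)

Section OdeFrame.
Variables (R : realType) (W : domain R (3).*2) (psi : kform R).
Variables (F : 'I_2 -> 'rV[R]_7 -> R) (Fs : 'I_2 -> sfun W).
Hypothesis psi_smooth : forall a b, smooth_on W (fun p => psi p a b).
Hypothesis coframe_unit : forall p, dom_set W p -> coframe psi p \in unitmx.
Hypothesis FsE : forall i p, dom_set W p -> Fs i p = F i p.
Hypothesis line_field : forall p, dom_set W p ->
  (solution_vector F p == row th0 (dual_frame psi p))%MS.
Hypothesis vertical_field : forall p, dom_set W p ->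
  (vertical_vectors R == row om1 (dual_frame psi p) + row th1 (dual_frame psi p))%MS.
Hypothesis psi_regular : forall p, dom_set W p -> forall a b c,
  curvature psi p a b 0 c != 0 -> kdeg a + kdeg b < kdeg c.
Hypothesis psi_normal : exists2 ds, kadjoint ds &
  forall p, dom_set W p -> ds (curvature psi p) = 0.

Notation J s i := (@jy 2 s i).
Let P := Pc psi_smooth.
Let X := Xc psi_smooth.
Let d := @dc R W.
Let K := KK d P X.

Let X_out := Xc_out psi_smooth.
Let XP := Xc_Pc psi_smooth coframe_unit.
Let PX := Pc_Xc psi_smooth coframe_unit.
Let dM := @dcM R W.
Let dC := @dcC R W.
Let regular : forall a b f, kdeg f <= kdeg a + kdeg b -> K a b f = 0 :=
  gauge_regular psi_smooth coframe_unit psi_regular.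
Let normal : forall r s, keval (normal_form r s) K = 0.
Proof. by have [ds adj nds] := psi_normal; exact: gauge_normal adj nds. Qed.
Let lin := @sfun_lin R W.
Let tf2 := @sfun_tf2 R W.
Let tf3 := @sfun_tf3 R W.

Lemma solution_vector_ext p : dom_set W p -> solution_vector Fs p = solution_vector F p.
Proof.
move=> Wp; rewrite /solution_vector; congr (_ + _); apply: eq_bigr => i _.
by rewrite FsE.
Qed.

Let ev_XP p (Wp : dom_set W p) a b : isneg a -> isneg b ->
  \sum_i dual_frame psi p a i * psi p i b = (a == b)%:R.
Proof.
move=> na nb; have := congr1 (ev Wp) (XP na nb).
rewrite rmorph_nat rmorph_sum => <-; apply: eq_bigr => i _.
by rewrite rmorphM /= ev_Xc // ev_Pc.
Qed.

Let sl := sol Fs.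
Let sl_x : sl jx = 1. Proof. by rewrite /sl /sol eqxx. Qed.
Let d_sl0 j i : d j (sl (J 0 i)) = (J 1 i == j)%:R.
Proof. by rewrite /sl solE // /d /dc /= spd_scoord. Qed.
Let d_sl1 j i : d j (sl (J 1 i)) = (J 2 i == j)%:R.
Proof. by rewrite /sl solE // /d /dc /= spd_scoord. Qed.
Let ev_sl p (Wp : dom_set W p) a : ev Wp (sl a) = solution_vector F p 0 a.
Proof. by rewrite ev_sol solution_vector_ext. Qed.

(** The factor between the solution field, normalised by its x-component, and [X th0]. *)
Let c := ct1 (fun i => P i th0) sl.

Let sl_X j : sl j = c * X th0 j.
Proof.
apply: sfun_evP => p Wp; have /andP[/sub_rVP[a E] _] := line_field Wp.
have El i : ev Wp (sl i) = a * dual_frame psi p th0 i by rewrite ev_sl E !mxE.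
rewrite rmorphM /= El ev_Xc //; congr (_ * _).
rewrite /c /ct1 rmorph_sum -[LHS]mulr1.
have <- : \sum_i dual_frame psi p th0 i * psi p i th0 = 1 by rewrite ev_XP // eqxx.
by rewrite mulr_sumr; apply: eq_bigr => i _; rewrite rmorphM /= El ev_Pc mulrA.
Qed.

Let P_vert i b : isneg b -> b \notin [:: om1; th1] -> P (J 2 i) b = 0.
Proof.
move=> nb bV; apply: sfun_evP => p Wp; rewrite ev_Pc rmorph0.
have /andP[sV _] := vertical_field Wp.
have /sub_addsmxP[[u v] /= E] : (row i (vertical_vectors R) <=
    row om1 (dual_frame psi p) + row th1 (dual_frame psi p))%MS.
  exact: submx_trans (row_sub _ _) sV.
have psiE (w : 'rV[R]_7) : (w *m psi p) 0 b = \sum_j w 0 j * psi p j b by rewrite mxE.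
have rowE a : isneg a -> (row a (dual_frame psi p) *m psi p) 0 b = (a == b)%:R.
  by move=> na; rewrite psiE -(ev_XP Wp na nb); apply: eq_bigr => j _; rewrite mxE.
have E1 : (row i (vertical_vectors R) *m psi p) 0 b = psi p (J 2 i) b.
  rewrite psiE -[RHS](sum_delta (J 2 i) (fun j => psi p j b)); apply: eq_bigr => j _.
  by congr (_ * _); rewrite !mxE eqxx /= eq_sym.
rewrite -E1 E mulmxDl -!mulmxA mxE ![(_ *m (row _ _ *m _)) _ _]mxE !big_ord1 !rowE //.
move: bV; rewrite !inE negb_or => /andP[b1 b2].
by rewrite ![_ == b]eq_sym (negbTE b1) (negbTE b2) !mulr0 addr0.
Qed.

Let X_vert u : u \in [:: om1; th1] ->
  [/\ X u (@jx 2) = 0, forall i, X u (J 0 i) = 0 & forall i, X u (J 1 i) = 0].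
Proof.
move=> uV; have Z j : (forall i, (J 2 i == j) = false) -> X u j = 0.
  move=> jV; apply: sfun_evP => p Wp; rewrite ev_Xc // rmorph0.
  have /andP[_ sV] := vertical_field Wp.
  have /submxP[D E] : (row u (dual_frame psi p) <= vertical_vectors R)%MS.
    by apply: submx_trans sV; move: uV; rewrite !inE => /orP[] /eqP ->;
      [exact: addsmxSl|exact: addsmxSr].
  have -> : dual_frame psi p u j = (row u (dual_frame psi p)) 0 j by rewrite [RHS]mxE.
  rewrite E mxE big1 // => i _; rewrite [vertical_vectors R _ _]mxE [delta_mx _ _ _ _]mxE eqxx.
  by rewrite /= eq_sym jV mulr0.
split=> [|i|i]; apply: Z => k.
- by rewrite eq_sym; exact: (@jx_jy 2 k).
- exact: (@jy_eq 2 2 k 0 i isT isT).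
exact: (@jy_eq 2 2 k 1 i isT isT).
Qed.

Definition invariants_vanish p :=
  [/\ [/\ b10 psi p = 0, b11 psi p = 0, b12 psi p = 0 & b13 psi p = 0],
      [/\ b20 psi p = 0, b21 psi p = 0 & b22 psi p = 0] & b30 psi p = 0].

Let ev_K p (Wp : dom_set W p) a b f : ev Wp (K a b f) = curvature psi p a b 0 f.
Proof. exact: ev_KK. Qed.

Let b3_formE : keval b3_form K = K om3 th0 om1 - K th0 th3 th1.
Proof. by rewrite (kevalD (unit_form om3 th0 om1)) kevalN !keval_unit. Qed.

Lemma multiplier_necessary (rho : 'I_(jdim 2) -> 'I_(jdim 2) -> sfun W) : helmholtz_form F rho ->
  forall p, dom_set W p -> invariants_vanish p.
Proof.
move=> [rN rC rsol r2 runit].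
have rho_sol b : \sum_a sl a * rho a b = 0.
  apply: sfun_evP => p Wp; rewrite rmorph_sum rmorph0 -[RHS](rsol p Wp b).
  by apply: eq_bigr => a _; rewrite rmorphM /= ev_sl.
have r22 i j : rho (J 2 i) (J 2 j) = 0 by have [] := r2 i j.
have r21 i j : rho (J 2 i) (J 1 j) = 0 by have [] := r2 i j.
pose m := multiplier X rho.
have rE : forall i j, rho i j = m * rh P i j.
  exact: (rho_multiplier dM dC X_out XP PX regular lin tf2 tf3 normal sl_x d_sl0
    sl_X X_vert rN rC rho_sol r22 r21).
(* At a zero of the multiplier the pairing of V with d/dy_0 would vanish. *)
have m0 p (Wp : dom_set W p) : ev Wp m != 0.
  apply/negP => /eqP m0; have := runit p Wp.
  have -> : \matrix_(i < 2, j < 2) ev Wp (rho (J 2 i) (J 0 j)) = 0.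
    by apply/matrixP => i j; rewrite !mxE rE rmorphM /= m0 mul0r.
  by rewrite unitmxE det0 unitr0.
(* On isotropic triples the nowhere zero multiplier cancels; the primitive components and the
   component giving b_3 are of this kind. *)
have T0 a b e : sympz a b = 0 -> sympz b e = 0 -> sympz e a = 0 -> Tor d P X a b e = 0.
  move=> z1 z2 z3; apply: sfun_evP => p Wp; rewrite rmorph0.
  have := multiplier_Tor dM dC X_out XP PX regular lin tf2 tf3 normal sl_x d_sl0
    sl_X X_vert rN rC rho_sol r22 r21 z1 z2 z3.
  move=> /(congr1 (ev Wp)); rewrite rmorphM rmorph0 => /eqP.
  by rewrite mulf_eq0 (negbTE (m0 p Wp)) => /eqP.
have b12_0 t : List.In t b12_forms -> keval t K = 0.
  apply: (lin_KK X_out lin consequence_2') => l lr; case: (In_cat lr) => lr'.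
    exact: (rows_vanish dM dC X_out XP PX regular normal _
      (KK_below2 dM dC X_out XP PX regular lin tf2 normal)).
  move: l lr' {lr}; apply: (forall_In (Q := fun t => keval t K = 0)).
  by do 7![split; first exact: T0].
have T1 : keval b3_form K = 0.
  by apply/eqP; rewrite -oppr_eq0 -Tor_b3; apply/eqP; exact: T0.
move=> p Wp; have Zu a b f : keval (unit_form a b f) K = 0 -> curvature psi p a b 0 f = 0.
  by rewrite keval_unit -(ev_K Wp) => ->; rewrite rmorph0.
have [Z1 [Z2 [Z3 [Z4 [Z5 [Z6 [Z7 _]]]]]]] : foldr (fun x q => keval x K = 0 /\ q) True b12_forms.
  by move: b12_0; rewrite /b12_forms /= => H; do 7![split; first by apply: H; tauto].
split.
- by rewrite /b10 /b11 /b12 /b13 !(Zu _ _ _ Z1, Zu _ _ _ Z2, Zu _ _ _ Z3, Zu _ _ _ Z4) oppr0.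
- by rewrite /b20 /b21 /b22 !(Zu _ _ _ Z5, Zu _ _ _ Z6, Zu _ _ _ Z7) oppr0.
by rewrite /b30 -!(ev_K Wp) -rmorphB -b3_formE T1 rmorph0.
Qed.

(** Exactness of closed 1-forms is a hypothesis because it depends on the shape of the domain. *)
Lemma invariants_sufficient : (forall p, dom_set W p -> invariants_vanish p) ->
  (forall w : 'I_7 -> sfun W, (forall i j, spd i (w j) = spd j (w i)) ->
     exists f, forall i, spd i f = w i) ->
  exists rho : 'I_(jdim 2) -> 'I_(jdim 2) -> sfun W, helmholtz_form Fs rho.
Proof.
move=> inv exact1.
have Ku a b f : (forall p, dom_set W p -> curvature psi p a b 0 f = 0) ->
    keval (unit_form a b f) K = 0.
  by move=> H; rewrite keval_unit; apply: sfun_evP => p Wp; rewrite ev_K H ?rmorph0.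
have b12_0 t : List.In t b12_forms -> keval t K = 0.
  have opp0 (x : R) : - x = 0 -> x = 0 by move=> /eqP; rewrite oppr_eq0 => /eqP.
  move: t; apply: (forall_In (Q := fun t => keval t K = 0)).
  split; first by apply: Ku => p /inv[[/opp0]].
  split; first by apply: Ku => p /inv[[_ /opp0]].
  split; first by apply: Ku => p /inv[[_ _ /opp0]].
  split; first by apply: Ku => p /inv[[]].
  split; first by apply: Ku => p /inv[_ []].
  split; first by apply: Ku => p /inv[_ [_ /opp0]].
  by split=> //; apply: Ku => p /inv[_ []].
have b3_0 : keval b3_form K = 0.
  rewrite b3_formE; apply: sfun_evP => p Wp; rewrite rmorphB /= !ev_K rmorph0.
  by have [_ _ b3] := inv p Wp.
have ph1C := ph1_closed dM dC X_out XP PX regular lin tf2 normal b12_0 b3_0.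
have NhE := Nh_wedge dM dC X_out XP PX regular lin tf2 normal b12_0 b3_0.
have [|f Hf] := exact1 (fun i => - P i ph1).
  by move=> i j; rewrite !raddfN; congr (- _); exact: ph1C.
pose lam := sexp f; exists (fun i j => lam * rh P i j).
have dlam i : spd i lam = - (lam * P i ph1) by rewrite spd_sexp Hf mulrN.
split.
- by move=> a b; rewrite rhN mulrN.
- move=> a b e; rewrite !spdM !dlam; have := NhE a b e; rewrite /Nh /d /dc /= => E.
  rewrite -[RHS](mulr0 lam) -[X in _ = lam * X](subrr (P a ph1 * rh P b e + P b ph1 * rh P e a + P e ph1 * rh P a b)).
  by rewrite -{1}E; ring.
- move=> p Wp b; rewrite (_ : \sum_a _ = ev Wp (lam * \sum_a sl a * rh P a b)).
    by rewrite (rh_sol X_out XP PX sl_X) mulr0 rmorph0.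
  rewrite mulr_sumr rmorph_sum; apply: eq_bigr => a _.
  by rewrite !rmorphM /= ev_sol mulrCA.
- move=> i j; rewrite (rh22 P_vert).
  by rewrite (rh21 dM X_out XP PX regular sl_x d_sl0 d_sl1 sl_X P_vert) mulr0.
move=> p Wp; have [N MN] := rh_nondegenerate dM X_out XP PX regular sl_x d_sl0 d_sl1 sl_X P_vert.
have E : map_mx (ev Wp) (\matrix_(i, j) rh P (J 2 i) (J 0 j)) *m map_mx (ev Wp) N = 1%:M.
  by rewrite -map_mxM MN map_mx1.
have [uM _] := mulmx1_unit E.
rewrite (_ : \matrix_(i, j) _ = ev Wp lam *: map_mx (ev Wp) (\matrix_(i, j) rh P (J 2 i) (J 0 j))).
  by rewrite unitmxZ ?unitfE ?ev_sexp_neq0.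
by apply/matrixP => i j; rewrite !mxE rmorphM.
Qed.

End OdeFrame.

Lemma variational_subset (R : realType) (U U' : set 'rV[R]_(jdim 2)) F :
  open U' -> U' `<=` U -> variational U F -> variational U' F.
Proof.
move=> oU' U'U vF p U'p; have [V [B [k [L [[oV Vp VU] [sB uB k2 sL EL]]]]]] := vF p (U'U _ U'p).
exists (V `&` U'), B, k, L; split; first by split; [exact: openI|split|move=> q []].
split=> //.
- by move=> i j m; apply: Ck_on_sub (sB i j m) => q [].
- by move=> q [Vq _]; exact: uB.
- by move=> m; apply: Ck_on_sub (sL m) => q [].
by move=> z [Vz _]; exact: EL.
Qed.

Theorem proposition5p8 (R : realType) (U : set 'rV[R]_7)
    (F : 'I_2 -> 'rV[R]_7 -> R) (G : cartan_geometry U) :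
  open U -> (forall i, smooth_on U (F i)) ->
  cg_of_ode F G -> cg_regular G -> cg_normal G ->
  (variational U F <->
   forall (i : cg_index G) (p : 'rV[R]_7), cg_dom i p ->
     let psi := cg_gauge i in
     [/\ [/\ b10 psi p = 0, b11 psi p = 0, b12 psi p = 0 & b13 psi p = 0],
         [/\ b20 psi p = 0, b21 psi p = 0 & b22 psi p = 0]
       & b30 psi p = 0]).
Proof.
move=> oU sF ode reg [ds adj nds].
have domU (i : cg_index G) : cg_dom i `<=` U.
  by move=> p ip; rewrite -(cg_cover G); exists i.
have data (i : cg_index G) (W : domain R (3).*2) (WU : dom_set W `<=` cg_dom i) :
  [/\ forall a b, smooth_on W (fun p => cg_gauge i p a b),
      forall p, dom_set W p -> coframe (cg_gauge i) p \in unitmx &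
      forall j, smooth_on W (F j)].
  split=> [a b m|p /WU|j m]; [|exact: cg_coframe|].
    exact: Ck_on_sub WU (@cg_smooth _ _ G i a b m).
  by apply: Ck_on_sub (sF j m) => q /WU /domU.
split=> [vF i p ip|inv p Up].
  have sFi j : smooth_on (cg_dom i) (F j) by move=> m; exact: Ck_on_sub (domU i) (sF j m).
  have [W [rho [Wp WU rhoF]]] :=
    variational_helmholtz sFi (variational_subset (@cg_open _ _ G i) (domU i) vF) ip.
  have [sp cu sFW] := data i W WU.
  apply: (@multiplier_necessary R W (cg_gauge i) F (fun j => mk_sfun (sFW j)) sp cu _ _ _ _ _ rho) => //.
  - by move=> j q Wq; rewrite mk_sfunE.
  - by move=> q /WU /ode[].
  - by move=> q /WU /ode[].
  - by move=> q /WU; exact: reg.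
  by exists ds => // q /WU; exact: nds.
have : (\bigcup_i cg_dom (c := G) i) p by rewrite cg_cover.
move=> [i _ ip].
(* Variationality is local, so a ball inside one gauge domain suffices, and there the Poincare lemma
   applies. *)
have /nbhs_ballP[r /= r0 rU] : nbhs p (cg_dom i) by apply: open_nbhs_nbhs; split; [exact: (@cg_open _ _ G i)|].
pose W : domain R (3).*2 := ball_domain p r0.
have [sp cu sFW] := data i W rU.
have [||||||w wC|rho Hrho] := @invariants_sufficient R W (cg_gauge i) F (fun j => mk_sfun (sFW j)) sp cu.
- by move=> j q Wq; rewrite mk_sfunE.
- by move=> q /rU /ode[].
- by move=> q /rU /ode[].
- by move=> q /rU; exact: reg.
- by exists ds => // q /rU; exact: nds.
- by move=> q /rU; exact: inv.
- have [f Hf] := closed1_exact (enum_uniq 'I_7) (fun i j _ _ => wC i j).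
  by exists f => j; rewrite Hf // mem_enum.
have [B [k [L /= [sB uB k2 sL EL]]]] := helmholtz_variational Hrho.
exists (dom_set W), B, k, L; split.
  by split; [exact: dom_open|exact: ballxx|move=> q /rU /domU].
split=> // z Vz j; rewrite EL //; apply: eq_bigr => l _.
by congr (_ * (_ - _)); exact: (mk_sfunE (sFW l) Vz).
Qed.
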